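(* Let $\tau>0$. The map $$\mathsf{W}(v_1,v_2):=-\int_0^\tau(Av_1(t),v_2(t))\,dt$$ is well-defined for $(v_1,v_2)\in L^2(0,\tau;D(A))\times L^2(0,\tau;H)$ and satisfies $$|\mathsf{W}(v_1,v_2)|\le\left(\int_0^\tau|Av_1(t)|^2dt\right)^{1/2}\left(\int_0^\tau|v_2(t)|^2dt\right)^{1/2}.$$ Let $\mu,\hat\nu>0$, $N\in\mathbb{N}$, and let $v,\hat v$ be the (Leray–Hopf) solutions of the nudged equation and the sensitivity equation, respectively, and set $V_1=\sup_{t\in[0,\tau]}\|v(t)\|$, $\mathsf{W}=\mathsf{W}(v,\hat v)$, $\mathsf{G}=\int_0^\tau|P_N\hat v(t)|^2dt$. If $$\max\left\{\frac{4c_L^2V_1^2}{\mu},\frac{2c_LV_1}{N}\right\}\le\hat\nu,$$ then $$\frac12|\hat v(\tau)|^2+\frac{\hat\nu}2\int_0^\tau\|\hat v(t)\|^2dt+\frac\mu2\mathsf{G}\le\mathsf{W}\le\mu\mathsf{G}+\left(\frac1\mu+\frac{2}{\hat\nu N^2}\right)\int_0^\tau|Av(t)|^2dt.$$ If additionally $\mu\le\frac12\hat\nu N^2$, then $$\frac12|\hat v(\tau)|^2+\frac{\hat\nu}4\int_0^\tau\|\hat v(t)\|^2dt+\frac\mu2\int_0^\tau|\hat v(t)|^2dt\le\mathsf{W}\le\mu\mathsf{G}+\frac2\mu\int_0^\tau|Av(t)|^2dt.$$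
   Context: Setting: $\mathbb{T}^2=[0,2\pi]^2$ with periodic boundary conditions. $H$ is the space of mean-free, divergence-free vector fields in $L^2(\mathbb{T}^2)$ with inner product $(\cdot,\cdot)$ and norm $|\cdot|$; $V=H^1\cap H$ with norm $\|u\|=|\nabla u|$; $P_\sigma$ is the Leray projection, $A=P_\sigma(-\Delta)=-\Delta$ with domain $D(A)=H^2\cap V$; $B(u,v)=P_\sigma((u\cdot\nabla)v)$; $DB(v)\phi=B(v,\phi)+B(\phi,v)$. $P_N$ is the $L^2$-orthogonal projection onto Fourier wavenumbers $|k|\le N$, $Q_N=I-P_N$. $c_L$ is the constant in Ladyzhenskaya's inequality $|\phi|_{L^4}^2\le c_L\|\phi\||\phi|$. Standing assumptions: $f\in L^\infty(0,\infty;H)$, $u$ is a strong solution of $\partial_tu+\nu Au+B(u,u)=f$ with $\nu>0$ and $u(0)\in V$. The nudged equation is $\partial_tv+\hat\nu Av+B(v,v)=f-\mu P_Nv+\mu P_Nu$ with $v(0)=P_Nu(0)+Q_Nv_0$, $v_0\in V$; the sensitivity equation is $\partial_t\hat v+\hat\nu A\hat v+DB(v)\hat v=-\mu P_N\hat v-Av$, $\hat v(0)=0$. In this setting both have unique weak solutions, which are strong: $v,\hat v\in C([0,\tau];V)\cap L^2(0,\tau;D(A))$ with time derivatives in $L^2(0,\tau;H)$. *)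

(* Defs.v *)
From HB Require Import structures.
From mathcomp Require Import all_boot all_order all_algebra.
From mathcomp Require Import all_classical all_reals all_analysis.
Import Order.TTheory GRing.Theory Num.Theory.
Import numFieldNormedType.Exports.

Set Implicit Arguments.
Unset Strict Implicit.
Unset Printing Implicit Defensive.

Local Open Scope classical_set_scope.
Local Open Scope ring_scope.

Definition circle (R : realType) : set (measurableTypeR R) :=
  `[0, 2 * pi]%classic.

Lemma measurable_circle (R : realType) : measurable (@circle R).
Proof. exact: measurable_itv. Qed.

Lemma circle_finite (R : realType) :
  (@lebesgue_measure R (@circle R) < +oo)%E.
Proof. by rewrite lebesgue_measure_itv /=; case: ifP => _; rewrite ?ltry. Qed.

Definition circle_measure (R : realType) :
    {finite_measure set (measurableTypeR R) -> \bar R} :=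
  mfrestr (@measurable_circle R) (@circle_finite R).

(* A function on the torus is represented by a function on the plane of which
   only the values on [0, 2pi]^2 matter, since [torus] gives mass 0 to the
   complement of that square. Periodicity enters through the test functions. *)
Definition torus (R : realType) := (@circle_measure R \x @circle_measure R)%E.

Arguments torus : clear implicits.

Definition vfield (R : realType) := 'I_2 -> R * R -> R.

Section Torus.
Variable R : realType.
Implicit Types (g psi : R * R -> R) (phi u v w h : vfield R).

Definition dir (j : 'I_2) : R * R := if j == ord0 then (1, 0) else (0, 1).

Fixpoint Ck (n : nat) psi : Prop :=
  continuous psi /\
  if n is m.+1 then
    forall j, (forall x, derivable psi x (dir j)) /\ Ck m ('D_(dir j) psi)
  else True.

Definition periodic psi : Prop :=
  forall x y : R, psi (x + 2 * pi, y) = psi (x, y) /\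
                  psi (x, y + 2 * pi) = psi (x, y).

Definition test psi : Prop := (forall n, Ck n psi) /\ periodic psi.

Definition inL2 g : Prop := g \in Lfun (torus R) 2%:E.

Definition inL2v phi : Prop := forall i, inL2 (phi i).

Definition eq_ae u v : Prop :=
  {ae torus R, forall x, forall i, u i x = v i x}.

Definition is_wderiv (j : 'I_2) g g' : Prop :=
  inL2 g' /\
  forall psi, test psi ->
    \int[torus R]_x (g x * 'D_(dir j) psi x) = - \int[torus R]_x (g' x * psi x).

(* The weak derivative, unique up to a null set; 0 if there is none in L^2. *)
Definition wderiv (j : 'I_2) g : R * R -> R := xget (cst 0) (is_wderiv j g).

Definition inH1 g : Prop := inL2 g /\ forall j, exists g', is_wderiv j g g'.

Definition inH2 g : Prop := inH1 g /\ forall j, inH1 (wderiv j g).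

Definition inH phi : Prop :=
  [/\ inL2v phi,
      forall i, \int[torus R]_x phi i x = 0 &
      forall psi, test psi ->
        \int[torus R]_x (\sum_i phi i x * 'D_(dir i) psi x) = 0].

Definition inV phi : Prop := inH phi /\ forall i, inH1 (phi i).

Definition inDA phi : Prop := inV phi /\ forall i, inH2 (phi i).

Definition ip u v : R := \int[torus R]_x (\sum_i u i x * v i x).

Definition normH phi : R := Num.sqrt (ip phi phi).

Definition normV phi : R :=
  Num.sqrt (\sum_i \sum_j \int[torus R]_x (wderiv j (phi i) x) ^+ 2).

Definition normL4 phi : \bar R :=
  Lnorm (torus R) 4%:E (fun x => (Num.sqrt (\sum_i phi i x ^+ 2))%:E).

Definition ladyzhenskaya (cL : R) : Prop :=
  forall phi, inV phi ->
    (normL4 phi * normL4 phi <= (cL * normV phi * normH phi)%:E)%E.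

(* Set to 0 outside D(A), so that [A (v t)] makes sense for every t even if
   v t belongs to D(A) for almost every t only. *)
Definition A phi : vfield R :=
  if `[< inDA phi >] then
    fun i x => - \sum_j wderiv j (wderiv j (phi i)) x
  else fun _ _ => 0.

Definition freq (N : nat) (a : 'I_N.*2.+1) : int := a%:Z - N%:Z.

(* Fourier truncation to |k| <= N. The terms k and -k of the complex series add
   up to real ones:
   Re (hat phi_k e^(ik.x)) = (2pi)^-2 \int phi(y) cos (k . (x - y)) dy. *)
Definition PN (N : nat) phi : vfield R := fun i x =>
  \sum_(k : 'I_N.*2.+1 * 'I_N.*2.+1 |
        freq k.1 ^+ 2 + freq k.2 ^+ 2 <= N%:Z ^+ 2)
    ((2 * pi) ^+ 2)^-1 *
    \int[torus R]_y (phi i y * cos ((freq k.1)%:~R * (x.1 - y.1) +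
                                    (freq k.2)%:~R * (x.2 - y.2))).

Definition QN (N : nat) phi : vfield R := fun i x => phi i x - PN N phi i x.

(* [is_leray u v] : v = P_sigma u, the L^2-orthogonal projection of F on H. *)
Definition is_leray u v : Prop :=
  [/\ inL2v u, inH v & forall h, inH h -> ip (fun i x => u i x - v i x) h = 0].

Definition advection u v : vfield R :=
  fun i x => \sum_j u j x * wderiv j (v i) x.

(* Graphs of B and DB: [is_B u v b] means B(u,v) = b, and [is_DB v phi b] means
   DB(v)phi = b. *)
Definition is_B u v (b : vfield R) : Prop := is_leray (advection u v) b.

Definition is_DB v phi (b : vfield R) : Prop :=
  exists b1 b2, [/\ is_B v phi b1, is_B phi v b2 &
                    b = fun i x => b1 i x + b2 i x].

Implicit Types (vt wt ft ut gt : R -> vfield R) (tau : R).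

Local Notation leb := (@lebesgue_measure R).

Definition simple_field (s : R -> vfield R) : Prop :=
  exists m (E : 'I_m -> set R) (c : 'I_m -> vfield R),
    (forall j, measurable (E j) /\ inH (c j)) /\
    s = fun t i x => \sum_j \1_(E j) t * c j i x.

(* Strong (Bochner) measurability of an H-valued map on D. A class of maps
   equal for almost every t always has a representative for which the
   convergence holds everywhere on D; these are the representatives used. *)
Definition strongly_measurable (D : set R) wt : Prop :=
  (forall t, D t -> inH (wt t)) /\
  exists s : nat -> R -> vfield R, (forall n, simple_field (s n)) /\
    forall t, D t ->
      (fun n => normH (fun i x => s n t i x - wt t i x)) @ \oo --> (0 : R).

Definition L2H tau wt : Prop :=
  strongly_measurable `[0, tau] wt /\
  leb.-integrable `[0, tau] (fun t => (normH (wt t) ^+ 2)%:E).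

(* D(A) is normed by |A.|. *)
Definition L2DA tau wt : Prop :=
  {ae leb, forall t, t \in `[0, tau] -> inDA (wt t)} /\
  L2H tau (fun t => A (wt t)).

Definition LinftyH ft : Prop :=
  strongly_measurable `[0, +oo[ ft /\
  exists M : R, {ae leb, forall t, t \in `[0, +oo[ -> normH (ft t) <= M}.

Definition C0V tau vt : Prop :=
  (forall t, t \in `[0, tau] -> inV (vt t)) /\
  forall t, t \in `[0, tau] ->
    (fun s => normV (fun i x => vt s i x - vt t i x))
      @ within `[0, tau] (nbhs t) --> (0 : R).

(* v(t) = v(0) + \int_0^t w(s) ds in H on [0, tau]; the Bochner integral is
   characterised by its inner products with the elements of H. *)
Definition is_time_derivative tau vt wt : Prop :=
  forall h, inH h -> forall t, t \in `[0, tau] ->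
    ip (vt t) h = ip (vt 0) h + \int[leb]_(s in `[0, t]) ip (wt s) h.

Definition strong_regularity tau vt wt : Prop :=
  [/\ C0V tau vt, L2DA tau vt, L2H tau wt & is_time_derivative tau vt wt].

(* Solution on [0, tau] of dv/dt + nu A v + B(v,v) = g, v(0) = v0. Here and in
   [sensitivity], for data as regular as ours the Leray-Hopf solution is the
   strong one: the equation holds in H for almost every t. *)
Definition navier_stokes tau (nu : R) gt v0 vt : Prop :=
  eq_ae (vt 0) v0 /\
  exists wt, strong_regularity tau vt wt /\
    {ae leb, forall t, t \in `[0, tau] ->
      exists b, is_B (vt t) (vt t) b /\
        eq_ae (fun i x => wt t i x + nu * A (vt t) i x + b i x) (gt t)}.

Definition nudged tau (hnu mu : R) (N : nat) ft ut v0 vt : Prop :=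
  navier_stokes tau hnu
    (fun t i x => ft t i x - mu * PN N (vt t) i x + mu * PN N (ut t) i x)
    (fun i x => PN N (ut 0) i x + QN N v0 i x) vt.

(* Solution z on [0, tau] of
   dz/dt + hnu A z + DB(v) z = - mu P_N z - A v, z(0) = 0. *)
Definition sensitivity tau (hnu mu : R) (N : nat) vt zt : Prop :=
  eq_ae (zt 0) (fun _ _ => 0) /\
  exists wt, strong_regularity tau zt wt /\
    {ae leb, forall t, t \in `[0, tau] ->
      exists b, is_DB (vt t) (zt t) b /\
        eq_ae (fun i x => wt t i x + hnu * A (zt t) i x + b i x)
              (fun i x => - (mu * PN N (zt t) i x) - A (vt t) i x)}.

Definition W tau vt wt : R :=
  - \int[leb]_(t in `[0, tau]) ip (A (vt t)) (wt t).

End Torus.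

(* Main.v *)
Require Import Defs.
From mathcomp Require Import all_boot all_order all_algebra.
From mathcomp Require Import all_classical all_reals all_analysis.
From mathcomp Require Import measurable_realfun ring lra zify.
Import Order.TTheory GRing.Theory Num.Theory.
Import numFieldNormedType.Exports.

(** Testing the sensitivity equation with its solution z gives
    1/2 d/dt |z|^2 + hnu ||z||^2 + (B(z,v),z) = - mu |P_N z|^2 - (Av,z), because
    (B(v,z),z) = 0. By Ladyzhenskaya's inequality the stretching term is at most
    cL V1 ||z|| |z|, and |z|^2 <= |P_N z|^2 + ||z||^2 / N^2 lets the damping and
    the dissipation absorb it; integrating in time yields the lower bounds. For
    the upper bounds |(Av,z)| is split by Young's inequality in the same way, and
    the resulting ||z||^2 is absorbed in half of W by the lower bound.

    All facts on weak derivatives rest on the truncations P_M: trigonometric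
    polynomials are dense in L^2 of the torus, so P_M g -> g, and P_M commutes
    with weak differentiation. Hence P_M z replaces mollification in the
    integration by parts and in (B(v,z),z) = 0, where Ladyzhenskaya's inequality
    for z - P_M z provides the L^4 convergence. The energy identity follows from
    the weak formulation alone: F = |z|^2 - 2 \int (z',z) satisfies
    |F(t) - F(s)| <= 2 (t - s) \int_s^t |z'|^2, so it is constant. *)

Set Implicit Arguments.
Unset Strict Implicit.
Unset Printing Implicit Defensive.

Local Open Scope classical_set_scope.
Local Open Scope ring_scope.

(** * Real-valued integrals and square integrable functions *)

(** The thresholds on hnu come from one use of Young's inequality with c = cL V1: c ||z|| |z| <=
    hnu/4 ||z||^2 + c^2/hnu |z|^2. The condition 4 c^2/mu <= hnu makes c^2/hnu at most mu/4 on the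
    low modes, and 2 c/N <= hnu makes it at most hnu N^2/4 on the high ones, where N^2 |Q_N z|^2 <=
    ||z||^2; half of the dissipation and at least half of the damping survive. Two obstacles shape
    the rest. [wderiv] is an arbitrary choice among functions that agree almost everywhere, so weak
    derivatives are compared only through their inner products with L^2 functions. And z' is known
    only through pairings with time-independent fields of H, so no product rule for |z|^2 is at
    hand: |z(t)|^2 - |z(s)|^2 = (z(t) - z(s), z(t) + z(s)) supplies a fixed test field for each time
    interval, and replacing that field by 2 z(r) under the integral costs an error of second order
    only. *)

Lemma quadratic_cauchy_schwarz (R : realType) (a b c : R) :
  (forall l, 0 <= a + 2 * l * b + l ^+ 2 * c) ->
  `|b| <= Num.sqrt a * Num.sqrt c.
Proof.
move=> h.
have a0 : 0 <= a by have := h 0; rewrite mulr0 mul0r expr0n /= mul0r !addr0.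
have [->|b0] := eqVneq b 0; first by rewrite normr0 mulr_ge0 ?sqrtr_ge0.
have c0 : 0 < c.
  rewrite ltNge; apply/negP => c0.
  (* This l makes the affine part a + 2 l b equal to -1, which a nonpositive c cannot compensate. *)
  have := h (- (a + 1) / (2 * b)).
  have -> : a + 2 * (- (a + 1) / (2 * b)) * b = -1 by field.
  have := sqr_ge0 (- (a + 1) / (2 * b)); set s := _ ^+ 2 => s0.
  have : s * c <= 0 by rewrite mulr_ge0_le0.
  lra.
have bc : b ^+ 2 <= a * c.
  (* The minimiser of the quadratic. *)
  have := h (- b / c).
  have -> : a + 2 * (- b / c) * b + (- b / c) ^+ 2 * c = (a * c - b ^+ 2) / c.
    by field; rewrite gt_eqF.
  by rewrite pmulr_lge0 ?invr_gt0// subr_ge0.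
by rewrite -sqrtr_sqr -sqrtrM//; exact: ler_wsqrtr.
Qed.

Section RealIntegral.
Context d (T : measurableType d) (R : realType).
Variable mu : {measure set T -> \bar R}.
Variables (D : set T) (mD : measurable D).
Implicit Types f g : T -> R.

Definition rint f := mu.-integrable D (EFin \o f).

Lemma rint_measurable f : rint f -> measurable_fun D f.
Proof. by move=> /measurable_int /measurable_EFinP. Qed.

Lemma rintD f g : rint f -> rint g -> rint (fun x => f x + g x).
Proof.
by move=> fi gi; apply: eq_integrable (integrableD mD fi gi) => // x _ /=; rewrite EFinD.
Qed.

Lemma rintZ a f : rint f -> rint (fun x => a * f x).
Proof.
by move=> fi; apply: eq_integrable (integrableZl mD a fi) => // x _ /=; rewrite EFinM.
Qed.

Lemma eq_rint f g : (forall x, D x -> f x = g x) -> rint f -> rint g.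
Proof. by move=> fg; apply: (eq_integrable mD) => x /set_mem Dx /=; rewrite fg. Qed.

Lemma rintN f : rint f -> rint (fun x => - f x).
Proof. by move=> /(rintZ (-1)); apply: eq_rint => x _; rewrite mulN1r. Qed.

Lemma rintB f g : rint f -> rint g -> rint (fun x => f x - g x).
Proof. by move=> fi gi; apply: rintD => //; exact: rintN. Qed.

Lemma rint0 : rint (fun=> 0).
Proof. exact: integrable0. Qed.

Lemma rint_sum (I : Type) (s : seq I) (P : pred I) (F : I -> T -> R) :
  (forall i, P i -> rint (F i)) -> rint (fun x => \sum_(i <- s | P i) F i x).
Proof.
move=> h; elim: s => [|i s ih].
  by under eq_fun do rewrite big_nil; exact: rint0.
under eq_fun do rewrite big_cons.
by case: (boolP (P i)) => // Pi; apply: rintD => //; exact: h.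
Qed.

Lemma le_rint f g : measurable_fun D f -> (forall x, D x -> `|f x| <= g x) ->
  rint g -> rint f.
Proof.
move=> mf fg; apply: (le_integrable mD); first exact/measurable_EFinP.
move=> x Dx; rewrite /= lee_fin (le_trans (fg _ Dx))//.
exact: ler_norm.
Qed.

Lemma rint_norm f : rint f -> rint (fun x => `|f x|).
Proof. exact: integrable_norm. Qed.

Lemma Rintegral0 : \int[mu]_(x in D) 0 = 0.
Proof. by rewrite /Rintegral integral0. Qed.

Lemma RintegralN f : rint f -> \int[mu]_(x in D) (- f x) = - \int[mu]_(x in D) f x.
Proof.
move=> fi; rewrite -[RHS]mulN1r -RintegralZl//.
by apply: eq_Rintegral => x _; rewrite mulN1r.
Qed.

Lemma Rintegral_sum (I : Type) (s : seq I) (P : pred I) (F : I -> T -> R) :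
  (forall i, P i -> rint (F i)) ->
  \int[mu]_(x in D) (\sum_(i <- s | P i) F i x) =
  \sum_(i <- s | P i) \int[mu]_(x in D) F i x.
Proof.
move=> h; elim: s => [|i s ih].
  by under eq_Rintegral do rewrite big_nil; rewrite Rintegral0 big_nil.
under eq_Rintegral do rewrite big_cons.
rewrite big_cons; case: (boolP (P i)) => // Pi.
by rewrite RintegralD ?ih//; [exact: h|exact: rint_sum].
Qed.

Lemma ae_eq_Rintegral f g : measurable_fun D f -> measurable_fun D g ->
  {ae mu, forall x, D x -> f x = g x} ->
  \int[mu]_(x in D) f x = \int[mu]_(x in D) g x.
Proof.
move=> mf mg fg; congr fine; apply: ae_eq_integral => //.
- exact/measurable_EFinP.
- exact/measurable_EFinP.
- by apply: filterS fg => x h Dx; rewrite h.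
Qed.

Lemma ae_le_Rintegral f g : rint f -> rint g ->
  {ae mu, forall x, D x -> f x <= g x} ->
  \int[mu]_(x in D) f x <= \int[mu]_(x in D) g x.
Proof.
move=> fi gi fg.
rewrite -subr_ge0 -RintegralB//.
have mgf := rint_measurable (rintB gi fi).
(* Almost everywhere g - f equals its absolute value, which is nonnegative at every point. *)
rewrite (@ae_eq_Rintegral _ (fun x => `|g x - f x|))//; first exact: Rintegral_ge0.
- exact: measurableT_comp mgf.
- by apply: filterS fg => x h Dx; rewrite ger0_norm// subr_ge0 h.
Qed.

(** Kept general in the measure and the domain: it is used over the torus in space and over
    intervals in time. *)
Definition sqint f := measurable_fun D f /\ rint (fun x => f x ^+ 2).

Lemma sqintM f g : sqint f -> sqint g -> rint (fun x => f x * g x).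
Proof.
move=> [mf f2] [mg g2].
apply: (@le_rint _ (fun x => f x ^+ 2 + g x ^+ 2)).
- exact: measurable_funM.
- move=> x _; rewrite ler_norml.
  have := sqr_ge0 (f x + g x); have := sqr_ge0 (f x - g x).
  have := sqr_ge0 (f x); have := sqr_ge0 (g x).
  by move=> ? ? ? ?; apply/andP; split; nra.
- exact: rintD.
Qed.

Lemma sqintD f g : sqint f -> sqint g -> sqint (fun x => f x + g x).
Proof.
move=> hf hg; have := sqintM hf hg; case: hf hg => [mf f2] [mg g2] fg.
split; first exact: measurable_funD.
apply: (@eq_rint (fun x => f x ^+ 2 + (2 * (f x * g x) + g x ^+ 2))).
  by move=> x _; ring.
by apply: rintD => //; apply: rintD => //; exact: rintZ.
Qed.

Lemma sqintZ a f : sqint f -> sqint (fun x => a * f x).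
Proof.
move=> [mf f2]; split; first exact: measurable_funM.
apply: (@eq_rint (fun x => a ^+ 2 * f x ^+ 2)); first by move=> x _; ring.
exact: rintZ.
Qed.

Lemma sqintN f : sqint f -> sqint (fun x => - f x).
Proof. by move=> /(sqintZ (-1)); under eq_fun do rewrite mulN1r. Qed.

Lemma sqintB f g : sqint f -> sqint g -> sqint (fun x => f x - g x).
Proof. by move=> ? ?; apply: sqintD => //; exact: sqintN. Qed.

Lemma sqint0 : sqint (fun=> 0).
Proof.
split; first exact: measurable_cst.
by under eq_fun do rewrite expr0n /=; exact: rint0.
Qed.

Lemma sqint_sum (I : Type) (s : seq I) (P : pred I) (F : I -> T -> R) :
  (forall i, P i -> sqint (F i)) -> sqint (fun x => \sum_(i <- s | P i) F i x).
Proof.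
move=> h; elim: s => [|i s ih].
  by under eq_fun do rewrite big_nil; exact: sqint0.
under eq_fun do rewrite big_cons.
by case: (boolP (P i)) => // Pi; apply: sqintD => //; exact: h.
Qed.

Lemma bounded_sqint f c : measurable_fun D f -> (mu D < +oo)%E ->
  (forall x, D x -> `|f x| <= c) -> sqint f.
Proof.
move=> mf muD fc; split => //.
apply: (@le_rint _ (fun=> c ^+ 2)).
- exact: measurable_funX.
- move=> x Dx; rewrite normrX ler_sqr ?nnegrE//; first exact: fc.
  exact: le_trans (fc _ Dx).
- apply/integrableP; split; first exact/measurable_EFinP.
  under eq_integral do rewrite /= ger0_norm ?sqr_ge0//.
  by rewrite integral_cst// lte_mul_pinfty// lee_fin sqr_ge0.
Qed.

(** The quadratic criterion, applied to the integrals of (f + l g)^2. *)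
Lemma integral_cauchy_schwarz f g : sqint f -> sqint g ->
  `|\int[mu]_(x in D) (f x * g x)| <=
  Num.sqrt (\int[mu]_(x in D) f x ^+ 2) * Num.sqrt (\int[mu]_(x in D) g x ^+ 2).
Proof.
move=> hf hg; have fg := sqintM hf hg; case: (hf) (hg) => [mf f2] [mg g2].
apply: quadratic_cauchy_schwarz => l.
rewrite -!RintegralZl//.
rewrite -!RintegralD//; [|by do ?[apply: rintD|apply: rintZ]..].
apply: Rintegral_ge0 => x _.
have -> : f x ^+ 2 + 2 * l * (f x * g x) + l ^+ 2 * g x ^+ 2 =
  (f x + l * g x) ^+ 2 by ring.
exact: sqr_ge0.
Qed.

End RealIntegral.

(** * Plane waves and test functions *)

Section TrigonometricSystem.
Variable R : realType.
Implicit Types (g h psi : R * R -> R) (k l : int * int) (a b : R) (x : R * R).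

(** The phase a keeps everything real and within one family: a = - pi / 2 gives the sine, and
    differentiation shifts a by pi / 2. *)
Definition wave k a x : R := cos (k.1%:~R * x.1 + k.2%:~R * x.2 + a).

Local Notation plane := (measurableTypeR R * measurableTypeR R)%type.

Lemma measurable_wave k a : measurable_fun [set: plane] (wave k a).
Proof.
rewrite /wave; apply: measurableT_comp.
  by apply: continuous_measurable_fun; exact: continuous_cos.
by apply: measurable_funD => //; apply: measurable_funD;
  apply: measurable_funM => //.
Qed.

Lemma wave_continuous k a : continuous (wave k a).
Proof.
move=> x; apply: continuous_comp; last exact: continuous_cos.
apply: continuousD; last exact: cst_continuous.
apply: continuousD; apply: continuousM; try exact: cst_continuous.
  exact: cvg_fst.
exact: cvg_snd.
Qed.

Lemma norm_wave_le1 k a x : `|wave k a x| <= 1.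
Proof. by rewrite ler_norml; apply/andP; split; [exact: cos_geN1|exact: cos_le1]. Qed.

Lemma is_derive_line psi x v d : is_derive (0 : R) 1 (fun t => psi (t *: v + x)) d ->
  is_derive x v psi d.
Proof.
move=> [h1 h2].
have e : (fun h : R => h^-1 *: ((psi \o shift x) (h *: v) - psi x)) =
  (fun h : R => h^-1 *: (((fun t => psi (t *: v + x)) \o shift 0) (h *: (1 : R))
     - (fun t => psi (t *: v + x)) 0)).
  apply/funext => h /=; rewrite addr0 scale0r add0r.
  by rewrite /GRing.scale /= mulr1.
by split; [rewrite /derivable e|rewrite /derive e].
Qed.

Definition wavecoord (j : 'I_2) k : int := if j == ord0 then k.1 else k.2.

Lemma is_derive_wave j k a x :
  is_derive x (dir R j) (wave k a) ((wavecoord j k)%:~R * wave k (a + pi / 2) x).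
Proof.
apply: is_derive_line.
set s := k.1%:~R * x.1 + k.2%:~R * x.2 + a.
have -> : (fun t => wave k a (t *: dir R j + x)) =
    (fun t : R => cos (t * (wavecoord j k)%:~R + s)).
  apply/funext => t; rewrite /wave /dir /wavecoord /s; congr cos.
  by case: ifP => _ /=; rewrite /GRing.scale /= ; ring.
have -> : wave k (a + pi / 2) x = - sin s by rewrite /wave addrA cosDpihalf.
apply: is_derive_eq.
rewrite /GRing.scale /= !mul0r !add0r; ring.
Qed.

Lemma derive_wave j k a :
  'D_(dir R j) (wave k a) = fun x => (wavecoord j k)%:~R * wave k (a + pi / 2) x.
Proof. by apply/funext => x; have /@derive_val := is_derive_wave j k a x. Qed.

Lemma CkD n g h : Ck n g -> Ck n h -> Ck n (fun x => g x + h x).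
Proof.
elim: n g h => [|n ih] g h [cg Hg] [ch Hh]; split => //.
- by move=> x; apply: continuousD; [exact: cg|exact: ch].
- by move=> x; apply: continuousD; [exact: cg|exact: ch].
move=> j; have [dg Dg] := Hg j; have [dh Dh] := Hh j; split.
  by move=> x; apply: derivableD.
suff -> : 'D_(dir R j) (fun x => g x + h x) =
  fun x => 'D_(dir R j) g x + 'D_(dir R j) h x by exact: ih.
by apply/funext => x; rewrite -deriveD.
Qed.

Lemma CkZ n c g : Ck n g -> Ck n (fun x => c * g x).
Proof.
elim: n g => [|n ih] g [cg Hg]; split => //.
- by move=> x; apply: continuousM; [exact: cst_continuous|exact: cg].
- by move=> x; apply: continuousM; [exact: cst_continuous|exact: cg].
move=> j; have [dg Dg] := Hg j; split.
  by move=> x; apply: derivableM => //; exact: derivable_cst.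
suff -> : 'D_(dir R j) (fun x => c * g x) =
  fun x => c * 'D_(dir R j) g x by exact: ih.
by apply/funext => x; exact: (deriveMl c (dg x)).
Qed.

Lemma CkW n g : Ck n.+1 g -> Ck n g.
Proof.
elim: n g => [|n ih] g [cg Hg]; split => //.
by move=> j; have [dg Dg] := Hg j; split => //; exact: ih.
Qed.

Lemma CkM n g h : Ck n g -> Ck n h -> Ck n (fun x => g x * h x).
Proof.
elim: n g h => [|n ih] g h kg kh; case: (kg) => [cg Hg]; case: (kh) => [ch Hh];
  split => //.
- by move=> x; apply: continuousM; [exact: cg|exact: ch].
- by move=> x; apply: continuousM; [exact: cg|exact: ch].
move=> j; have [dg Dg] := Hg j; have [dh Dh] := Hh j; split.
  by move=> x; apply: derivableM.
suff -> : 'D_(dir R j) (fun x => g x * h x) =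
  fun x => g x * 'D_(dir R j) h x + h x * 'D_(dir R j) g x.
  by apply: CkD; apply: ih => //; exact: CkW.
by apply/funext => x; have := deriveM (dg x) (dh x).
Qed.

Lemma Ck0 n : Ck n (fun _ : R * R => 0 : R).
Proof.
elim: n => [|n ih]; (split; first exact: cst_continuous) => //.
move=> j; split; first by move=> x; exact: derivable_cst.
suff -> : 'D_(dir R j) (fun _ : R * R => 0 : R) = fun=> 0 by [].
by apply/funext => x; rewrite derive_cst.
Qed.

Lemma Ck_wave n k a : Ck n (wave k a).
Proof.
(* The phase is generalised because each derivative shifts it. *)
elim: n a => [|n ih] a; (split; first exact: wave_continuous) => //.
move=> j; split; first by move=> x; have /@ex_derive := is_derive_wave j k a x.
by rewrite derive_wave; apply: CkZ.
Qed.

Lemma periodic_cosM (m : int) (t : R) : cos (t + m%:~R * (2 * pi)) = cos t.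
Proof.
have H (n : nat) (s : R) : cos (s + n%:R * (2 * pi)) = cos s.
  elim: n s => [|n ih] s; first by rewrite mul0r addr0.
  by rewrite -natr1 mulrDl mul1r addrA (mulr_natl pi 2) cosD2pi -(mulr_natl pi 2) ih.
case: m => n; first exact: H.
rewrite -[in RHS](subrK (n.+1%:R * (2 * pi)) t) H NegzE; congr cos.
by rewrite mulrNz mulNr.
Qed.

Lemma periodic_wave k a : Defs.periodic (wave k a).
Proof.
move=> x y; split; rewrite /wave /=.
- rewrite -[RHS](periodic_cosM k.1); congr cos; ring.
- rewrite -[RHS](periodic_cosM k.2); congr cos; ring.
Qed.

Lemma test_wave k a : test (wave k a).
Proof. by split; [move=> n; exact: Ck_wave|exact: periodic_wave]. Qed.

Lemma testD g h : test g -> test h -> test (fun x => g x + h x).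
Proof.
move=> [g1 g2] [h1 h2]; split; first by move=> n; exact: CkD.
by move=> x y; case: (g2 x y) (h2 x y) => -> -> [-> ->].
Qed.

Lemma testM g h : test g -> test h -> test (fun x => g x * h x).
Proof.
move=> [g1 g2] [h1 h2]; split; first by move=> n; exact: CkM.
by move=> x y; case: (g2 x y) (h2 x y) => -> -> [-> ->].
Qed.

Lemma testZ c g : test g -> test (fun x => c * g x).
Proof.
move=> [g1 g2]; split; first by move=> n; exact: CkZ.
by move=> x y; case: (g2 x y) => -> ->.
Qed.

Lemma test0 : test (fun _ : R * R => 0 : R).
Proof. by split; first by move=> n; exact: Ck0. Qed.

Lemma test_sum (I : Type) (s : seq I) (P : pred I) (F : I -> R * R -> R) :
  (forall i, test (F i)) -> test (fun x => \sum_(i <- s | P i) F i x).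
Proof.
move=> h; elim: s => [|i s ih].
  by under eq_fun do rewrite big_nil; exact: test0.
under eq_fun do rewrite big_cons.
by case: (boolP (P i)) => // Pi; exact: testD.
Qed.

Lemma test_derivable psi j x : test psi -> derivable psi x (dir R j).
Proof. by move=> [/(_ 1%N)[_ /(_ j)[d _]] _]; exact: d. Qed.

Lemma test_continuous psi : test psi -> continuous psi.
Proof. by move=> [/(_ 0%N)[]]. Qed.

Lemma derive_test_sum j (I : Type) (s : seq I) (P : pred I) (F : I -> R * R -> R) :
  (forall i, test (F i)) ->
  'D_(dir R j) (fun x => \sum_(i <- s | P i) F i x) =
  fun x => \sum_(i <- s | P i) 'D_(dir R j) (F i) x.
Proof.
move=> h; elim: s => [|i s ih].
  rewrite (_ : (fun x => _) = cst 0); last by apply/funext => x; rewrite big_nil.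
  by apply/funext => x; rewrite derive_cst big_nil.
apply/funext => x; rewrite big_cons.
have /= <- := congr1 (fun f => f x) ih.
rewrite (_ : (fun x => _) = fun x => if P i then F i x + \sum_(i <- s | P i) F i x
  else \sum_(i <- s | P i) F i x); last by apply/funext => y; rewrite big_cons.
case: (boolP (P i)) => // Pi.
rewrite -deriveD//; first exact: test_derivable.
by apply: test_derivable; exact: test_sum.
Qed.

Lemma derive_waveE j k a x :
  'D_(dir R j) (wave k a) x = (wavecoord j k)%:~R * wave k (a + pi / 2) x.
Proof. by have /@derive_val := is_derive_wave j k a x. Qed.

Lemma derive_testZE j c g x : test g ->
  'D_(dir R j) (fun x => c * g x) x = c * 'D_(dir R j) g x.
Proof. by move=> tg; exact: (deriveMl c (@test_derivable _ j x tg)). Qed.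

Lemma derive_testDE j g h x : test g -> test h ->
  'D_(dir R j) (fun x => g x + h x) x = 'D_(dir R j) g x + 'D_(dir R j) h x.
Proof.
by move=> tg th; exact: (deriveD (@test_derivable _ j x tg) (@test_derivable _ j x th)).
Qed.

Lemma derive_testME j g h x : test g -> test h ->
  'D_(dir R j) (fun x => g x * h x) x = g x * 'D_(dir R j) h x + h x * 'D_(dir R j) g x.
Proof.
by move=> tg th; exact: (deriveM (@test_derivable _ j x tg) (@test_derivable _ j x th)).
Qed.

End TrigonometricSystem.

(** * The measure of the torus *)

Section TorusMeasure.
Variable R : realType.
Implicit Types (g h psi : R * R -> R) (k l : int * int) (a b : R) (x : R * R).

Local Notation plane := (measurableTypeR R * measurableTypeR R)%type.

Lemma two_pi_gt0 : 0 < 2 * pi :> R.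
Proof. by rewrite mulr_gt0 ?pi_gt0. Qed.

Lemma circle_measureT : @circle_measure R setT = (2 * pi)%:E.
Proof.
have -> : @circle_measure R setT = lebesgue_measure (setT `&` @circle R) by [].
by rewrite setTI lebesgue_measure_itv /= lte_fin two_pi_gt0 oppr0 adde0.
Qed.

Lemma circle_measureT_lty : (@circle_measure R setT < +oo)%E.
Proof. by rewrite circle_measureT ltry. Qed.

Lemma torusT : torus R setT = ((2 * pi) ^+ 2)%:E.
Proof.
by rewrite -setXTT /torus product_measure1E//= circle_measureT -EFinM.
Qed.

#[export] Instance torus_ae_filter : Filter (almost_everywhere (torus R)).
Proof. exact: (ae_filter_ringOfSetsType (@circle_measure R \x @circle_measure R)%E). Qed.

Lemma torusT_lty : (torus R setT < +oo)%E.
Proof. by rewrite torusT ltry. Qed.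

Lemma bounded_rint g c : measurable_fun [set: plane] g -> (forall x, `|g x| <= c) ->
  rint (torus R) setT g.
Proof.
move=> mg gc; apply: (@le_rint _ _ _ (torus R) setT measurableT g (fun x => 1 + g x ^+ 2)) => //.
  move=> x _; rewrite -[X in 1 + X](real_normK (num_real _)).
  by have := sqr_ge0 (`|g x| - 1); have := normr_ge0 (g x) => ? ?; nra.
apply: rintD => //.
  have [] := @bounded_sqint _ _ _ (torus R) setT measurableT (cst 1) 1 => //.
  - exact: torusT_lty.
  - by move=> x _; rewrite /= normr1.
  - by move=> _; apply: eq_rint => // x _; rewrite /= expr1n.
by have [] := @bounded_sqint _ _ _ (torus R) setT measurableT g c mg torusT_lty
  (fun x _ => gc x).
Qed.

Lemma integral_circle (f : R -> R) c : measurable_fun [set: measurableTypeR R] f ->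
  (forall x : R, `|f x| <= c) ->
  (\int[@circle_measure R]_x (f x)%:E =
   \int[@lebesgue_measure R]_(x in `[0%R, (2 * pi)%R]) (f x)%:E)%E.
Proof.
move=> mf fc.
have c0 : 0 <= c by apply: le_trans (fc 0).
have fi : (@circle_measure R).-integrable setT (EFin \o f).
  apply: (@measurable_bounded_integrable _ _ _ (@circle_measure R)) => //.
    exact: circle_measureT_lty.
  exists c; split; first exact: num_real.
  by move=> y cy x _; apply: (le_trans (fc x)); exact: ltW.
rewrite (@negligible_integral _ _ _ _ _ (~` @circle R))//.
- rewrite setTD setCK; apply: eq_measure_integral => B mB Bc.
  transitivity (@lebesgue_measure R (B `&` @circle R)); first by [].
  by rewrite setIidl.
- by apply: measurableC; exact: measurable_circle.
- transitivity (@lebesgue_measure R (~` @circle R `&` @circle R)); first by [].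
  by rewrite setICl measure0.
Qed.

Lemma integral_circle_cos (m : int) a :
  (\int[@circle_measure R]_x (cos (m%:~R * x + a))%:E =
   (if m == 0 then 2 * pi * cos a else 0)%:E)%E.
Proof.
have mc : measurable_fun [set: measurableTypeR R] (fun x : R => cos (m%:~R * x + a)).
  apply: measurableT_comp.
    by apply: continuous_measurable_fun; exact: continuous_cos.
  by apply: measurable_funD => //; exact: measurable_funM.
rewrite (@integral_circle _ 1)//; last first.
  by move=> x; rewrite ler_norml; apply/andP; split; [exact: cos_geN1|exact: cos_le1].
have [->|m0] := eqVneq m 0.
  under eq_integral do rewrite mul0r add0r.
  rewrite integral_cst//= lebesgue_measure_itv /= lte_fin two_pi_gt0.
  by rewrite oppr0 adde0 -EFinM mulrC.
have m0' : m%:~R != 0 :> R by rewrite intr_eq0.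
pose F (x : R) : R := m%:~R^-1 * sin (m%:~R * x + a).
have cF : continuous F.
  rewrite /F => x; apply: (@continuousM _ _ (cst _)); first exact: cst_continuous.
  apply: (@continuous_comp _ _ _ (fun x : R => m%:~R * x + a)); last exact: continuous_sin.
  apply: continuousD; last exact: cst_continuous.
  by apply: (@continuousM _ _ (cst _)); [exact: cst_continuous|exact: cvg_id].
have dF (x : R) : is_derive x (1 : R) F (cos (m%:~R * x + a)).
  apply: is_derive_eq.
  by rewrite /GRing.scale /=; field.
rewrite (@continuous_FTC2 _ _ F 0 (2 * pi))//.
- rewrite /F mulr0 add0r.
  have -> : sin (m%:~R * (2 * pi) + a) = sin a.
    (* A shift by pi / 2 turns the sine into a cosine, to which [periodic_cosM] applies. *)
    rewrite -[in LHS](subrK (pi / 2) (m%:~R * _ + a)) sinDpihalf.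
    have -> : m%:~R * (2 * pi) + a - pi / 2 = (a - pi / 2) + m%:~R * (2 * pi) by ring.
    by rewrite periodic_cosM -sinDpihalf subrK.
  by rewrite subee.
- exact: two_pi_gt0.
- apply: continuous_subspaceT => x; apply: continuous_comp; last exact: continuous_cos.
  apply: continuousD; last exact: cst_continuous.
  by apply: (@continuousM _ _ (cst _)); [exact: cst_continuous|exact: cvg_id].
- split.
  + by move=> x _; have /@ex_derive := dF x.
  + by apply: cvg_at_right_filter; exact: cF.
  + by apply: cvg_at_left_filter; exact: cF.
- by move=> x _; rewrite derive1E; have /@derive_val := dF x.
Qed.

Lemma rint_wave k a : rint (torus R) setT (wave k a).
Proof.
by apply: (@bounded_rint _ 1); [exact: measurable_wave|move=> x; exact: norm_wave_le1].
Qed.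

Lemma Rintegral_wave k a : \int[torus R]_x wave k a x =
  if k == (0, 0) then (2 * pi) ^+ 2 * cos a else 0.
Proof.
rewrite /Rintegral -integral12_prod_meas1; last exact: rint_wave.
rewrite /fubini_F; under eq_integral => x _.
  under eq_integral => y _.
    have -> : wave k a (x, y) = cos (k.2%:~R * y + (k.1%:~R * x + a)).
      by rewrite /wave /=; congr cos; ring.
    over.
  rewrite integral_circle_cos; over.
case: k => k1 k2 /=; rewrite xpair_eqE andbC.
have [k20|k20] := eqVneq k2 0; last by rewrite integral0.
under eq_integral do rewrite EFinM.
rewrite integralZl//; last first.
  apply: (@measurable_bounded_integrable _ _ _ (@circle_measure R)) => //.
  - exact: circle_measureT_lty.
  - apply: measurableT_comp.
      by apply: continuous_measurable_fun; exact: continuous_cos.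
    by apply: measurable_funD => //; exact: measurable_funM.
  - exists 1; split; first exact: num_real.
    move=> c c1 x _ /=; apply: le_trans (ltW c1); rewrite ler_norml.
    by apply/andP; split; [exact: cos_geN1|exact: cos_le1].
rewrite integral_circle_cos -EFinM /=; case: ifP => _; ring.
Qed.

(** Product-to-sum; it yields both the orthogonality relations and the closure of trigonometric
    polynomials under products. *)
Lemma wave_mul k a l b x : wave k a x * wave l b x =
  2^-1 * wave (k.1 - l.1, k.2 - l.2) (a - b) x +
  2^-1 * wave (k.1 + l.1, k.2 + l.2) (a + b) x.
Proof.
rewrite /wave /= !intrB !intrD.
set s := k.1%:~R * x.1 + k.2%:~R * x.2 + a.
set t := l.1%:~R * x.1 + l.2%:~R * x.2 + b.
have -> : (k.1%:~R - l.1%:~R) * x.1 + (k.2%:~R - l.2%:~R) * x.2 + (a - b) = s - t.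
  by rewrite /s /t; ring.
have -> : (k.1%:~R + l.1%:~R) * x.1 + (k.2%:~R + l.2%:~R) * x.2 + (a + b) = s + t.
  by rewrite /s /t; ring.
by rewrite (cosB s t) (cosD s t); field.
Qed.

End TorusMeasure.

(** * Fourier truncation *)

Section Projection.
Variable R : realType.
Implicit Types (g h psi : R * R -> R) (k l : int * int) (a b : R) (x : R * R).
Local Notation plane := (measurableTypeR R * measurableTypeR R)%type.
Local Notation L2 := (sqint (torus R) setT).

Lemma inL2_sqint g : inL2 g -> L2 g.
Proof.
move=> hg; split; last exact: Lfun2_integrable_sqr.
by move: hg => /andP[]; rewrite inE.
Qed.

Lemma sqint_inL2 g : L2 g -> inL2 g.
Proof.
move=> [mg /integrableP[_ gi]]; apply/andP; rewrite !inE; split=> //=.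
rewrite /finite_norm unlock /= poweR_lty//; apply: le_lt_trans gi.
apply: ge0_le_integral => //.
- apply/measurable_EFinP; apply: (@measurableT_comp _ _ _ _ _ _ (fun x : R => x `^ 2)) => //.
  exact: measurableT_comp.
- by apply: measurableT_comp => //; apply/measurable_EFinP; exact: measurable_funX.
- by move=> x _ /=; rewrite lee_fin powR_mulrn// normrX.
Qed.

Definition inner g h : R := \int[torus R]_x (g x * h x).

Lemma innerC g h : inner g h = inner h g.
Proof. by apply: eq_Rintegral => x _; rewrite mulrC. Qed.

Lemma innerDl g1 g2 h : L2 g1 -> L2 g2 -> L2 h ->
  inner (fun x => g1 x + g2 x) h = inner g1 h + inner g2 h.
Proof.
move=> h1 h2 h3; rewrite /inner -RintegralD//; [|exact: sqintM..].
by apply: eq_Rintegral => x _; rewrite mulrDl.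
Qed.

Lemma innerZl c g h : L2 g -> L2 h -> inner (fun x => c * g x) h = c * inner g h.
Proof.
move=> h1 h2; rewrite /inner -RintegralZl//; last exact: sqintM.
by apply: eq_Rintegral => x _; rewrite mulrA.
Qed.

Lemma innerNl g h : L2 g -> L2 h -> inner (fun x => - g x) h = - inner g h.
Proof.
move=> h1 h2; rewrite -mulN1r -innerZl//; apply: eq_Rintegral => x _.
by rewrite mulN1r.
Qed.

Lemma innerBl g1 g2 h : L2 g1 -> L2 g2 -> L2 h ->
  inner (fun x => g1 x - g2 x) h = inner g1 h - inner g2 h.
Proof. by move=> h1 h2 h3; rewrite innerDl ?innerNl//; exact: sqintN. Qed.

Lemma inner_suml (I : Type) (s : seq I) (P : pred I) (F : I -> R * R -> R) h :
  (forall i, P i -> L2 (F i)) -> L2 h ->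
  inner (fun x => \sum_(i <- s | P i) F i x) h = \sum_(i <- s | P i) inner (F i) h.
Proof.
move=> hF hh; rewrite /inner -Rintegral_sum//; last first.
  by move=> i Pi; apply: sqintM => //; exact: hF.
by apply: eq_Rintegral => x _; rewrite mulr_suml.
Qed.

Lemma innerDr g h1 h2 : L2 g -> L2 h1 -> L2 h2 ->
  inner g (fun x => h1 x + h2 x) = inner g h1 + inner g h2.
Proof. by move=> *; rewrite innerC innerDl// !(innerC g). Qed.

Lemma innerBr g h1 h2 : L2 g -> L2 h1 -> L2 h2 ->
  inner g (fun x => h1 x - h2 x) = inner g h1 - inner g h2.
Proof. by move=> *; rewrite innerC innerBl// !(innerC g). Qed.

Lemma innerZr c g h : L2 g -> L2 h -> inner g (fun x => c * h x) = c * inner g h.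
Proof. by move=> *; rewrite innerC innerZl// (innerC g). Qed.

Lemma inner_sumr (I : Type) (s : seq I) (P : pred I) (F : I -> R * R -> R) g :
  L2 g -> (forall i, P i -> L2 (F i)) ->
  inner g (fun x => \sum_(i <- s | P i) F i x) = \sum_(i <- s | P i) inner g (F i).
Proof.
by move=> *; rewrite innerC inner_suml//; under eq_bigr do rewrite innerC.
Qed.

Lemma inner_ge0 g : 0 <= inner g g.
Proof. by apply: Rintegral_ge0 => x _; rewrite -expr2 sqr_ge0. Qed.

Lemma inner_sqr g : inner g g = \int[torus R]_x g x ^+ 2.
Proof. by []. Qed.

Lemma inner_cauchy_schwarz g h : L2 g -> L2 h ->
  `|inner g h| <= Num.sqrt (inner g g) * Num.sqrt (inner h h).
Proof. by move=> h1 h2; exact: integral_cauchy_schwarz. Qed.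

Lemma L2_wave k a : L2 (wave k a).
Proof.
apply: (@bounded_sqint _ _ _ (torus R) setT measurableT _ 1).
- exact: measurable_wave.
- exact: torusT_lty.
- by move=> x _; exact: norm_wave_le1.
Qed.

(** The waves of k and -k agree up to the sign of the phase, so there are two resonances: k = l
    through the difference of the frequencies, k = -l through their sum. *)
Lemma inner_wave k a l b : inner (wave k a) (wave l b) =
  (2 * pi) ^+ 2 / 2 * ((if k == l then cos (a - b) else 0) +
                       (if k == (- l.1, - l.2) then cos (a + b) else 0)).
Proof.
rewrite /inner; under eq_Rintegral do rewrite wave_mul.
rewrite RintegralD//; [|by apply: rintZ => //; exact: rint_wave..].
rewrite !RintegralZl//; [|exact: rint_wave..].
rewrite !Rintegral_wave; case: k l => k1 k2 [l1 l2] /=.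
by rewrite !xpair_eqE !subr_eq0 !addr_eq0; do 2 case: ifP => _; field.
Qed.

Lemma wave_neg k a x : wave (- k.1, - k.2) a x = wave k (- a) x.
Proof.
by rewrite /wave /= -cosN; congr cos; rewrite !mulrNz; ring.
Qed.

Lemma wave_phase k a x :
  wave k a x = cos a * wave k 0 x - sin a * wave k (- (pi / 2)) x.
Proof.
rewrite /wave addr0; set s := k.1%:~R * x.1 + k.2%:~R * x.2; rewrite (cosD s a).
have -> : cos (s - pi / 2) = sin s.
  by rewrite cosB cos_pihalf sin_pihalf mulr0 add0r mulr1.
ring.
Qed.

Lemma inner_wave_phase g k a : L2 g ->
  inner g (wave k a) =
  cos a * inner g (wave k 0) - sin a * inner g (wave k (- (pi / 2))).
Proof.
move=> hg; rewrite -!innerZr//; [|exact: L2_wave..].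
rewrite -innerBr//; [|by apply: sqintZ => //; exact: L2_wave..].
by apply: eq_Rintegral => x _; rewrite wave_phase.
Qed.

Local Notation box N := ('I_N.*2.+1 * 'I_N.*2.+1)%type.

Definition wavenum N (k : box N) : int * int := (freq k.1, freq k.2).
Definition inball N k := k.1 ^+ 2 + k.2 ^+ 2 <= N%:Z ^+ 2.

(** [PN] on one component, with cos (k . (x - y)) expanded so that the Fourier coefficients of g
    appear. The sum runs over both k and -k, hence no factor 2. *)
Definition pn N g : R * R -> R := fun x =>
  \sum_(k : box N | inball N (wavenum k)) ((2 * pi) ^+ 2)^-1 *
    (inner g (wave (wavenum k) 0) * wave (wavenum k) 0 x +
     inner g (wave (wavenum k) (- (pi / 2))) * wave (wavenum k) (- (pi / 2)) x).

Lemma PN_pn N (phi : vfield R) i : L2 (phi i) -> PN N phi i = pn N (phi i).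
Proof.
move=> hg; apply/funext => x; apply: eq_bigr => k _; congr (_ * _).
rewrite /inner -!RintegralZr//; [|by apply: sqintM => //; exact: L2_wave..].
rewrite -RintegralD//; last first.
- under eq_fun do rewrite mulrC; apply: rintZ => //.
  by apply: sqintM => //; exact: L2_wave.
- under eq_fun do rewrite mulrC; apply: rintZ => //.
  by apply: sqintM => //; exact: L2_wave.
apply: eq_Rintegral => y _; rewrite -!mulrA -mulrDr; congr (_ * _).
rewrite /wave /= !addr0.
have E (s : R) : cos (s - pi / 2) = sin s.
  by rewrite cosB cos_pihalf sin_pihalf mulr0 add0r mulr1.
by rewrite !E -cosB -[RHS]cosN; congr cos; ring.
Qed.

Lemma L2_pn N g : L2 (pn N g).
Proof.
apply: sqint_sum => // k _; apply: sqintZ => //.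
by apply: sqintD => //; apply: sqintZ => //; exact: L2_wave.
Qed.

Lemma test_pn N g : test (pn N g).
Proof.
apply: test_sum => k; apply: testZ.
by apply: testD; apply: testZ; exact: test_wave.
Qed.

Lemma freq_inj N : injective (@freq N).
Proof. by move=> i j /addIr [] /val_inj. Qed.

Lemma wavenum_inj N : injective (@wavenum N).
Proof. by move=> [i1 i2] [j1 j2] [] /freq_inj -> /freq_inj ->. Qed.

Lemma freq_surj N (m : int) : m ^+ 2 <= N%:Z ^+ 2 -> exists i, @freq N i = m.
Proof.
rewrite -[m ^+ 2]real_normK ?num_real// ler_sqr ?nnegrE// ler_norml => /andP[h1 h2].
have h : (`|(m + N%:Z)%R|%N < N.*2.+1)%N by lia.
by exists (Ordinal h); rewrite /freq /=; lia.
Qed.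

Lemma wavenum_surj N k : inball N k -> exists i, @wavenum N i = k.
Proof.
rewrite /inball => h.
have [i hi] : exists i, @freq N i = k.1.
  by apply: freq_surj; apply: le_trans h; rewrite lerDl sqr_ge0.
have [j hj] : exists j, @freq N j = k.2.
  by apply: freq_surj; apply: le_trans h; rewrite lerDr sqr_ge0.
by exists (i, j); rewrite /wavenum /= hi hj -surjective_pairing.
Qed.

Lemma sum_wavenum_eq N (F : int * int -> R) k : inball N k ->
  \sum_(i : box N | inball N (wavenum i)) (if wavenum i == k then F (wavenum i) else 0)
  = F k.
Proof.
move=> hk; have [i ik] := wavenum_surj hk.
rewrite (bigD1 i) ?ik//= eqxx big1 ?addr0// => j /andP[_ ji].
by rewrite -ik (inj_eq (@wavenum_inj N)) (negbTE ji).
Qed.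

Lemma inballN N k : inball N k -> inball N (- k.1, - k.2).
Proof. by rewrite /inball /= !sqrrN. Qed.

(** In the sum defining [pn] only the modes k and -k meet [wave k a], and each contributes one half
    of the coefficient of g. For k = 0 the two coincide and both resonances fire. *)
Lemma inner_pn_wave N g k a : L2 g -> inball N k ->
  inner (pn N g) (wave k a) = inner g (wave k a).
Proof.
move=> hg hk; rewrite inner_suml; [|move=> l _|exact: L2_wave]; last first.
  apply: sqintZ => //.
  by apply: sqintD => //; apply: sqintZ => //; exact: L2_wave.
(* The contribution of mode l after [inner_wave]: with b = - a it comes from l = k, with b = a from
   l = -k. *)
pose G b l := 2^-1 * (inner g (wave l 0) * cos (0 + b) +
                    inner g (wave l (- (pi / 2))) * cos (- (pi / 2) + b)).
transitivity (\sum_(l : box N | inball N (wavenum l))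
   ((if wavenum l == k then G (- a) (wavenum l) else 0) +
    (if wavenum l == (- k.1, - k.2) then G a (wavenum l) else 0))).
  apply: eq_bigr => l _; rewrite innerZl; [| |exact: L2_wave]; last first.
    by apply: sqintD => //; apply: sqintZ => //; exact: L2_wave.
  rewrite innerDl; [|by apply: sqintZ => //; exact: L2_wave..|exact: L2_wave].
  rewrite !innerZl; [|exact: L2_wave..]; rewrite !inner_wave /G.
  have p0 : pi != 0 :> R by rewrite gt_eqF ?pi_gt0.
  move: (inner g (wave (wavenum l) 0)) (inner g (wave (wavenum l) (- (pi / 2)))) => A1 B1.
  move: (cos (0 - a)) (cos (0 + a)) (cos (- (pi / 2) - a)) (cos (- (pi / 2) + a)).
  move: pi p0 => p p0 c1 c2 c3 c4.
  by do 2 case: ifP => _; field; exact: p0.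
rewrite big_split /= !sum_wavenum_eq//; last exact: inballN.
rewrite /G (inner_wave_phase k a hg) !add0r.
have E b : inner g (wave (- k.1, - k.2) b) = inner g (wave k (- b)).
  by apply: eq_Rintegral => x _; rewrite wave_neg.
rewrite !E oppr0 opprK (inner_wave_phase k (pi / 2) hg).
have E2 (c : R) : cos (- (pi / 2) + c) = sin c.
  by rewrite addrC cosB cos_pihalf sin_pihalf mulr0 add0r mulr1.
rewrite !E2 cosN sinN cos_pihalf sin_pihalf.
by field.
Qed.

(** [pn N h] is a combination of waves in the ball, and on these [pn N g] and g have the same
    coefficients. Self-adjointness and Pythagoras follow from this one identity. *)
Lemma inner_pn_pn N g h : L2 g -> L2 h -> inner (pn N g) (pn N h) = inner g (pn N h).
Proof.
move=> hg hh; have wD (l : box N) : L2 (fun x =>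
    inner h (wave (@wavenum N l) 0) * wave (wavenum l) 0 x +
    inner h (wave (wavenum l) (- (pi / 2))) * wave (wavenum l) (- (pi / 2)) x).
  by apply: sqintD => //; apply: sqintZ => //; exact: L2_wave.
rewrite !inner_sumr//; [|by first [exact: L2_pn|move=> l _; exact: sqintZ]..].
apply: eq_bigr => l hl; rewrite !innerZr//; last exact: L2_pn.
congr (_ * _); have hp := L2_pn N g.
rewrite !innerDr//; [|by apply: sqintZ => //; exact: L2_wave..].
by rewrite !innerZr//; [|exact: L2_wave..]; rewrite !inner_pn_wave.
Qed.

Lemma inner_pn N g h : L2 g -> L2 h -> inner (pn N g) h = inner g (pn N h).
Proof.
move=> hg hh; rewrite -inner_pn_pn// [RHS]innerC inner_pn_pn//; first exact: innerC.
Qed.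

Lemma pn_pythagoras N g : L2 g ->
  inner g g = inner (pn N g) (pn N g) +
              inner (fun x => g x - pn N g x) (fun x => g x - pn N g x).
Proof.
move=> hg; have hp := L2_pn N g.
rewrite innerBl ?innerBr//; last exact: sqintB.
rewrite [inner (pn N g) g]innerC !inner_pn_pn//; ring.
Qed.

Lemma pn_le N g : L2 g -> inner (pn N g) (pn N g) <= inner g g.
Proof. by move=> hg; rewrite [leRHS](pn_pythagoras N hg) lerDl inner_ge0. Qed.

Lemma inner_pn_self N g : L2 g -> inner (pn N g) g = inner (pn N g) (pn N g).
Proof. by move=> hg; rewrite inner_pn_pn// innerC. Qed.

Lemma pn_parseval N g : L2 g -> inner (pn N g) (pn N g) =
  \sum_(k : box N | inball N (wavenum k)) ((2 * pi) ^+ 2)^-1 *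
    (inner g (wave (wavenum k) 0) ^+ 2 + inner g (wave (wavenum k) (- (pi / 2))) ^+ 2).
Proof.
move=> hg; rewrite inner_pn_pn// inner_sumr//; last first.
  move=> l _; apply: sqintZ => //.
  by apply: sqintD => //; apply: sqintZ => //; exact: L2_wave.
apply: eq_bigr => l hl; rewrite innerZr//; last first.
  by apply: sqintD => //; apply: sqintZ => //; exact: L2_wave.
rewrite innerDr//; [|by apply: sqintZ => //; exact: L2_wave..].
by rewrite !innerZr//; exact: L2_wave.
Qed.

Lemma pnB N g h : L2 g -> L2 h ->
  pn N (fun x => g x - h x) = fun x => pn N g x - pn N h x.
Proof.
move=> hg hh; apply/funext => x; rewrite /pn -sumrB; apply: eq_bigr => k _.
by rewrite !innerBl//; [|exact: L2_wave..]; ring.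
Qed.

Lemma pnD N g h : L2 g -> L2 h ->
  pn N (fun x => g x + h x) = fun x => pn N g x + pn N h x.
Proof.
move=> hg hh; apply/funext => x; rewrite /pn -big_split; apply: eq_bigr => k _ /=.
by rewrite !innerDl//; [|exact: L2_wave..]; ring.
Qed.

Lemma pnZ N c g : L2 g -> pn N (fun x => c * g x) = fun x => c * pn N g x.
Proof.
move=> hg; apply/funext => x; rewrite /pn mulr_sumr; apply: eq_bigr => k _ /=.
by rewrite !innerZl//; [|exact: L2_wave..]; ring.
Qed.

End Projection.

(** * Density of trigonometric polynomials *)

Section Density.
Variable R : realType.
Implicit Types (g h p q : R * R -> R) (k l : int * int) (a b : R) (x : R * R).
Local Notation plane := (measurableTypeR R * measurableTypeR R)%type.
Local Notation L2 := (sqint (torus R) setT).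

(** Products are not a constructor: [wave_mul] makes the family an algebra. *)
Inductive trigpoly : (R * R -> R) -> Prop :=
| trig_wave k a : trigpoly (wave k a)
| trigD p q : trigpoly p -> trigpoly q -> trigpoly (fun x => p x + q x)
| trigZ c p : trigpoly p -> trigpoly (fun x => c * p x).

Lemma trig_cst c : trigpoly (fun=> c).
Proof.
have := trigZ c (trig_wave (0, 0) 0); congr trigpoly; apply/funext => x.
by rewrite /wave /= !mul0r !addr0 cos0 mulr1.
Qed.

Lemma trigM p q : trigpoly p -> trigpoly q -> trigpoly (fun x => p x * q x).
Proof.
move=> hp hq; elim: hp => {p} [k a|p1 p2 _ ih1 _ ih2|c p _ ih].
- elim: hq => {q} [l b|q1 q2 _ ih1 _ ih2|c q _ ih].
  + under eq_fun do rewrite wave_mul.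
    by apply: trigD; apply: trigZ; exact: trig_wave.
  + by under eq_fun do rewrite mulrDr; exact: trigD.
  + by under eq_fun do rewrite mulrCA; exact: trigZ.
- by under eq_fun do rewrite mulrDl; exact: trigD.
- by under eq_fun do rewrite -mulrA; exact: trigZ.
Qed.

Lemma trigX n p : trigpoly p -> trigpoly (fun x => p x ^+ n).
Proof.
move=> hp; elim: n => [|n ih].
  by under eq_fun do rewrite expr0; exact: trig_cst.
by under eq_fun do rewrite exprS; exact: trigM.
Qed.

Lemma L2_trig p : trigpoly p -> L2 p.
Proof.
elim => {p} [k a|p q _ hp _ hq|c p _ hp]; first exact: L2_wave.
- exact: sqintD.
- exact: sqintZ.
Qed.

Lemma inner_sqrD g h : L2 g -> L2 h ->
  inner (fun x => g x + h x) (fun x => g x + h x) <= 2 * inner g g + 2 * inner h h.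
Proof.
move=> hg hh; have hD := sqintD measurableT hg hh.
have hB := sqintB measurableT hg hh.
have := inner_ge0 (fun x => g x - h x).
have -> : inner (fun x => g x - h x) (fun x => g x - h x) =
    inner g g - 2 * inner g h + inner h h.
  by rewrite innerBl// !innerBr// (innerC h g); ring.
have -> : inner (fun x => g x + h x) (fun x => g x + h x) =
    inner g g + 2 * inner g h + inner h h.
  by rewrite innerDl// !innerDr// (innerC h g); ring.
by move=> ?; lra.
Qed.

Definition pn_dist N g := inner (fun x => g x - pn N g x) (fun x => g x - pn N g x).

Lemma pn_dist_le N g : L2 g -> pn_dist N g <= inner g g.
Proof. by move=> hg; rewrite [leRHS](pn_pythagoras N hg) lerDr inner_ge0. Qed.

Lemma pn_distD N g h : L2 g -> L2 h ->
  pn_dist N (fun x => g x + h x) <= 2 * pn_dist N g + 2 * pn_dist N h.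
Proof.
move=> hg hh; rewrite /pn_dist pnD//.
have -> : (fun x => g x + h x - (pn N g x + pn N h x)) =
          (fun x => (g x - pn N g x) + (h x - pn N h x)).
  by apply/funext => x; ring.
by apply: inner_sqrD; apply: sqintB => //; exact: L2_pn.
Qed.

Lemma pn_distZ N c g : L2 g -> pn_dist N (fun x => c * g x) = c ^+ 2 * pn_dist N g.
Proof.
move=> hg; have hp := L2_pn N g.
have hd := sqintB measurableT hg hp.
rewrite /pn_dist pnZ//.
have -> : (fun x => c * g x - c * pn N g x) = (fun x => c * (g x - pn N g x)).
  by apply/funext => x; ring.
rewrite innerZl ?innerZr//; [ring|exact: sqintZ].
Qed.

Lemma pn_dist_trig p : trigpoly p -> exists M, forall N, (M <= N)%N -> pn_dist N p = 0.
Proof.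
elim => {p} [k a|p q hp [M1 h1] hq [M2 h2]|c p hp [M h]].
(* The sum of the absolute values dominates the Euclidean length of k. *)
- exists (`|k.1| + `|k.2|)%N => N kN.
  have kb : inball N k.
    rewrite /inball -[k.1 ^+ 2]real_normK ?num_real//.
    rewrite -[k.2 ^+ 2]real_normK ?num_real//.
    apply: (@le_trans _ _ ((`|k.1| + `|k.2|) ^+ 2)).
      by rewrite sqrrD addrAC lerDl mulrn_wge0// mulr_ge0.
    by rewrite ler_sqr ?nnegrE ?addr_ge0//; lia.
  have hw := @L2_wave R k a; have hp := L2_pn N (wave k a).
  have hd := sqintB measurableT hw hp.
  rewrite /pn_dist innerBl// !innerBr// -[inner (pn N _) (pn N _)]inner_pn_self//.
  by rewrite subrr subr0 [inner (wave k a) (pn _ _)]innerC inner_pn_wave// subrr.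
- exists (maxn M1 M2) => N; rewrite geq_max => /andP[n1 n2].
  apply/eqP; rewrite eq_le inner_ge0 andbT.
  have := pn_distD N (L2_trig hp) (L2_trig hq).
  by rewrite h1// h2// mulr0 addr0.
- by exists M => N MN; rewrite pn_distZ ?h ?mulr0//; exact: L2_trig.
Qed.

Definition approximable g := forall e, 0 < e -> exists2 p, trigpoly p &
  inner (fun x => g x - p x) (fun x => g x - p x) < e.

Lemma trig_approximable p : trigpoly p -> approximable p.
Proof.
move=> hp e e0; exists p => //; under eq_fun do rewrite subrr.
by rewrite /inner; under eq_Rintegral do rewrite mulr0; rewrite Rintegral0.
Qed.

Lemma approximable_closed g : L2 g ->
  (forall e, 0 < e -> exists h, [/\ L2 h, approximable h &
    inner (fun x => g x - h x) (fun x => g x - h x) < e]) -> approximable g.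
Proof.
(* A quarter, because distances are squared and |a + b|^2 <= 2 |a|^2 + 2 |b|^2. *)
move=> hg H e e0; have e4 : 0 < e / 4 by rewrite divr_gt0.
have [h [hh ah gh]] := H _ e4; have [p tp hp] := ah _ e4; exists p => //.
have -> : (fun x => g x - p x) = (fun x => (g x - h x) + (h x - p x)).
  by apply/funext => x; ring.
apply: le_lt_trans (inner_sqrD _ _) _.
- exact: sqintB.
- by apply: sqintB => //; exact: L2_trig.
- by lra.
Qed.

Lemma approximableD g h : L2 g -> L2 h -> approximable g -> approximable h ->
  approximable (fun x => g x + h x).
Proof.
move=> hg hh ag ah e e0; have e4 : 0 < e / 4 by rewrite divr_gt0.
have [p tp gp] := ag _ e4; have [q tq hq] := ah _ e4.
exists (fun x => p x + q x); first exact: trigD.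
have -> : (fun x => g x + h x - (p x + q x)) = (fun x => (g x - p x) + (h x - q x)).
  by apply/funext => x; ring.
apply: le_lt_trans (inner_sqrD _ _) _.
- by apply: sqintB => //; exact: L2_trig.
- by apply: sqintB => //; exact: L2_trig.
- by lra.
Qed.

Lemma approximableZ c g : L2 g -> approximable g -> approximable (fun x => c * g x).
Proof.
move=> hg ag e e0.
(* The summand 1 covers c = 0. *)
have c1 : 0 < c ^+ 2 + 1 by have := sqr_ge0 c => ?; lra.
have e4 : 0 < e / (c ^+ 2 + 1) by rewrite divr_gt0.
have [p tp gp] := ag _ e4; exists (fun x => c * p x); first exact: trigZ.
have hd : L2 (fun x => g x - p x) by apply: sqintB => //; exact: L2_trig.
have -> : (fun x => c * g x - c * p x) = (fun x => c * (g x - p x)).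
  by apply/funext => x; ring.
rewrite innerZl ?innerZr//; last exact: sqintZ.
move: gp; rewrite ltr_pdivlMr// => gp; apply: le_lt_trans gp.
by have := inner_ge0 (fun x => g x - p x); nra.
Qed.

Lemma approximableB g h : L2 g -> L2 h -> approximable g -> approximable h ->
  approximable (fun x => g x - h x).
Proof.
move=> hg hh ag ah; under eq_fun do rewrite -mulN1r.
by apply: approximableD => //; [exact: sqintZ|exact: approximableZ].
Qed.

Lemma approximable_sum (I : Type) (s : seq I) (F : I -> R * R -> R) :
  (forall i, L2 (F i)) -> (forall i, approximable (F i)) ->
  approximable (fun x => \sum_(i <- s) F i x).
Proof.
move=> hF aF; elim: s => [|i s ih].
  under eq_fun do rewrite big_nil.
  exact/trig_approximable/trig_cst.
under eq_fun do rewrite big_cons.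
by apply: approximableD => //; exact: sqint_sum.
Qed.

(** An L^2 majorant turns almost everywhere convergence into L^2 convergence, since the squared
    error is at most 4 G^2; [approximable_closed] then applies. *)
Lemma dominated_approximable (gn : nat -> R * R -> R) g G : L2 G ->
  measurable_fun [set: plane] g -> (forall n, measurable_fun [set: plane] (gn n)) ->
  (forall n, approximable (gn n)) ->
  (forall n x, `|gn n x| <= G x) -> (forall x, `|g x| <= G x) ->
  {ae torus R, forall x, (fun n => gn n x) @ \oo --> g x} ->
  approximable g.
Proof.
move=> [mG iG] mg mgn agn gnG gG cvg_gn.
have dom (f : R * R -> R) : measurable_fun [set: plane] f -> (forall x, `|f x| <= G x) -> L2 f.
  move=> mf fG; split => //; apply: (le_rint _ _ _ iG) => //.
    exact: measurable_funX.
  by move=> x _; rewrite normrX ler_sqr ?nnegrE//; exact: le_trans (fG x).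
apply: approximable_closed; first exact: dom.
move=> e e0.
have [|||||_ + _] := @dominated_convergence _ _ _ (torus R) setT measurableT
  (fun n x => ((g x - gn n x) * (g x - gn n x))%:E) (cst 0%E)
  (fun x => (4 * G x ^+ 2)%:E).
- move=> n; apply/measurable_EFinP; apply: measurable_funM => //; exact: measurable_funB.
- exact: measurable_cst.
- apply: filterS cvg_gn => x cx _ /=.
  apply/fine_cvgP; split; first exact: nearW.
  have c0 : (fun n => g x - gn n x) @ \oo --> (0 : R).
    by rewrite -[X in _ --> X](subrr (g x)); apply: cvgB => //; exact: cvg_cst.
  by rewrite -(mulr0 (0 : R)); exact: cvgM.
- exact: (rintZ measurableT 4 iG).
- apply: nearW => x n _ /=; rewrite lee_fin.
  have := gnG n x; have := gG x; set A := g x; set B := gn n x => hA hB.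
  have hAB : `|A - B| <= 2 * G x.
    by apply: le_trans (ler_normB _ _) _; lra.
  have -> : (4 * G x ^+ 2) = (2 * G x) ^+ 2 by ring.
  by rewrite -expr2 normrX ler_sqr ?nnegrE//; exact: le_trans hAB.
move=> /fine_cvgP[_ /cvgrPdist_lt /(_ _ e0)[N _ HN]].
exists (gn N); split => //; first exact: dom.
have := HN N (leqnn _); rewrite sub0r normrN /= ger0_norm; last first.
  by apply: fine_ge0; apply: integral_ge0.
rewrite /inner /Rintegral; congr (_ < _); congr fine; apply: eq_integral => x _.
by rewrite subr0 ger0_norm// -expr2 sqr_ge0.
Qed.

End Density.

(** * From steps to quadrants, measurable sets and all of L^2 *)

Section Completeness.
Variable R : realType.
Implicit Types (g h p q : R * R -> R) (k l : int * int) (a b : R) (x : R * R).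
Local Notation plane := (measurableTypeR R * measurableTypeR R)%type.
Local Notation line := (measurableTypeR R).
Local Notation L2 := (sqint (torus R) setT).

(* The Brosowski-Deutsch polynomials approximating a step at 1/2; composed with a
   trigonometric polynomial they approximate indicators of intervals. *)
Lemma cvg_pow_step (u : R) : 0 <= u -> u <= 1 -> u != 2^-1 ->
  (fun n => (1 - u ^+ n) ^+ (2 ^ n)) @ \oo --> ((nat_of_bool (u < 2^-1)%R)%:R : R).
Proof.
move=> u0 u1 uh; have un0 n : 0 <= u ^+ n by exact: exprn_ge0.
have un1 n : u ^+ n <= 1 by exact: exprn_ile1.
have e2 n : (2 ^ n)%:R * u ^+ n = (2 * u) ^+ n :> R by rewrite natrX exprMn.
have [ul|ul] := ltP u 2^-1.
- apply: (@squeeze_cvgr _ _ _ _ (fun n => 1 - (2 * u) ^+ n) (cst 1)).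
  + apply: nearW => n /=; apply/andP; split; last first.
      by rewrite exprn_ile1// ?subr_ge0// gerBl.
    (* Bernoulli's inequality; with m = 2^n and t = u^n it gives the lower bound 1 - (2 u)^n. *)
    have H (m : nat) (t : R) : 0 <= t -> t <= 1 -> 1 - m%:R * t <= (1 - t) ^+ m.
      move=> t0 t1; elim: m => [|m ih]; first by rewrite mul0r subr0 expr0.
      rewrite exprS -natr1; apply: le_trans (ler_wpM2l _ ih); last by rewrite subr_ge0.
      by have := ler0n R m => m0; nra.
    by rewrite -e2; exact: H.
  + rewrite -[X in _ --> X]subr0; apply: cvgB; first exact: cvg_cst.
    by apply: cvg_expr; rewrite ger0_norm ?mulr_ge0//; lra.
  + exact: cvg_cst.
- have ul' : 2^-1 < u by rewrite lt_neqAle eq_sym uh.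
  apply: (@squeeze_cvgr _ _ _ _ (cst 0) (fun n => (2 * u)^-1 ^+ n)).
  + apply: nearW => n /=; apply/andP; split; first by rewrite exprn_ge0// subr_ge0.
    (* The companion of Bernoulli's inequality; with m = 2^n and t = u^n it gives the upper bound (2
       u)^(-n). *)
    have H (m : nat) (t : R) : 0 <= t -> t <= 1 -> (1 - t) ^+ m * (1 + m%:R * t) <= 1.
      move=> t0 t1; elim: m => [|m ih]; first by rewrite mul0r addr0 mulr1 expr0.
      rewrite exprS -natr1; apply: le_trans ih; rewrite -mulrA mulrCA ler_wpM2l//.
        by rewrite exprn_ge0// subr_ge0.
      by have := ler0n R m => m0; have := mulr_ge0 t0 t0; nra.
    have s0 : 0 < (2 * u) ^+ n by rewrite exprn_gt0//; lra.
    rewrite exprVn -(ler_pM2r s0) mulVf ?gt_eqF//.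
    apply: le_trans (H (2 ^ n)%N _ (un0 n) (un1 n)); rewrite e2 ler_wpM2l//.
      by rewrite exprn_ge0// subr_ge0.
    by rewrite lerDr.
  + exact: cvg_cst.
  + apply: cvg_expr; rewrite ger0_norm ?invr_ge0 ?mulr_ge0//.
    by rewrite invf_lt1//; lra.
Qed.

(** The difference cos (a / 2) - cos (t - a / 2) = 2 sin ((t - a) / 2) sin (t / 2) is a
    trigonometric polynomial of degree one in t which, for a in [0, 2 pi[, changes sign on ]0, 2 pi[
    at most at a. Rescaled into [0, 1] around 1/2 it feeds [cvg_pow_step]. For other a the ray
    covers all or nothing of ]0, 2 pi[. The quantified c allows either coordinate of the plane. *)
Lemma ray_steps a : exists q : nat -> R -> R,
  [/\ forall c : R * R -> R, (forall b, trigpoly (fun x => cos (c x + b))) ->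
        forall n, trigpoly (fun x => q n (c x)),
      forall n, measurable_fun [set: line] (q n),
      forall n t, 0 <= q n t <= 1 &
      forall t, 0 < t -> t < 2 * pi -> t != a ->
        (fun n => q n t) @ \oo --> (\1_(`]a, +oo[%classic) t : R)].
Proof.
have [a0|a0] := ltP a 0.
  exists (fun _ _ => 1); split.
  - by move=> *; exact: trig_cst.
  - by move=> n; exact: measurable_cst.
  - by move=> *; rewrite ler01 lexx.
  - move=> t t0 _ _; rewrite indicE mem_set; first exact: cvg_cst.
    by rewrite /= in_itv/= andbT (lt_trans a0).
have [a1|a1] := leP (2 * pi) a.
  exists (fun _ _ => 0); split.
  - by move=> *; exact: trig_cst.
  - by move=> n; exact: measurable_cst.
  - by move=> *; rewrite ler01 lexx.
  - move=> t _ t1 _; rewrite indicE memNset; first exact: cvg_cst.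
    by rewrite /= in_itv/= andbT => at_; have := lt_trans at_ (lt_le_trans t1 a1); rewrite ltxx.
pose u (t : R) : R := 2^-1 - (cos (a / 2) - cos (t - a / 2)) / 4.
(* On ]0, 2 pi[ the sign of [1/2 - u t] is that of [t - a]. *)
have uE t : u t = 2^-1 - sin ((t - a) / 2) * sin (t / 2) / 2.
  rewrite /u; have -> : a / 2 = t / 2 - (t - a) / 2 by field.
  have -> : t - (t / 2 - (t - a) / 2) = t / 2 + (t - a) / 2 by field.
  by rewrite cosB cosD; field.
have u01 t : 0 <= u t <= 1.
  rewrite /u; have := cos_le1 (a / 2); have := cos_geN1 (a / 2).
  have := cos_le1 (t - a / 2); have := cos_geN1 (t - a / 2).
  by move=> *; apply/andP; split; lra.
have mu_ : measurable_fun [set: line] u.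
  apply: measurable_funB => //; apply: measurable_funM => //; apply: measurable_funB => //.
  apply: measurableT_comp; last exact: measurable_funB.
  by apply: continuous_measurable_fun; exact: continuous_cos.
exists (fun n t => (1 - u t ^+ n) ^+ (2 ^ n)); split.
- move=> c hc n; apply: trigX; under eq_fun do rewrite -mulN1r.
  apply: trigD; first exact: trig_cst.
  apply: trigZ; apply: trigX; rewrite /u.
  have -> : (fun x => 2^-1 - (cos (a / 2) - cos (c x - a / 2)) / 4) =
    (fun x => (2^-1 - cos (a / 2) / 4) + 4^-1 * cos (c x + (- (a / 2)))).
    by apply/funext => x; field.
  by apply: trigD; [exact: trig_cst|exact: trigZ].
- by move=> n; apply: measurable_funX; apply: measurable_funB => //; exact: measurable_funX.
- move=> n t; have /andP[u0 u1] := u01 t.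
  rewrite exprn_ge0 ?exprn_ile1// ?subr_ge0 ?exprn_ile1//.
  by rewrite gerBl exprn_ge0.
- move=> t t0 t1 ta; have /andP[u0 u1] := u01 t.
  have st : 0 < sin (t / 2) by apply: sin_gt0_pi; lra.
  have -> : \1_(`]a, +oo[%classic) t = (nat_of_bool (u t < 2^-1)%R)%:R :> R.
    rewrite indicE; congr (_%:R); congr nat_of_bool.
    rewrite mem_setE in_itv/= andbT uE.
    have [lt_at|lt_ta|e] := ltgtP a t; last by rewrite e eqxx in ta.
    - have : 0 < sin ((t - a) / 2) by apply: sin_gt0_pi; lra.
      by move=> s0; have := mulr_gt0 s0 st => ?; apply/esym; lra.
    - have : 0 < sin ((a - t) / 2) by apply: sin_gt0_pi; lra.
      have -> : (a - t) / 2 = - ((t - a) / 2) by field.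
      rewrite sinN => s0; have := mulr_gt0 s0 st => ?; apply/esym/negbTE.
      by rewrite -leNgt; lra.
  apply: cvg_pow_step => //; rewrite uE; apply/eqP => e.
  have : sin ((t - a) / 2) * sin (t / 2) = 0 by lra.
  move/eqP; rewrite mulf_eq0 [_ (t / 2) == _]gt_eqF// orbF => /eqP sa0.
  have [lt_at|lt_ta|e'] := ltgtP a t; last by rewrite e' eqxx in ta.
  + have : 0 < sin ((t - a) / 2) by apply: sin_gt0_pi; lra.
    by rewrite sa0 ltxx.
  + have : 0 < sin ((a - t) / 2) by apply: sin_gt0_pi; lra.
    have -> : (a - t) / 2 = - ((t - a) / 2) by field.
    by rewrite sinN sa0 oppr0 ltxx.
Qed.

(** Discards the null set on which [ray_steps] promises no limit: the boundary of the square and the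
    lines through the jumps. *)
Lemma ae_inside (a b : R) : {ae torus R, forall x : R * R,
  [/\ 0 < x.1, x.1 < 2 * pi & x.1 != a] /\ [/\ 0 < x.2, x.2 < 2 * pi & x.2 != b]}.
Proof.
pose N (c : R) : set line := ~` (`]0, 2 * pi[%classic `\ c).
have mN c : measurable (N c) by apply: measurableC; exact: measurableD.
have cN c : @circle_measure R (N c) = 0%E.
  transitivity (@lebesgue_measure R (N c `&` @circle R)); first by [].
  apply: (@subset_measure0 _ _ _ (@lebesgue_measure R) _ ([set 0] `|` ([set 2 * pi] `|` [set c]))) => //.
  - by apply: measurableI => //; exact: measurable_circle.
  - by apply: measurableU => //; exact: measurableU.
  - move=> t [Nt]; rewrite /circle /= in_itv/= => /andP[t0 t1].
    have [->|t0'] := eqVneq t 0; first by left.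
    have [->|t1'] := eqVneq t (2 * pi); first by right; left.
    have [->|tc] := eqVneq t c; first by right; right.
    exfalso; apply: Nt; split; last exact/eqP.
    by rewrite /= in_itv/= !lt_neqAle t0 t1 t1' eq_sym t0'.
  - apply: null_set_setU => //; [exact: measurableU|exact: lebesgue_measure_set1|].
    by apply: null_set_setU => //; exact: lebesgue_measure_set1.
exists ((N a `*` setT) `|` (setT `*` N b)); split.
- by apply: measurableU; exact: measurableX.
- apply: null_set_setU; [exact: measurableX|exact: measurableX|..].
  + transitivity (@circle_measure R (N a) * @circle_measure R setT)%E.
      exact: product_measure1E.
    by rewrite cN mul0e.
  + transitivity (@circle_measure R setT * @circle_measure R (N b))%E.
      exact: product_measure1E.
    by rewrite cN mule0.
- move=> x /= nx; apply: contrapT => /not_orP[h1 h2]; apply: nx.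
  have [h1' h2'] : ~ N a x.1 /\ ~ N b x.2 by split => h; [apply: h1|apply: h2].
  move/contrapT : h1' => [/= + /eqP]; rewrite in_itv/= => /andP[? ?] ?.
  by move/contrapT : h2' => [/= + /eqP]; rewrite in_itv/= => /andP[? ?] ?.
Qed.

Lemma approximable_rays (a b : R) :
  approximable (\1_((fst @^-1` `]a, +oo[) `&` (snd @^-1` `]b, +oo[) : set plane)).
Proof.
have [p [tp mp p01 cp]] := ray_steps a; have [q [tq mq q01 cq]] := ray_steps b.
have hfst (c : R) : trigpoly (fun x : R * R => cos (x.1 + c)).
  have := trig_wave (1, 0) c; congr trigpoly; apply/funext => x.
  by rewrite /wave /= mul1r mul0r addr0.
have hsnd (c : R) : trigpoly (fun x : R * R => cos (x.2 + c)).
  have := trig_wave (0, 1) c; congr trigpoly; apply/funext => x.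
  by rewrite /wave /= mul1r mul0r add0r.
have tpq n : trigpoly (fun x => p n x.1 * q n x.2).
  by apply: trigM; [exact: tp|exact: tq].
apply: (@dominated_approximable _ (fun n x => p n x.1 * q n x.2) _ (cst 1)).
- apply: (@bounded_sqint _ _ _ (torus R) setT measurableT _ 1) => //.
  + exact: torusT_lty.
  + by move=> x _; rewrite /= normr1.
- apply: measurable_indic; apply: measurableI.
  + by rewrite -[X in measurable X]setTI; apply: measurable_fst.
  + by rewrite -[X in measurable X]setTI; apply: measurable_snd.
- move=> n; apply: measurable_funM.
  + by apply: measurableT_comp => //; exact: mp.
  + by apply: measurableT_comp => //; exact: mq.
- by move=> n; exact: trig_approximable.
- move=> n x; have /andP[p0 p1] := p01 n x.1; have /andP[q0 q1] := q01 n x.2.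
  by rewrite /= ger0_norm ?mulr_ge0// mulr_ile1.
- by move=> x; rewrite /= indicE; case: (_ \in _); rewrite ?normr1 ?normr0.
- apply: filterS (ae_inside a b) => x [[x0 x1 xa] [y0 y1 yb]].
  have -> : \1_((fst @^-1` `]a, +oo[) `&` (snd @^-1` `]b, +oo[)) x =
    \1_(`]a, +oo[%classic) x.1 * \1_(`]b, +oo[%classic) x.2 :> R.
    rewrite !indicE -natrM; congr (_%:R); rewrite mulnb in_setI.
    by [].
  by apply: cvgM; [exact: cp|exact: cq].
Qed.

Lemma L2_indic (E : set plane) : measurable E -> L2 (\1_E : plane -> R).
Proof.
move=> mE; apply: (@bounded_sqint _ _ _ (torus R) setT measurableT _ 1).
- exact: measurable_indic.
- exact: torusT_lty.
- by move=> x _; rewrite /= indicE; case: (_ \in _); rewrite ?normr1 ?normr0.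
Qed.

(** The sets E with approximable indicator of the preimage form a Dynkin system: complements are
    differences, disjoint unions are dominated limits. The factor S stays fixed, so that one
    coordinate can be treated at a time. *)
Lemma approximable_dynkin d (T : measurableType d) (G : set (set T)) (f : plane -> T)
    (S : set plane) :
  @measurable _ T = <<s G>> -> setI_closed G -> measurable_fun setT f ->
  measurable S -> approximable (\1_S : plane -> R) ->
  (forall E, G E -> approximable (\1_((f @^-1` E) `&` S) : plane -> R)) ->
  forall E, measurable E -> approximable (\1_((f @^-1` E) `&` S) : plane -> R).
Proof.
move=> mG GI mf mS aS aG E; rewrite mG; move: E.
have mfS E : measurable E -> measurable ((f @^-1` E) `&` S).
  by move=> mE; apply: measurableI => //; rewrite -[X in measurable X]setTI; exact: mf.
apply: (dynkin_induction mG GI) => //.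
- by rewrite preimage_setT setTI.
- move=> E mE aE.
  have -> : \1_((f @^-1` (~` E)) `&` S) =
      (fun x => \1_S x - \1_((f @^-1` E) `&` S) x) :> (plane -> R).
    apply/funext => x; rewrite !indicE !in_setI preimage_setC in_setC.
    by case: (x \in f @^-1` E) (x \in S) => [] [] /=; rewrite ?subrr ?subr0.
  by apply: approximableB => //; apply: L2_indic => //; exact: mfS.
- move=> F mF tF aF.
  pose s n (x : plane) : R := \sum_(i <- iota 0 n) \1_((f @^-1` (F i)) `&` S) x.
  (* By disjointness at most one summand is nonzero, so the partial sums stay below 1. *)
  have sE n x : s n x = \1_((f @^-1` (\bigcup_(i < n) F i)) `&` S) x.
    rewrite /s.
    have [xS|xS] := boolP (x \in S); last first.
      rewrite indicE in_setI (negbTE xS) andbF big1// => i _.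
      by rewrite indicE in_setI (negbTE xS) andbF.
    have [[i /= ni Fi]|nF] := pselect ((\bigcup_(i < n) F i) (f x)).
      rewrite [RHS]indicE mem_set; last by split; [exists i|exact: set_mem].
      rewrite (bigD1_seq i) ?iota_uniq ?mem_iota ?add0n//=.
      rewrite indicE mem_set ?big1 ?addr0//; last by split => //; exact: set_mem.
      move=> j ji; rewrite indicE memNset// => -[Fj _].
      by move/negP: ji; apply; apply/eqP; apply: tF => //; exists (f x).
    rewrite [RHS]indicE memNset; last by case.
    rewrite big_seq big1// => i; rewrite mem_iota add0n => /andP[_ ni].
    by rewrite indicE memNset// => -[Fi _]; apply: nF; exists i.
  have ms n : measurable_fun [set: plane] (s n).
    by apply: measurable_sum => i; apply: measurable_indic; exact: mfS.
  have s01 E (x : plane) : `|\1_E x : R| <= 1.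
    by rewrite indicE; case: (_ \in _); rewrite ?normr1 ?normr0.
  apply: (@dominated_approximable _ s _ (cst 1)) => //.
  + apply: (@bounded_sqint _ _ _ (torus R) setT measurableT _ 1) => //.
      exact: torusT_lty.
    by move=> x _; rewrite /= normr1.
  + by apply: measurable_indic; apply: mfS; exact: bigcupT_measurable.
  + move=> n; apply: approximable_sum => // i.
    by apply: L2_indic; exact: mfS.
  + by move=> n x; rewrite sE.
  + apply: nearW => x.
    have [[i _ Fi]|nF] := pselect ((\bigcup_i F i) (f x)); last first.
      rewrite (_ : (fun n => _) = cst (\1_((f @^-1` \bigcup_i F i) `&` S) x)).
        exact: cvg_cst.
      apply/funext => n; rewrite sE /= !indicE !memNset//; first by case.
      by case=> -[i _ Fi] _; apply: nF; exists i.
    apply: (@cvg_trans _ (cst (\1_((f @^-1` \bigcup_i F i) `&` S) x : R) @ \oo)).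
      2: exact: cvg_cst.
    apply: near_eq_cvg; exists i.+1 => // n /= ni; rewrite sE !indicE.
    congr (_%:R); congr nat_of_bool; rewrite !in_setI; congr (_ && _).
    by rewrite !mem_set//; exists i.
Qed.

Lemma line_measurableE : @measurable _ line = <<s @RGenOInfty.G R >>.
Proof. exact: RGenOInfty.measurableE. Qed.

Lemma rays_setI_closed : setI_closed (@RGenOInfty.G R).
Proof.
move=> _ _ [a ->] [b ->]; exists (Num.max a b).
by apply/seteqP; split => t /=; rewrite !in_itv/= !andbT gt_max => /andP.
Qed.

(** Three passes of the Dynkin argument: first coordinate, second coordinate, then rectangles to the
    product sigma-algebra. Each pass needs its S to be approximable beforehand, hence the auxiliary
    half-planes and slabs. *)
Lemma approximable_indic (E : set plane) : measurable E ->
  approximable (\1_E : plane -> R).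
Proof.
have aT : approximable (\1_setT : plane -> R).
  by rewrite indicT; exact/trig_approximable/trig_cst.
have mray (c : plane -> line) b : measurable_fun setT c ->
    measurable (c @^-1` `]b, +oo[%classic).
  by move=> mc; rewrite -[X in measurable X]setTI; exact: mc.
(* The ray from -1 contains the whole circle, so a half-plane is almost everywhere a quadrant. *)
have aray2 (b : R) : approximable (\1_(snd @^-1` `]b, +oo[) : plane -> R).
  apply: (@dominated_approximable _
    (fun=> \1_((fst @^-1` `](-1), +oo[) `&` (snd @^-1` `]b, +oo[) : set plane)) _ (cst 1)).
  - by rewrite (_ : cst 1 = \1_setT); [exact: L2_indic|rewrite indicT].
  - by apply: measurable_indic; exact: mray.
  - by move=> _; apply: measurable_indic; apply: measurableI; exact: mray.
  - by move=> _; exact: approximable_rays.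
  - by move=> _ x; rewrite /= indicE; case: (_ \in _); rewrite ?normr1 ?normr0.
  - by move=> x; rewrite /= indicE; case: (_ \in _); rewrite ?normr1 ?normr0.
  - apply: filterS (ae_inside 0 0) => x [[x0 _ _] _].
    rewrite (_ : \1_(_ `&` _) x = \1_(snd @^-1` `]b, +oo[) x :> R); first exact: cvg_cst.
    rewrite !indicE in_setI mem_set// /= in_itv/= andbT; lra.
have strip A b : measurable A ->
    approximable (\1_((fst @^-1` A) `&` (snd @^-1` `]b, +oo[) : set plane)).
  move: A; apply: (approximable_dynkin line_measurableE rays_setI_closed) => //.
  - exact: mray.
  - by move=> _ [a ->]; exact: approximable_rays.
have slab A : measurable A -> approximable (\1_(fst @^-1` A) : plane -> R).
  move=> mA; rewrite -[fst @^-1` A]setIT; move: A mA.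
  apply: (approximable_dynkin line_measurableE rays_setI_closed) => //.
  move=> _ [a ->]; rewrite setIT.
  apply: (@dominated_approximable _
    (fun=> \1_((fst @^-1` `]a, +oo[) `&` (snd @^-1` `](-1), +oo[) : set plane)) _ (cst 1)).
  - by rewrite (_ : cst 1 = \1_setT); [exact: L2_indic|rewrite indicT].
  - by apply: measurable_indic; exact: mray.
  - by move=> _; apply: measurable_indic; apply: measurableI; exact: mray.
  - by move=> _; exact: approximable_rays.
  - by move=> _ x; rewrite /= indicE; case: (_ \in _); rewrite ?normr1 ?normr0.
  - by move=> x; rewrite /= indicE; case: (_ \in _); rewrite ?normr1 ?normr0.
  - apply: filterS (ae_inside 0 0) => x [_ [x0 _ _]].
    rewrite (_ : \1_(_ `&` _) x = \1_(fst @^-1` `]a, +oo[) x :> R); first exact: cvg_cst.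
    rewrite !indicE in_setI andbC mem_set// /= in_itv/= andbT; lra.
have rect A B : measurable A -> measurable B ->
    approximable (\1_((fst @^-1` A) `&` (snd @^-1` B) : set plane)).
  move=> mA mB; rewrite setIC; move: B mB.
  apply: (approximable_dynkin line_measurableE rays_setI_closed) => //.
  - by rewrite -[X in measurable X]setTI; exact: measurable_fst.
  - exact: slab.
  - by move=> _ [b ->]; rewrite setIC; exact: strip.
(* Here f is the identity of the plane and the generators are the rectangles. *)
move=> mE; rewrite -[E]setIT -[E]preimage_id; move: E mE.
apply: (approximable_dynkin (measurable_prod_measurableType line line)) => //.
- move=> _ _ [A1 mA1 [B1 mB1 <-]] [A2 mA2 [B2 mB2 <-]].
  exists (A1 `&` A2); first exact: measurableI.
  by exists (B1 `&` B2); [exact: measurableI|rewrite setXI].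
- by move=> _ [A mA [B mB <-]]; rewrite setIT; exact: rect.
Qed.

Import HBNNSimple.

Theorem L2_approximable g : L2 g -> approximable g.
Proof.
have pos f : L2 f -> (forall x, 0 <= f x) -> approximable f.
  move=> hf f0; have [mf _] := hf.
  have mef : measurable_fun [set: plane] (EFin \o f) by exact/measurable_EFinP.
  pose s n : {nnsfun plane >-> R} := nnsfun_approx measurableT mef n.
  have s_le n x : s n x <= f x.
    rewrite -lee_fin nnsfun_approxE.
    by apply: (@le_approx _ _ _ setT (EFin \o f)) => // y _; rewrite lee_fin.
  apply: (@dominated_approximable _ s _ f) => //.
  - move=> n; have [m [c sE]] : exists m (c : 'I_m -> R), forall x,
        s n x = \sum_(i < m) (c i * \1_(s n @^-1` [set c i]) x).
      by do 2 eexists; exact: (fimfunEord (s n)).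
    rewrite (_ : (s n : plane -> R) = fun x =>
      \sum_(i < m) (c i * \1_(s n @^-1` [set c i]) x)); last exact/funext.
    have mi r : measurable (s n @^-1` [set r]) by [].
    apply: approximable_sum => i.
    + by apply: sqintZ => //; exact: L2_indic.
    + by apply: approximableZ; [exact: L2_indic|exact: approximable_indic].
  - by move=> n x; rewrite ger0_norm.
  - by move=> x; rewrite ger0_norm.
  - apply: nearW => x.
    have := @cvg_nnsfun_approx _ _ _ setT measurableT _ mef (fun y _ => f0 y) x I.
    by move=> /fine_cvgP[].
move=> hg; have [mg ig] := hg.
have hn : L2 (fun x => `|g x|).
  split; first exact: measurableT_comp.
  by apply: eq_rint ig => // x _; rewrite real_normK ?num_real.
(* Positive and negative parts, in a form that is visibly square integrable. *)
have -> : g = fun x => 2^-1 * (`|g x| + g x) - 2^-1 * (`|g x| - g x).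
  by apply/funext => x; field.
have hD := sqintD measurableT hn hg; have hB := sqintB measurableT hn hg.
apply: approximableB; try exact: sqintZ.
- apply: approximableZ => //; apply: pos => // x.
  by have := lerNnormlW (lexx `|g x|); lra.
- apply: approximableZ => //; apply: pos => // x.
  by rewrite subr_ge0 ler_norm.
Qed.

(** Split g into g - p and a trigonometric polynomial p: the truncation error of p vanishes for
    large N, that of g - p never exceeds its norm. *)
Theorem pn_cvg g : L2 g -> (fun N => pn_dist N g) @ \oo --> (0 : R).
Proof.
move=> hg; apply/cvgrPdist_lt => e e0.
have e4 : 0 < e / 4 by rewrite divr_gt0.
have [p tp gp] := L2_approximable hg e4.
have [M hM] := pn_dist_trig tp; have hp := L2_trig tp.
have hgp := sqintB measurableT hg hp.
exists M => // N /= MN; rewrite sub0r normrN ger0_norm ?inner_ge0//.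
have -> : g = fun x => (g x - p x) + p x by apply/funext => x; ring.
apply: le_lt_trans (pn_distD N hgp hp) _; rewrite hM// mulr0 addr0.
apply: le_lt_trans (ler_wpM2l _ (pn_dist_le N hgp)) _ => //; lra.
Qed.

End Completeness.

(** * Integration by parts for test functions *)

Section SmoothFunctions.
Variable R : realType.
Implicit Types (g h psi : R * R -> R) (k l : int * int) (a b : R) (x : R * R).
Local Notation plane := (measurableTypeR R * measurableTypeR R)%type.
Local Notation line := (measurableTypeR R).
Local Notation L2 := (sqint (torus R) setT).

(** The topology and the product sigma-algebra of the plane meet through rational boxes, of which an
    open set is a countable union. *)
Lemma open_plane_measurable (U : set (R * R)) : open U -> measurable (U : set plane).
Proof.
move=> oU.
pose box (q : (rat * rat) * (rat * rat)) : set plane :=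
  `]ratr q.1.1, ratr q.1.2[%classic `*` `]ratr q.2.1, ratr q.2.2[%classic.
(* Boxes that leave U are emptied rather than removed, so that the union runs over a countable
   type. *)
pose F q : set plane := if `[< box q `<=` U >] then box q else set0.
have -> : U = \bigcup_q F q.
  apply/seteqP; split => [x Ux|x [q _]]; last first.
    by rewrite /F; case: asboolP => // h /h.
  have [[B1 B2] /= [n1 n2] BU] : nbhs x U by exact: open_nbhs_nbhs.
  have /nbhs_ballP[e1 /= e10 h1] := n1; have /nbhs_ballP[e2 /= e20 h2] := n2.
  have near_box (t e : R) : 0 < e -> exists p q : rat,
      [/\ ratr p < t, t < ratr q & `]ratr p, ratr q[ `<=` ball t e].
    move=> e0.
    have [|p] := @rat_in_itvoo R (t - e) t; first by lra.
    rewrite in_itv/= => /andP[p1 p2].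
    have [|q] := @rat_in_itvoo R t (t + e); first by lra.
    rewrite in_itv/= => /andP[q1 q2].
    exists p, q; split => // s /=; rewrite in_itv/= => /andP[s1 s2].
    by rewrite /ball/= ltr_norml; apply/andP; split; lra.
  have [p1 [q1 [p1x q1x H1]]] := near_box x.1 _ e10.
  have [p2 [q2 [p2x q2x H2]]] := near_box x.2 _ e20.
  exists ((p1, q1), (p2, q2)) => //; rewrite /F asboolT.
    by split; rewrite /= in_itv/= ?p1x ?p2x.
  move=> y [y1 y2]; apply: BU; split => /=.
    by apply: h1; exact: H1.
  by apply: h2; exact: H2.
have mF q : measurable (F q).
  by rewrite /F; case: ifP => // _; exact: measurableX.
by apply: countable_bigcupT_measurable => //; exact: countableP.
Qed.

Lemma continuous_measurable_plane g : continuous g -> measurable_fun [set: plane] g.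
Proof.
move=> /continuousP cg; apply: (measurability _ (RGenOpens.measurableE R)).
move=> _ [_ [a [b ->] <-]]; rewrite setTI; apply: open_plane_measurable.
by apply: cg; exact: interval_open.
Qed.

Lemma ae_rint g h : measurable_fun [set: plane] g -> {ae torus R, forall x, g x = h x} ->
  rint (torus R) setT h -> rint (torus R) setT g.
Proof.
move=> mg gh /[dup] hh /integrableP[mh ih]; apply/integrableP; split.
  exact/measurable_EFinP.
apply: le_lt_trans ih; rewrite le_eqVlt; apply/orP; left; apply/eqP.
apply: ae_eq_integral => //.
- by apply: measurableT_comp => //; exact/measurable_EFinP.
- exact: measurableT_comp.
- by apply: filterS gh => x e _; rewrite /= e.
Qed.

(** A continuous function may be unbounded on the plane; cutting it off outside the compact square
    changes it only on a null set. *)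
Lemma L2_continuous g : continuous g -> L2 g.
Proof.
move=> cg; have mg := continuous_measurable_plane cg.
pose sq : set (R * R) := `[0, 2 * pi]%classic `*` `[0, 2 * pi]%classic.
have csq : compact sq by apply: compact_setX; exact: segment_compact.
have [M [_ HM]] : bounded_set (g @` sq).
  apply: compact_bounded; apply: continuous_compact => //.
  exact: continuous_subspaceT.
have msq : measurable (sq : set plane) by exact: measurableX.
pose h x := g x * \1_sq x.
have mh : measurable_fun [set: plane] h by apply: measurable_funM => //; exact: measurable_indic.
have hM x : `|h x| <= `|M| + 1.
  rewrite /h indicE; have [xs|xs] := boolP (x \in sq).
    rewrite mulr1; apply: HM; last by exists x => //; exact/set_mem.
    by rewrite (le_lt_trans (ler_norm M))// ltrDl.
  by rewrite mulr0 normr0 addr_ge0.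
have [_ h2] := @bounded_sqint _ _ _ (torus R) setT measurableT h _ mh (torusT_lty R)
  (fun x _ => hM x).
split => //; apply: ae_rint h2; first exact: measurable_funX.
apply: filterS (ae_inside 0 0) => x [[x0 x1 _] [y0 y1 _]].
by rewrite /h indicE mem_set ?mulr1//; split; rewrite /= in_itv/= !ltW.
Qed.

Lemma L2_rint g : L2 g -> rint (torus R) setT g.
Proof.
move=> hg; have h1 : L2 (cst 1) by apply: L2_continuous; exact: cst_continuous.
by have := sqintM measurableT hg h1; apply: eq_rint => // x _; rewrite mulr1.
Qed.

Lemma test_L2 psi : test psi -> L2 psi.
Proof. by move=> /test_continuous; exact: L2_continuous. Qed.

Lemma test_derive_continuous j psi : test psi -> continuous ('D_(dir R j) psi).
Proof. by move=> [/(_ 1%N)[_ /(_ j)[_ []]]]. Qed.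

(** The same cut-off on the circle removes the boundedness assumption of [integral_circle]. *)
Lemma integral_circle_continuous (f : R -> R) : continuous f ->
  (\int[@circle_measure R]_x (f x)%:E =
   \int[@lebesgue_measure R]_(x in `[0%R, (2 * pi)%R]) (f x)%:E)%E.
Proof.
move=> cf; pose I : set R := `[0, 2 * pi]%classic.
have mf : measurable_fun [set: line] f by exact: continuous_measurable_fun.
have [M [_ HM]] : bounded_set (f @` I).
  apply: compact_bounded; apply: continuous_compact; last exact: segment_compact.
  exact: continuous_subspaceT.
have mI : measurable (I : set line) by exact: measurable_itv.
pose h (x : R) : R := f x * \1_I x.
have mh : measurable_fun [set: line] h by apply: measurable_funM => //; exact: measurable_indic.
have hM (x : R) : `|h x| <= `|M| + 1.
  rewrite /h indicE; have [xs|xs] := boolP (x \in I).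
    rewrite mulr1; apply: HM; last by exists x => //; exact/set_mem.
    by rewrite (le_lt_trans (ler_norm M))// ltrDl.
  by rewrite mulr0 normr0 addr_ge0.
transitivity (\int[@circle_measure R]_x (h x)%:E)%E.
  apply: ae_eq_integral => //; [exact/measurable_EFinP|exact/measurable_EFinP|].
  exists (~` (I : set line)); split.
  - exact: measurableC.
  - transitivity (@lebesgue_measure R (~` I `&` @circle R)); first by [].
    by rewrite setICl measure0.
  - move=> x /= nx Ix; apply: nx => _.
    by rewrite /h indicE mem_set ?mulr1.
rewrite (integral_circle mh hM); apply: eq_integral => x xI.
by rewrite /h indicE xI mulr1.
Qed.

(** Stated for difference quotients so that derivability and the value of the derivative both pass
    to the slice. *)
Lemma slice_quotient_fst psi (t y : R) :
  (fun h : R => h^-1 *: ((psi \o shift (t, y)) (h *: dir R ord0) - psi (t, y))) =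
  (fun h : R => h^-1 *: (((fun s => psi (s, y)) \o shift t) (h *: (1 : R)) - psi (t, y))).
Proof.
apply/funext => h /=; congr (_ *: (psi _ - _)).
by rewrite /dir /= -[LHS]/(h * 1 + t, h * 0 + y) mulr0 add0r.
Qed.

Lemma slice_quotient_snd psi (x t : R) :
  (fun h : R => h^-1 *: ((psi \o shift (x, t)) (h *: dir R (lift ord0 ord0)) - psi (x, t))) =
  (fun h : R => h^-1 *: (((fun s => psi (x, s)) \o shift t) (h *: (1 : R)) - psi (x, t))).
Proof.
apply/funext => h /=; congr (_ *: (psi _ - _)).
by rewrite /dir /= -[LHS]/(h * 0 + x, h * 1 + t) mulr0 add0r.
Qed.

Lemma derive_fst psi (t y : R) : 'D_(dir R ord0) psi (t, y) = derive1 (fun s => psi (s, y)) t.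
Proof. by rewrite derive1E /derive slice_quotient_fst. Qed.

Lemma derivable_fst psi (t y : R) : derivable psi (t, y) (dir R ord0) ->
  derivable (fun s => psi (s, y)) t 1.
Proof. by rewrite /derivable slice_quotient_fst. Qed.

Lemma derive_snd psi (x t : R) :
  'D_(dir R (lift ord0 ord0)) psi (x, t) = derive1 (fun s => psi (x, s)) t.
Proof. by rewrite derive1E /derive slice_quotient_snd. Qed.

Lemma derivable_snd psi (x t : R) : derivable psi (x, t) (dir R (lift ord0 ord0)) ->
  derivable (fun s => psi (x, s)) t 1.
Proof. by rewrite /derivable slice_quotient_snd. Qed.

Lemma integral_circle_derive (s : R -> R) : continuous s -> continuous (derive1 s) ->
  (forall t, derivable s t 1) -> s (2 * pi) = s 0 ->
  (\int[@circle_measure R]_t (derive1 s t)%:E = 0)%E.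
Proof.
move=> cs cds ds s0; rewrite (integral_circle_continuous cds).
have LR : derivable_oo_LRcontinuous s 0 (2 * pi).
  split; first by move=> x _; exact: ds.
    by apply: cvg_at_right_filter; exact: cs.
  by apply: cvg_at_left_filter; exact: cs.
have eqd : {in `]0, (2 * pi)[, derive1 s =1 derive1 s} by move=> x _.
rewrite (continuous_FTC2 (two_pi_gt0 R) (continuous_subspaceT cds) LR eqd).
by rewrite s0 subee.
Qed.

Lemma continuous_slice_fst g y : continuous g -> continuous (fun t : R => g (t, y)).
Proof.
move=> cg t; apply: (@continuous_comp _ _ _ (fun t : R => (t, y))); last exact: cg.
by apply: (@cvg_pair _ _ _ _ (nbhs (t : R)) (nbhs (y : R))); [exact: cvg_id|exact: cvg_cst].
Qed.

Lemma continuous_slice_snd g (t : R) : continuous g -> continuous (fun y : R => g (t, y)).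
Proof.
move=> cg y; apply: (@continuous_comp _ _ _ (fun y : R => (t, y))); last exact: cg.
by apply: (@cvg_pair _ _ _ _ (nbhs (t : R)) (nbhs (y : R))); [exact: cvg_cst|exact: cvg_id].
Qed.

(** By Fubini and periodicity. The variable of differentiation must be integrated first, so the two
    directions use opposite orders of integration. *)
Lemma Rintegral_derive_test j psi : test psi ->
  \int[torus R]_x 'D_(dir R j) psi x = 0.
Proof.
move=> tp; have cp := test_continuous tp; have cd := test_derive_continuous (j := j) tp.
have di := L2_rint (L2_continuous cd).
have [_ per] := tp.
have e0 t : psi (2 * pi, t) = psi (0, t) by have [] := per 0 t; rewrite add0r.
have e1 t : psi (t, 2 * pi) = psi (t, 0) by have [] := per t 0; rewrite add0r.
case: (unliftP ord0 j) => [i|] ej; last subst j.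
  have {ej i} ej : j = lift ord0 ord0 by rewrite ej (ord1 i).
  subst j; rewrite /Rintegral -integral12_prod_meas1//.
  rewrite /fubini_F; under eq_integral => x _.
    under eq_integral do rewrite derive_snd.
    rewrite integral_circle_derive//.
    - over.
    - exact: continuous_slice_snd.
    - rewrite (_ : derive1 _ = fun t => 'D_(dir R (lift ord0 ord0)) psi (x, t)).
        exact: (continuous_slice_snd (g := 'D_(dir R (lift ord0 ord0)) psi)).
      by apply/funext => t; rewrite derive_snd.
    - by move=> t; apply: derivable_snd; exact: test_derivable.
  by rewrite integral0.
rewrite /Rintegral -integral21_prod_meas1//.
rewrite /fubini_G; under eq_integral => x _.
  under eq_integral do rewrite derive_fst.
  rewrite integral_circle_derive//.
  - over.
  - exact: continuous_slice_fst.
  - rewrite (_ : derive1 _ = fun t => 'D_(dir R ord0) psi (t, x)).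
      exact: (continuous_slice_fst (g := 'D_(dir R ord0) psi)).
    by apply/funext => t; rewrite derive_fst.
  - by move=> t; apply: derivable_fst; exact: test_derivable.
by rewrite integral0.
Qed.

Lemma is_wderiv_test j psi : test psi -> is_wderiv j psi ('D_(dir R j) psi).
Proof.
move=> tp; have hd := L2_continuous (test_derive_continuous (j := j) tp).
split; first exact: sqint_inL2.
move=> phi tphi; apply/eqP; rewrite -addr_eq0; apply/eqP.
have hd' := L2_continuous (test_derive_continuous (j := j) tphi).
have h := test_L2 tp; have h' := test_L2 tphi.
rewrite -RintegralD//; [|exact: sqintM..].
rewrite -(Rintegral_derive_test j (testM tp tphi)); apply: eq_Rintegral => x _.
by rewrite derive_testME// [phi x * _]mulrC.
Qed.

End SmoothFunctions.

(** * Weak derivatives *)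

Section WeakDerivatives.
Variable R : realType.
Implicit Types (g h psi : R * R -> R) (k l : int * int) (a b : R) (x : R * R).
Local Notation L2 := (sqint (torus R) setT).
Local Notation box N := ('I_N.*2.+1 * 'I_N.*2.+1)%type.

Lemma is_wderivP j g g' : L2 g ->
  is_wderiv j g g' <-> L2 g' /\ forall psi, test psi ->
    inner g ('D_(dir R j) psi) = - inner g' psi.
Proof.
by move=> hg; split=> -[hg' H]; split=> //; [exact: inL2_sqint|exact: sqint_inL2].
Qed.

Lemma is_wderiv_L2 j g g' : is_wderiv j g g' -> L2 g'.
Proof. by move=> [/inL2_sqint]. Qed.

Lemma L2_derive_test j psi : test psi -> L2 ('D_(dir R j) psi).
Proof. by move=> tp; exact/L2_continuous/test_derive_continuous. Qed.

Lemma is_wderivB j g g' h h' : L2 g -> L2 h -> is_wderiv j g g' -> is_wderiv j h h' ->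
  is_wderiv j (fun x => g x - h x) (fun x => g' x - h' x).
Proof.
move=> hg hh /(is_wderivP _ _ hg)[hg' H1] /(is_wderivP _ _ hh)[hh' H2].
apply/is_wderivP; first exact: sqintB.
split; first exact: sqintB.
move=> psi tp; have h1 := test_L2 tp; have h2 := L2_derive_test j tp.
by rewrite !innerBl// H1// H2//; ring.
Qed.

Lemma wderiv_spec j g : (exists g', is_wderiv j g g') -> is_wderiv j g (wderiv j g).
Proof. by move=> [g' H]; exact: (xgetPex (cst 0) (ex_intro _ g' H)). Qed.

Lemma pihalf_wave k x : wave k (pi / 2) x = - wave k (- (pi / 2)) x :> R.
Proof.
by rewrite /wave cosDpihalf cosB cos_pihalf sin_pihalf mulr0 add0r mulr1.
Qed.

(** Waves are admissible test functions, so the definition of the weak derivative already fixes its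
    Fourier coefficients: differentiation swaps cosine and sine coefficients and multiplies by k_j,
    with a sign in the other case. *)
Lemma wderiv_coef0 j k g g' : L2 g -> is_wderiv j g g' ->
  inner g' (wave k 0) = (wavecoord j k)%:~R * inner g (wave k (- (pi / 2))).
Proof.
move=> hg /(is_wderivP _ _ hg)[hg' H].
have := H _ (test_wave k 0); rewrite derive_wave innerZr//; last exact: L2_wave.
rewrite add0r; have -> : inner g (wave k (pi / 2)) = - inner g (wave k (- (pi / 2))).
  rewrite -innerNl//; last exact: L2_wave.
  by apply: eq_Rintegral => x _; rewrite pihalf_wave mulrN mulNr.
by rewrite mulrN => /oppr_inj ->.
Qed.

Lemma wderiv_coef1 j k g g' : L2 g -> is_wderiv j g g' ->
  inner g' (wave k (- (pi / 2))) = - ((wavecoord j k)%:~R * inner g (wave k 0)).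
Proof.
move=> hg /(is_wderivP _ _ hg)[hg' H].
have := H _ (test_wave k (- (pi / 2))).
by rewrite derive_wave innerZr ?addNr// => [->|]; [rewrite opprK|exact: L2_wave].
Qed.

Lemma derive_pn N j g g' : L2 g -> is_wderiv j g g' ->
  'D_(dir R j) (pn N g) = pn N g'.
Proof.
move=> hg wg; rewrite /pn derive_test_sum; last first.
  by move=> k; apply: testZ; apply: testD; apply: testZ; exact: test_wave.
apply/funext => x; apply: eq_bigr => k _.
have tw a := test_wave (wavenum k) (a : R).
rewrite derive_testZE; last by apply: testD; exact: testZ.
rewrite (wderiv_coef0 _ hg wg) (wderiv_coef1 _ hg wg); congr (_ * _).
rewrite derive_testDE; [|exact: testZ..].
rewrite !derive_testZE// !derive_waveE.
by rewrite add0r addNr pihalf_wave; ring.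
Qed.

Lemma is_wderiv_pn N j g g' : L2 g -> is_wderiv j g g' ->
  is_wderiv j (pn N g) (pn N g').
Proof.
by move=> hg wg; rewrite -(derive_pn N hg wg); apply: is_wderiv_test; exact: test_pn.
Qed.

Lemma cvg_inner_pn g h : L2 g -> L2 h ->
  (fun N => inner (pn N g) h) @ \oo --> inner g h.
Proof.
move=> hg hh; apply/cvgrPdist_lt => e e0.
(* The summand 1 avoids division by zero when h vanishes. *)
pose s := Num.sqrt (inner h h) + 1.
have s0 : 0 < s by rewrite ltr_wpDl ?sqrtr_ge0.
have := pn_cvg hg => /cvgrPdist_lt /(_ ((e / s) ^+ 2)).
have es0 : 0 < (e / s) ^+ 2 by rewrite exprn_gt0// divr_gt0.
move=> /(_ es0); apply: filterS => N.
rewrite sub0r normrN ger0_norm ?inner_ge0// => dN.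
have hp := L2_pn N g; rewrite -innerBl//.
apply: le_lt_trans (inner_cauchy_schwarz (sqintB measurableT hg hp) hh) _.
have q1 : Num.sqrt (pn_dist N g) < e / s.
  rewrite -[ltRHS]ger0_norm ?divr_ge0 ?ltW// -sqrtr_sqr ltr_sqrt//.
have q2 := sqrtr_ge0 (inner h h); have q3 := sqrtr_ge0 (pn_dist N g).
move: q1; rewrite ltr_pdivlMr// /s => q1; apply: le_lt_trans q1.
by rewrite ler_wpM2l// lerDl.
Qed.

(** [pn N h] is a test function with derivative [pn N h']; the definition applies to it, and N tends
    to infinity. *)
Lemma wderiv_ibp j g g' h h' : L2 g -> L2 h -> is_wderiv j g g' -> is_wderiv j h h' ->
  inner g' h = - inner g h'.
Proof.
move=> hg hh wg wh; have hg' := is_wderiv_L2 wg; have hh' := is_wderiv_L2 wh.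
have c1 := cvg_inner_pn hh hg'.
have c2 : (fun N => inner (pn N h) g') @ \oo --> - inner g h'.
  rewrite (_ : (fun N => _) = fun N => - inner (pn N h') g).
    by rewrite innerC; apply: cvgN; exact: cvg_inner_pn.
  apply/funext => N; rewrite -(derive_pn N hh wh) innerC.
  have [_ /(_ _ (test_pn N h))] := (is_wderivP _ _ hg).1 wg.
  by rewrite [inner g _]innerC => ->; rewrite opprK.
by rewrite innerC; exact: (cvg_unique _ c1 c2).
Qed.

(** Uniqueness in the form in which it is used, inside inner products. Test functions separate,
    because h is the limit of its truncations. *)
Lemma wderiv_unique j g g1 g2 h : L2 g -> L2 h ->
  is_wderiv j g g1 -> is_wderiv j g g2 -> inner g1 h = inner g2 h.
Proof.
move=> hg hh w1 w2; have h1 := is_wderiv_L2 w1; have h2 := is_wderiv_L2 w2.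
have c1 := cvg_inner_pn hh h1; have c2 := cvg_inner_pn hh h2.
rewrite innerC [RHS]innerC.
suff e : (fun N => inner (pn N h) g1) = (fun N => inner (pn N h) g2).
  by rewrite e in c1; exact: (cvg_unique _ c1 c2).
apply/funext => N; have [_ /(_ _ (test_pn N h)) e1] := (is_wderivP _ _ hg).1 w1.
have [_ /(_ _ (test_pn N h)) e2] := (is_wderivP _ _ hg).1 w2.
by rewrite innerC [RHS]innerC; apply: oppr_inj; rewrite -e1 -e2.
Qed.

(* Parseval mode by mode: differentiation multiplies the k-th mode by |k|. *)
Lemma spectral_gap (m : R) g (D : 'I_2 -> R * R -> R) : L2 g ->
  (forall j, is_wderiv j g (D j)) ->
  (forall k, (k.1 ^+ 2 + k.2 ^+ 2)%:~R < m -> forall a, inner g (wave k a) = 0) ->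
  m * inner g g <= \sum_j inner (D j) (D j).
Proof.
move=> hg w low; have w0 := w ord0; have w1 := w (lift ord0 ord0).
rewrite big_ord_recl big_ord_recl big_ord0 addr0.
move: (D ord0) (D (lift ord0 ord0)) w0 w1 => g0 g1 w0 w1.
have h0 := is_wderiv_L2 w0; have h1 := is_wderiv_L2 w1.
have H N : m * inner (pn N g) g <= inner g0 g0 + inner g1 g1.
  apply: le_trans (lerD (pn_le N h0) (pn_le N h1)).
  rewrite (inner_pn_self N hg) (pn_parseval N hg) (pn_parseval N h0) (pn_parseval N h1).
  rewrite mulr_sumr -big_split /=.
  apply: ler_sum => k _.
  rewrite (wderiv_coef0 _ hg w0) (wderiv_coef1 _ hg w0).
  rewrite (wderiv_coef0 _ hg w1) (wderiv_coef1 _ hg w1) /wavecoord /=.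
  rewrite -mulrDr mulrCA; apply: ler_wpM2l; first by rewrite invr_ge0 sqr_ge0.
  set k1 := freq k.1; set k2 := freq k.2.
  (* Modes below the threshold are absent from g; on the others the factor |k|^2 is at least m. *)
  have [km|km] := ltP (k1 ^+ 2 + k2 ^+ 2)%:~R m.
    by rewrite !low// !mulr0 !oppr0 expr0n /= addr0 mulr0 !addr0.
  move: km; rewrite intrD !rmorphXn /=; set A0 := inner _ _; set B0 := inner _ _.
  move=> km; have := sqr_ge0 A0; have := sqr_ge0 B0 => b0 a0.
  have := ler_wpM2r (addr_ge0 a0 b0) km; lra.
have c : (fun N => m * inner (pn N g) g) @ \oo --> m * inner g g.
  by apply: cvgM; [exact: cvg_cst|exact: cvg_inner_pn].
rewrite -(cvg_lim _ c)//; apply: limr_le; first by apply/cvg_ex; exists (m * inner g g).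
exact: nearW.
Qed.

(** The gap m = N^2 for g - [pn N g], whose derivatives are the truncation errors of those of g and
    hence no larger. *)
Lemma poincare_high N g (D : 'I_2 -> R * R -> R) : L2 g ->
  (forall j, is_wderiv j g (D j)) ->
  N%:R ^+ 2 * (inner g g - inner (pn N g) (pn N g)) <= \sum_j inner (D j) (D j).
Proof.
move=> hg w.
have hp := L2_pn N g.
rewrite [X in _ * (X - _)](pn_pythagoras N hg) addrC addKr.
have := @spectral_gap (N%:R ^+ 2) _ _ (sqintB measurableT hg hp)
  (fun j => is_wderivB hg hp (w j) (is_wderiv_pn N hg (w j))).
move=> /(_ _)/le_trans; apply.
  move=> k kN a; rewrite innerBl//; last exact: L2_wave.
  rewrite inner_pn_wave ?subrr// /inball -(ler_int R) ltW//.
  by rewrite rmorphXn.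
by apply: ler_sum => j _; apply: pn_dist_le; exact: is_wderiv_L2 (w j).
Qed.

(** The gap m = 1: only the zero mode lies below it, and its coefficient is a multiple of the
    mean. *)
Lemma poincare_mean_free g (D : 'I_2 -> R * R -> R) : L2 g ->
  (forall j, is_wderiv j g (D j)) ->
  \int[torus R]_x g x = 0 -> inner g g <= \sum_j inner (D j) (D j).
Proof.
move=> hg w mg; rewrite -[leLHS]mul1r; apply: spectral_gap => // -[k1 k2] /= k0 a.
have k00 : k1 ^+ 2 + k2 ^+ 2 < 1 by rewrite -(ltr_int R).
have k10 : k1 = 0.
  by apply/eqP; rewrite -sqrf_eq0; have := sqr_ge0 k1; have := sqr_ge0 k2; lia.
have k20 : k2 = 0.
  by apply/eqP; rewrite -sqrf_eq0; have := sqr_ge0 k1; have := sqr_ge0 k2; lia.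
rewrite -[RHS](mulr0 (cos a)) -mg -RintegralZl//; last exact: L2_rint.
by apply: eq_Rintegral => x _; rewrite /wave k10 k20 /= !mul0r !add0r mulrC.
Qed.

End WeakDerivatives.

(** * Vector fields *)

Section FiniteFamilies.
Variables (R : realType) (I : finType).
Local Notation L2 := (sqint (torus R) setT).
Implicit Types U V : I -> R * R -> R.

(** The index type is arbitrary so that fields (two components) and gradients (four) share one inner
    product calculus. *)
Definition L2fam U := forall i, L2 (U i).

Definition fip U V : R := \sum_i inner (U i) (V i).

Definition fnorm U := Num.sqrt (fip U U).

Lemma fip_ge0 U : 0 <= fip U U.
Proof. by apply: sumr_ge0 => i _; exact: inner_ge0. Qed.

Lemma fnorm_sqr U : fnorm U ^+ 2 = fip U U.
Proof. by rewrite sqr_sqrtr// fip_ge0. Qed.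

Lemma fnorm_ge0 U : 0 <= fnorm U.
Proof. exact: sqrtr_ge0. Qed.

Lemma fipC U V : fip U V = fip V U.
Proof. by apply: eq_bigr => i _; rewrite innerC. Qed.

Lemma fipDl U1 U2 V : L2fam U1 -> L2fam U2 -> L2fam V ->
  fip (fun i x => U1 i x + U2 i x) V = fip U1 V + fip U2 V.
Proof. by move=> ? ? ?; rewrite -big_split; apply: eq_bigr => i _; rewrite innerDl. Qed.

Lemma fipBl U1 U2 V : L2fam U1 -> L2fam U2 -> L2fam V ->
  fip (fun i x => U1 i x - U2 i x) V = fip U1 V - fip U2 V.
Proof. by move=> ? ? ?; rewrite -sumrB; apply: eq_bigr => i _; rewrite innerBl. Qed.

Lemma fipZl c U V : L2fam U -> L2fam V -> fip (fun i x => c * U i x) V = c * fip U V.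
Proof. by move=> ? ?; rewrite mulr_sumr; apply: eq_bigr => i _; rewrite innerZl. Qed.

Lemma fipDr U1 U2 V : L2fam U1 -> L2fam U2 -> L2fam V ->
  fip V (fun i x => U1 i x + U2 i x) = fip V U1 + fip V U2.
Proof. by move=> *; rewrite fipC fipDl// !(fipC V). Qed.

Lemma fipBr U1 U2 V : L2fam U1 -> L2fam U2 -> L2fam V ->
  fip V (fun i x => U1 i x - U2 i x) = fip V U1 - fip V U2.
Proof. by move=> *; rewrite fipC fipBl// !(fipC V). Qed.

Lemma fipZr c U V : L2fam U -> L2fam V -> fip V (fun i x => c * U i x) = c * fip V U.
Proof. by move=> *; rewrite fipC fipZl// (fipC V). Qed.

Lemma L2famD U V : L2fam U -> L2fam V -> L2fam (fun i x => U i x + V i x).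
Proof. by move=> hU hV i; exact: sqintD. Qed.

Lemma L2famB U V : L2fam U -> L2fam V -> L2fam (fun i x => U i x - V i x).
Proof. by move=> hU hV i; exact: sqintB. Qed.

Lemma L2famZ c U : L2fam U -> L2fam (fun i x => c * U i x).
Proof. by move=> hU i; exact: sqintZ. Qed.

Lemma fip_cauchy_schwarz U V : L2fam U -> L2fam V -> `|fip U V| <= fnorm U * fnorm V.
Proof.
move=> hU hV; apply: quadratic_cauchy_schwarz => l.
have hlV := L2famZ l hV; have := fip_ge0 (fun i x => U i x + l * V i x).
rewrite fipDl//; last exact: L2famD.
rewrite !fipDr// !fipZl// !fipZr// (fipC V U); lra.
Qed.

Lemma fnormB_le U V : L2fam U -> L2fam V ->
  `|fnorm U - fnorm V| <= fnorm (fun i x => U i x - V i x).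
Proof.
move=> hU hV; rewrite -ler_sqr ?nnegrE ?fnorm_ge0// fnorm_sqr real_normK ?num_real//.
rewrite fipBl//; last exact: L2famB.
rewrite !fipBr// sqrrB !fnorm_sqr (fipC V U).
by have := ler_norm (fip U V); have := fip_cauchy_schwarz hU hV; lra.
Qed.

End FiniteFamilies.

(** * The spaces H, V and D(A) *)

Section Fields.
Variable R : realType.
Local Notation L2 := (sqint (torus R) setT).
Implicit Types (g h psi : R * R -> R) (u v w z phi : vfield R).

Lemma inL2v_L2fam u : inL2v u <-> L2fam u.
Proof. by split=> H i; [apply: inL2_sqint|apply: sqint_inL2]; exact: H. Qed.

Lemma ip_fip u v : L2fam u -> L2fam v -> ip u v = fip u v.
Proof. by move=> hu hv; rewrite /ip Rintegral_sum// => i _; exact: sqintM. Qed.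

Lemma normH_fnorm u : L2fam u -> normH u = fnorm u.
Proof. by move=> hu; rewrite /normH ip_fip. Qed.

Lemma normH_sqr u : L2fam u -> normH u ^+ 2 = ip u u.
Proof. by move=> hu; rewrite normH_fnorm// fnorm_sqr ip_fip. Qed.

Lemma normH_ge0 u : 0 <= normH u.
Proof. exact: sqrtr_ge0. Qed.

Lemma normV_ge0 u : 0 <= normV u.
Proof. exact: sqrtr_ge0. Qed.

Lemma ip_cauchy_schwarz u v : L2fam u -> L2fam v -> `|ip u v| <= normH u * normH v.
Proof.
by move=> hu hv; rewrite ip_fip// !normH_fnorm//; exact: fip_cauchy_schwarz.
Qed.

Lemma inH_L2fam u : inH u -> L2fam u.
Proof. by move=> [/inL2v_L2fam]. Qed.

Lemma divergence_freeP u : L2fam u ->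
  (forall psi, test psi -> \int[torus R]_x (\sum_i u i x * 'D_(dir R i) psi x) = 0) <->
  (forall psi, test psi -> \sum_i inner (u i) ('D_(dir R i) psi) = 0).
Proof.
move=> hu; have E psi : test psi ->
    \int[torus R]_x (\sum_i u i x * 'D_(dir R i) psi x) =
    \sum_i inner (u i) ('D_(dir R i) psi).
  by move=> tp; rewrite Rintegral_sum// => i _; apply: sqintM => //; exact: L2_derive_test.
by split=> H psi tp; [rewrite -E|rewrite E]; rewrite ?H.
Qed.

Lemma inHD u v : inH u -> inH v -> inH (fun i x => u i x + v i x).
Proof.
move=> hu hv; have hu2 := inH_L2fam hu; have hv2 := inH_L2fam hv.
case: hu hv => [_ mu du] [_ mv dv]; split.
- by apply/inL2v_L2fam; exact: L2famD.
- by move=> i; rewrite RintegralD ?mu ?mv ?addr0//; exact: L2_rint.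
- apply/divergence_freeP => [|psi tp]; first exact: L2famD.
  move/(divergence_freeP hu2): du => /(_ _ tp) du.
  move/(divergence_freeP hv2): dv => /(_ _ tp) dv.
  transitivity (\sum_i inner (u i) ('D_(dir R i) psi) +
                \sum_i inner (v i) ('D_(dir R i) psi)); last by rewrite du dv addr0.
  rewrite -big_split; apply: eq_bigr => i _.
  by rewrite innerDl//; exact: L2_derive_test.
Qed.

Lemma inHZ c u : inH u -> inH (fun i x => c * u i x).
Proof.
move=> hu; have hu2 := inH_L2fam hu.
case: hu => [_ mu du]; split.
- by apply/inL2v_L2fam; exact: L2famZ.
- by move=> i; rewrite RintegralZl ?mu ?mulr0//; exact: L2_rint.
- apply/divergence_freeP => [|psi tp]; first exact: L2famZ.
  move/(divergence_freeP hu2): du => /(_ _ tp) du.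
  transitivity (c * \sum_i inner (u i) ('D_(dir R i) psi)); last by rewrite du mulr0.
  rewrite mulr_sumr; apply: eq_bigr => i _.
  by rewrite innerZl//; exact: L2_derive_test.
Qed.

Lemma inHB u v : inH u -> inH v -> inH (fun i x => u i x - v i x).
Proof.
move=> hu hv; have := inHD hu (inHZ (-1) hv); congr inH.
by apply/funext => i; apply/funext => x; rewrite mulN1r.
Qed.

Definition grad u : 'I_2 * 'I_2 -> R * R -> R := fun k => wderiv k.2 (u k.1).

Lemma inV_H u : inV u -> inH u. Proof. by case. Qed.

Lemma inV_L2fam u : inV u -> L2fam u.
Proof. by move/inV_H/inH_L2fam. Qed.

Lemma inV_wderiv u i j : inV u -> is_wderiv j (u i) (wderiv j (u i)).
Proof. by move=> [_ /(_ i)[_ /(_ j)]] /wderiv_spec. Qed.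

Lemma inV_grad u : inV u -> L2fam (grad u).
Proof. by move=> hu k; exact: is_wderiv_L2 (inV_wderiv k.1 k.2 hu). Qed.

Lemma normV_fnorm u : normV u = fnorm (grad u).
Proof. by rewrite /normV /fnorm /fip (pair_big xpredT xpredT)/=. Qed.

Lemma normV_sqr u : normV u ^+ 2 =
  \sum_i \sum_j inner (wderiv j (u i)) (wderiv j (u i)).
Proof. by rewrite normV_fnorm fnorm_sqr /fip (pair_big xpredT xpredT). Qed.

Lemma inVB u v : inV u -> inV v -> inV (fun i x => u i x - v i x).
Proof.
move=> hu hv; have hu2 := inV_L2fam hu; have hv2 := inV_L2fam hv.
split; first by apply: inHB; exact: inV_H.
move=> i; split; first by apply: sqint_inL2; exact: L2famB.
move=> j; eexists; apply: is_wderivB => //.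
  exact: (inV_wderiv i j hu).
exact: (inV_wderiv i j hv).
Qed.

(** [normV] uses the chosen [wderiv], and the choice for a difference need not be the difference of
    the choices. This lets any weak derivatives compute the norm. *)
Lemma fnorm_wderiv (D : 'I_2 * 'I_2 -> R * R -> R) u : L2fam u ->
  (forall i j, is_wderiv j (u i) (D (i, j))) -> normV u = fnorm D.
Proof.
move=> hu H; rewrite normV_fnorm /fnorm; congr Num.sqrt; apply: eq_bigr => -[i j] _.
have w1 := H i j; have w2 : is_wderiv j (u i) (grad u (i, j)).
  by apply: wderiv_spec; exists (D (i, j)).
have h1 := is_wderiv_L2 w1; have h2 := is_wderiv_L2 w2.
rewrite (@wderiv_unique R j (u i) _ (D (i, j)))//.
by rewrite innerC (@wderiv_unique R j (u i) _ (D (i, j))).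
Qed.

Lemma normVB_le u v : inV u -> inV v ->
  `|normV u - normV v| <= normV (fun i x => u i x - v i x).
Proof.
move=> hu hv; have hu2 := inV_L2fam hu; have hv2 := inV_L2fam hv.
rewrite (@fnorm_wderiv (fun k x => grad u k x - grad v k x)
  (fun i x => u i x - v i x))//.
- by rewrite !normV_fnorm; apply: fnormB_le; exact: inV_grad.
- exact: L2famB.
- by move=> i j; apply: is_wderivB => //; exact: inV_wderiv.
Qed.

Lemma normHB_le u v : L2fam u -> L2fam v ->
  `|normH u - normH v| <= normH (fun i x => u i x - v i x).
Proof.
by move=> hu hv; rewrite !normH_fnorm//; [exact: fnormB_le|exact: L2famB].
Qed.

Lemma PN_fam N u : L2fam u -> PN N u = fun i => pn N (u i).
Proof. by move=> hu; apply/funext => i; exact: PN_pn. Qed.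

Lemma PN_L2fam N u : L2fam u -> L2fam (PN N u).
Proof. by move=> hu i; rewrite PN_fam//; exact: L2_pn. Qed.

Lemma PN_B N u v : L2fam u -> L2fam v ->
  PN N (fun i x => u i x - v i x) = fun i x => PN N u i x - PN N v i x.
Proof.
move=> hu hv; rewrite !PN_fam//; last exact: L2famB.
by apply/funext => i; rewrite pnB.
Qed.

Lemma normH_PN_le N u : L2fam u -> normH (PN N u) <= normH u.
Proof.
move=> hu; rewrite !normH_fnorm//; last exact: PN_L2fam.
by rewrite ler_wsqrtr// ler_sum// => i _; rewrite PN_fam//; exact: pn_le.
Qed.

Lemma ip_PN N u : L2fam u -> ip (PN N u) u = normH (PN N u) ^+ 2.
Proof.
move=> hu; have hp := PN_L2fam N hu.
rewrite normH_sqr// !ip_fip// PN_fam//; apply: eq_bigr => i _.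
exact: inner_pn_self.
Qed.

Lemma inV_PN N u : inV u -> inV (PN N u).
Proof.
move=> hu; have hu2 := inV_L2fam hu; have hp := PN_L2fam N hu2.
split; last first.
  move=> i; split; first exact: sqint_inL2.
  by move=> j; eexists; rewrite PN_fam//; apply: is_wderiv_pn => //; exact: inV_wderiv.
have [_ mu du] := inV_H hu; split.
- exact/inL2v_L2fam.
(* The mean is the zero mode, which truncation preserves. *)
- move=> i; have e g : \int[torus R]_x g x = inner g (wave (0, 0) 0).
    by apply: eq_Rintegral => x _; rewrite /wave /= !mul0r !addr0 cos0 mulr1.
  by rewrite e PN_fam// inner_pn_wave// -?e//.
- apply/divergence_freeP => // psi tp.
  (* Self-adjointness moves the truncation onto the test function, and [pn N psi] is again a test
     function. *)
  move/(divergence_freeP hu2): du => /(_ _ (test_pn N psi)) du.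
  rewrite -[RHS]du; apply: eq_bigr => i _.
  have -> : PN N u i = pn N (u i) by rewrite PN_pn.
  have -> := derive_pn N (test_L2 tp) (is_wderiv_test i tp).
  exact: (inner_pn N (hu2 i) (L2_derive_test i tp)).
Qed.

Lemma normH_high N u : inV u ->
  N%:R ^+ 2 * (normH u ^+ 2 - normH (PN N u) ^+ 2) <= normV u ^+ 2.
Proof.
move=> hu; have hu2 := inV_L2fam hu; have hp := PN_L2fam N hu2.
rewrite !normH_sqr// !ip_fip// /fip -sumrB mulr_sumr normV_sqr.
apply: ler_sum => i _; rewrite [PN N u i]PN_pn//.
exact: (poincare_high N (hu2 i) (fun j => inV_wderiv i j hu)).
Qed.

Lemma normH_le_normV u : inV u -> normH u <= normV u.
Proof.
move=> hu; have hu2 := inV_L2fam hu; have [_ mu _] := inV_H hu.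
rewrite -ler_sqr ?nnegrE ?normH_ge0 ?normV_ge0// normH_sqr// ip_fip// normV_sqr.
apply: ler_sum => i _.
exact: (poincare_mean_free (hu2 i) (fun j => inV_wderiv i j hu) (mu i)).
Qed.

Lemma A_laplacian u : inDA u ->
  A u = fun i x => - \sum_j wderiv j (wderiv j (u i)) x.
Proof. by move=> hu; rewrite /A asboolT. Qed.

Lemma ip_A u : inDA u -> ip (A u) u = normV u ^+ 2.
Proof.
move=> hu; have [hV h2] := hu; have hu2 := inV_L2fam hV.
have w i j : is_wderiv j (wderiv j (u i)) (wderiv j (wderiv j (u i))).
  by apply: wderiv_spec; have [_ /(_ j)[_ /(_ j)]] := h2 i.
have AE := A_laplacian hu.
have hw i j : L2 (wderiv j (wderiv j (u i))) := is_wderiv_L2 (w i j).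
have hA : L2fam (A u).
  by move=> i; rewrite AE; apply: sqintN => //; apply: sqint_sum.
rewrite ip_fip// normV_sqr AE; apply: eq_bigr => i _.
rewrite innerNl//; last exact: sqint_sum.
rewrite inner_suml// -sumrN; apply: eq_bigr => j _.
have wi := inV_wderiv i j hV.
by rewrite (wderiv_ibp (is_wderiv_L2 wi) (hu2 i) (w i j) wi) opprK.
Qed.

End Fields.

(** * The trilinear form *)

Lemma cvg_sqrt0 (R : realType) (u : nat -> R) : u @ \oo --> (0 : R) ->
  (fun n => Num.sqrt (u n)) @ \oo --> (0 : R).
Proof.
move=> u0; rewrite -(@sqrtr0 R).
have := cvg_comp _ _ u0 (@sqrt_continuous R 0); exact.
Qed.

Lemma cvg_sum_seq (R : realType) (I : Type) (s : seq I) (f : I -> nat -> R) (l : I -> R) :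
  (forall i, f i @ \oo --> l i) ->
  (fun n => \sum_(i <- s) f i n) @ \oo --> \sum_(i <- s) l i.
Proof.
move=> fl; elim: s => [|i s ih].
  by rewrite big_nil; under eq_fun do rewrite big_nil; exact: cvg_cst.
by rewrite big_cons; under eq_fun do rewrite big_cons; exact: cvgD.
Qed.

Section Trilinear.
Variable R : realType.
Local Notation L2 := (sqint (torus R) setT).
Local Notation plane := (measurableTypeR R * measurableTypeR R)%type.
Implicit Types (g h psi : R * R -> R) (u v w z phi : vfield R).

Definition energy_density phi : R * R -> R := fun x => \sum_i phi i x ^+ 2.

Lemma energy_density_ge0 phi x : 0 <= energy_density phi x.
Proof. by apply: sumr_ge0 => i _; exact: sqr_ge0. Qed.

Lemma measurable_energy_density phi : L2fam phi ->
  measurable_fun [set: plane] (energy_density phi).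
Proof.
by move=> hphi; apply: measurable_sum => i; apply: measurable_funX; have [] := hphi i.
Qed.

(** The inequality bounds an extended real by a real, so the L^4 norm is finite; its fourth power is
    the squared L^2 norm of the energy density. This form keeps all later estimates among real inner
    products. *)
Lemma ladyzhenskaya_L4 cL phi : 0 < cL -> ladyzhenskaya cL -> inV phi ->
  L2 (energy_density phi) /\
  inner (energy_density phi) (energy_density phi) <=
    (cL * normV phi * normH phi) ^+ 2.
Proof.
move=> cL0 lad hV; have hphi := inV_L2fam hV; have me := measurable_energy_density hphi.
set c := cL * normV phi * normH phi.
have c0 : 0 <= c by rewrite !mulr_ge0 ?normV_ge0 ?normH_ge0// ltW.
pose I := (\int[torus R]_x (energy_density phi x ^+ 2)%:E)%E.
have I0 : (0 <= I)%E by apply: integral_ge0 => x _; rewrite lee_fin sqr_ge0.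
have L0 : (0 <= normL4 phi)%E by exact: Lnorm_ge0.
have LI : (normL4 phi `^ 4 = I)%E.
  rewrite /normL4 powR_Lnorm//; apply: eq_integral => x _ /=; congr EFin.
  rewrite ger0_norm ?sqrtr_ge0// powR_mulrn ?sqrtr_ge0//.
  by rewrite -[4%N]/(2 * 2)%N exprM sqr_sqrtr// energy_density_ge0.
have := lad _ hV; rewrite -/c => Lc.
have [l lE] : exists l, normL4 phi = l%:E.
  by move: L0 Lc; case: (normL4 phi) => [l||]//; exists l.
have l0 : 0 <= l by move: L0; rewrite lE lee_fin.
have lc : l * l <= c by move: Lc; rewrite lE -EFinM lee_fin.
have IE : I = (l ^+ 4)%:E by rewrite -LI lE poweR_EFin powR_mulrn.
have hI : rint (torus R) setT (fun x => energy_density phi x ^+ 2).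
  apply/integrableP; split; first by apply/measurable_EFinP; exact: measurable_funX.
  under eq_integral do rewrite /= ger0_norm ?sqr_ge0//.
  by rewrite -/I IE ltry.
split; first by split.
rewrite inner_sqr /Rintegral -/I IE /=.
have -> : l ^+ 4 = (l * l) ^+ 2 by ring.
by apply: lerXn2r => //; rewrite nnegrE mulr_ge0.
Qed.

Lemma L4_component phi i : L2fam phi -> L2 (energy_density phi) ->
  L2 (fun x => phi i x ^+ 2) /\
  inner (fun x => phi i x ^+ 2) (fun x => phi i x ^+ 2) <=
  inner (energy_density phi) (energy_density phi).
Proof.
move=> hphi [me ie]; have [mi _] := hphi i.
have le x : (phi i x ^+ 2) ^+ 2 <= energy_density phi x ^+ 2.
  rewrite ler_sqr ?nnegrE ?sqr_ge0 ?energy_density_ge0// /energy_density (bigD1 i)//=.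
  by rewrite lerDl sumr_ge0// => j _; exact: sqr_ge0.
have ri : rint (torus R) setT (fun x => (phi i x ^+ 2) ^+ 2).
  apply: (le_rint _ _ _ ie) => //.
    by apply: measurable_funX; exact: measurable_funX.
  by move=> x _; rewrite ger0_norm ?sqr_ge0.
split; first by split => //; exact: measurable_funX.
by rewrite !inner_sqr; apply: le_Rintegral => //.
Qed.

(** Cauchy-Schwarz for g^2 and h^2: a product of two L^4 functions lies in L^2. *)
Lemma L2_mul_L4 g h : measurable_fun [set: plane] g -> measurable_fun [set: plane] h ->
  L2 (fun x => g x ^+ 2) -> L2 (fun x => h x ^+ 2) ->
  L2 (fun x => g x * h x) /\
  inner (fun x => g x * h x) (fun x => g x * h x) <=
  Num.sqrt (inner (fun x => g x ^+ 2) (fun x => g x ^+ 2)) *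
  Num.sqrt (inner (fun x => h x ^+ 2) (fun x => h x ^+ 2)).
Proof.
move=> mg mh hg hh.
have e x : (g x * h x) ^+ 2 = g x ^+ 2 * h x ^+ 2 by ring.
split.
  split; first exact: measurable_funM.
  by have := sqintM measurableT hg hh; apply: eq_rint => // x _.
rewrite inner_sqr; under eq_Rintegral do rewrite e.
by apply: le_trans (ler_norm _) _; exact: inner_cauchy_schwarz.
Qed.

(* Completes the square: sum_i (sum_j a_j b_ij) a_i pairs b with the rank one
   matrix a_i a_j, whose Frobenius norm is sum_i a_i^2. *)
Lemma rank_one_square (a : 'I_2 -> R) (b : 'I_2 -> 'I_2 -> R) l :
  (\sum_i a i ^+ 2) ^+ 2 + 2 * l * (\sum_i (\sum_j a j * b i j) * a i) +
    l ^+ 2 * (\sum_i \sum_j b i j ^+ 2) =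
  \sum_i \sum_j (a i * a j + l * b i j) ^+ 2.
Proof. by rewrite !big_ord_recl !big_ord0; ring. Qed.

(** One Cauchy-Schwarz for the full matrices, via [rank_one_square], instead of one per entry, so
    that no factor beyond cL appears. *)
Lemma advection_bound cL z v : 0 < cL -> ladyzhenskaya cL -> inV z -> inV v ->
  inL2v (advection z v) ->
  `|ip (advection z v) z| <= cL * normV z * normH z * normV v.
Proof.
move=> cL0 lad hz hv /inL2v_L2fam hadv; have hz2 := inV_L2fam hz.
have [hE bE] := ladyzhenskaya_L4 cL0 lad hz.
have hgrad := inV_grad hv.
pose P x := \sum_i \sum_j (wderiv j (v i) x) ^+ 2.
have rP : rint (torus R) setT P.
  by apply: rint_sum => // i _; apply: rint_sum => // j _; have [] := hgrad (i, j).
have IP : \int[torus R]_x P x = normV v ^+ 2.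
  rewrite normV_sqr Rintegral_sum//; last first.
    by move=> i _; apply: rint_sum => // j _; have [] := hgrad (i, j).
  by apply: eq_bigr => i _; rewrite Rintegral_sum// => j _; have [] := hgrad (i, j).
have [_ rE] := hE.
pose F x := \sum_i advection z v i x * z i x.
have rF : rint (torus R) setT F by apply: rint_sum => // i _; exact: sqintM.
have : `|\int[torus R]_x F x| <=
    Num.sqrt (\int[torus R]_x energy_density z x ^+ 2) * Num.sqrt (\int[torus R]_x P x).
  apply: quadratic_cauchy_schwarz => l.
  rewrite -!RintegralZl// -!RintegralD//; [|by do ?[apply: rintD|apply: rintZ]..].
  apply: Rintegral_ge0 => x _.
  have -> : energy_density z x ^+ 2 + 2 * l * F x + l ^+ 2 * P x =
      \sum_i \sum_j (z i x * z j x + l * wderiv j (v i) x) ^+ 2.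
    exact: (rank_one_square (fun i => z i x) (fun i j => wderiv j (v i) x) l).
  by apply: sumr_ge0 => i _; apply: sumr_ge0 => j _; exact: sqr_ge0.
move/le_trans; apply; rewrite IP sqrtr_sqr ger0_norm ?normV_ge0//.
apply: ler_wpM2r; first exact: normV_ge0.
rewrite -[leRHS]ger0_norm; last by rewrite !mulr_ge0 ?normV_ge0 ?normH_ge0// ltW.
by rewrite -sqrtr_sqr; apply: ler_wsqrtr; rewrite -inner_sqr.
Qed.

Lemma normH_PN_cvg z : L2fam z ->
  (fun N => normH (fun i x => z i x - PN N z i x)) @ \oo --> (0 : R).
Proof.
move=> hz; have e N : normH (fun i x => z i x - PN N z i x) =
    Num.sqrt (\sum_i pn_dist N (z i)).
  rewrite normH_fnorm; last by apply: L2famB => //; exact: PN_L2fam.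
  by rewrite PN_fam.
under eq_fun do rewrite e; apply: cvg_sqrt0.
rewrite [X in _ --> X](_ : 0 = \sum_(i : 'I_2) 0); last by rewrite big1.
by apply: (cvg_sum_seq _ (f := fun i N => pn_dist N (z i)) (l := fun=> 0)) => i; exact: pn_cvg.
Qed.

(** Each component pairs v_j z_i with the derivative of z_i, formally half of v . grad (z_i^2). The
    divergence condition of v is tested with (P_N z_i)^2, and P_N z_i = z_i - d separates the wanted
    term from an error carrying the factor v_j d. *)
Lemma advection_skew (cL : R) v z : 0 < cL -> ladyzhenskaya cL -> inV v -> inV z ->
  inL2v (advection v z) -> ip (advection v z) z = 0.
Proof.
move=> cL0 lad hv hz /inL2v_L2fam hadv.
have hv2 := inV_L2fam hv; have hz2 := inV_L2fam hz.
have [hEv _] := ladyzhenskaya_L4 cL0 lad hv.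
have [hEz _] := ladyzhenskaya_L4 cL0 lad hz.
have mv j : measurable_fun [set: plane] (v j) by have [] := hv2 j.
have mz j : measurable_fun [set: plane] (z j) by have [] := hz2 j.
have hvz j i : L2 (fun x => v j x * z i x).
  by have [] := L2_mul_L4 (mv j) (mz i) (L4_component j hv2 hEv).1
    (L4_component i hz2 hEz).1.
have hd i j : L2 (wderiv j (z i)) := is_wderiv_L2 (inV_wderiv i j hz).
have E i : inner (advection v z i) (z i) =
    \sum_j inner (fun x => v j x * z i x) (wderiv j (z i)).
  rewrite /inner /advection -Rintegral_sum//; last by move=> j _; exact: sqintM.
  by apply: eq_Rintegral => x _; rewrite mulr_suml; apply: eq_bigr => j _; ring.
rewrite ip_fip// /fip big1// => i _; rewrite E.
pose D N k x := z k x - PN N z k x.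
have hDV N : inV (D N) by apply: inVB => //; exact: inV_PN.
pose d N x := z i x - pn N (z i) x.
have dD N : d N = D N i by rewrite /D PN_fam.
(* The factor |D N| on the right tends to 0 while ||D N|| merely stays bounded by ||z||; that is
   enough to send v_j d to 0 in L^2. *)
have hvd N j : L2 (fun x => v j x * d N x) /\
    inner (fun x => v j x * d N x) (fun x => v j x * d N x) <=
    Num.sqrt (inner (energy_density v) (energy_density v)) *
      (cL * normV z * normH (D N)).
  rewrite dD; have hD2 := inV_L2fam (hDV N).
  have mD : measurable_fun [set: plane] (D N i) by have [] := hD2 i.
  have [hED bD] := ladyzhenskaya_L4 cL0 lad (hDV N).
  have [c1 c2] := L4_component j hv2 hEv; have [c3 c4] := L4_component i hD2 hED.
  have [h1 h2] := L2_mul_L4 (mv j) mD c1 c3; split; first exact: h1.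
  apply: le_trans h2 _; apply: ler_pM; rewrite ?sqrtr_ge0//.
    exact: ler_wsqrtr.
  apply: (@le_trans _ _ (cL * normV (D N) * normH (D N))).
    rewrite -[leRHS]ger0_norm; last by rewrite !mulr_ge0 ?normV_ge0 ?normH_ge0// ltW.
    by rewrite -sqrtr_sqr; apply: ler_wsqrtr; exact: le_trans c4 bD.
  apply: ler_wpM2r; first exact: normH_ge0.
  apply: ler_wpM2l; first exact: ltW.
  (* The gradient of the truncation error is the truncation error of the gradient, hence no larger
     than the gradient. *)
  rewrite (@fnorm_wderiv R (fun k x => grad z k x - pn N (grad z k) x)) //; last first.
    move=> k l; rewrite /D PN_fam//.
    by apply: is_wderivB; [|exact: L2_pn| |apply: is_wderiv_pn] => //; exact: inV_wderiv.
  rewrite normV_fnorm ler_wsqrtr// ler_sum// => k _.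
  by apply: pn_dist_le; exact: inV_grad.
(* The weak divergence condition of v for (P_N z_i)^2, divided by 2. *)
have T0 N : \sum_j (inner (fun x => v j x * z i x) (pn N (wderiv j (z i))) -
     inner (fun x => v j x * d N x) (pn N (wderiv j (z i)))) = 0.
  have [_ _ divv] := inV_H hv.
  move/(divergence_freeP hv2): divv => /(_ _ (testM (test_pn N (z i)) (test_pn N (z i)))).
  have e j : inner (v j) ('D_(dir R j) (fun x => pn N (z i) x * pn N (z i) x)) =
      2 * (inner (fun x => v j x * z i x) (pn N (wderiv j (z i))) -
     inner (fun x => v j x * d N x) (pn N (wderiv j (z i)))).
    have [h1 _] := hvd N j; have hp := L2_pn N (wderiv j (z i)).
    rewrite -innerBl// -innerZl//; last exact: sqintB.
    apply: eq_Rintegral => x _.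
    rewrite derive_testME; [|exact: test_pn..].
    have /(congr1 (fun f => f x)) -> := derive_pn N (hz2 i) (inV_wderiv i j hz).
    by rewrite /d; ring.
  under eq_bigr do rewrite e.
  by rewrite -mulr_sumr => /eqP; rewrite mulf_eq0 pnatr_eq0 /= => /eqP.
have lim2 j : (fun N => inner (fun x => v j x * d N x) (pn N (wderiv j (z i)))) @ \oo
    --> (0 : R).
  pose K := Num.sqrt (inner (energy_density v) (energy_density v)) * (cL * normV z).
  pose e N := Num.sqrt (K * normH (D N)) *
      Num.sqrt (inner (wderiv j (z i)) (wderiv j (z i))).
  have ce : e @ \oo --> (0 : R).
    rewrite -[X in _ --> X](mul0r (Num.sqrt (inner (wderiv j (z i)) (wderiv j (z i))))).
    apply: cvgM; last exact: cvg_cst.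
    apply: cvg_sqrt0.
    rewrite -[X in _ --> X](mulr0 K); apply: cvgM; first exact: cvg_cst.
    exact: normH_PN_cvg.
  apply: norm_cvg0; apply: (@squeeze_cvgr _ _ _ _ (cst 0) e) => //; last exact: cvg_cst.
  apply: nearW => N; rewrite normr_ge0 /=.
  have [h1 h2] := hvd N j.
  apply: le_trans (inner_cauchy_schwarz h1 (L2_pn N _)) _.
  apply: ler_pM; rewrite ?sqrtr_ge0//; apply: ler_wsqrtr.
    by rewrite /K -mulrA.
  exact: pn_le.
have lim1 j : (fun N => inner (fun x => v j x * z i x) (pn N (wderiv j (z i)))) @ \oo
    --> inner (fun x => v j x * z i x) (wderiv j (z i)).
  by rewrite innerC; under eq_fun do rewrite innerC; exact: cvg_inner_pn.
have c : (fun N => \sum_j (inner (fun x => v j x * z i x) (pn N (wderiv j (z i))) -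
     inner (fun x => v j x * d N x) (pn N (wderiv j (z i))))) @ \oo -->
    \sum_j inner (fun x => v j x * z i x) (wderiv j (z i)).
  apply: (cvg_sum_seq _ (f := fun j N => inner (fun x => v j x * z i x) (pn N (wderiv j (z i))) -
     inner (fun x => v j x * d N x) (pn N (wderiv j (z i))))) => j.
  by rewrite -[X in _ --> X]subr0; apply: cvgB; [exact: lim1|exact: lim2].
rewrite (funext T0) in c.
exact: (cvg_unique _ c (cvg_cst _)).
Qed.

End Trilinear.

(** * Measurability in time *)

(* In [{ae lebesgue_measure, forall t, t \in `[0, tau] -> _}] the bound variable
   gets an order-theoretic carrier, on which the library hint does not fire. *)
#[export] Hint Extern 0 (Filter (nbhs (almost_everywhere _))) =>
  exact: (ae_filter_ringOfSetsType (@lebesgue_measure _)) : typeclass_instances.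

Section TimeDependence.
Variable R : realType.
Local Notation line := (measurableTypeR R).
Local Notation leb := (@lebesgue_measure R).
Implicit Types (u v w z h : vfield R) (vt wt zt : R -> vfield R) (tau t s : R).
Local Notation Itv tau := ([set` `[0%R, tau]%R] : set line).

Lemma ip_suml (m : nat) (a : 'I_m -> R) (c : 'I_m -> vfield R) z :
  (forall j, L2fam (c j)) -> L2fam z ->
  ip (fun i x => \sum_j a j * c j i x) z = \sum_j a j * ip (c j) z.
Proof.
move=> hc hz; have hs : L2fam (fun i x => \sum_j a j * c j i x).
  by move=> i; apply: sqint_sum => // j _; apply: sqintZ => //; exact: hc.
rewrite ip_fip// /fip.
under eq_bigr => i _.
  rewrite inner_suml//; last by move=> j _; apply: sqintZ => //; exact: hc.
  over.
rewrite exchange_big /=; apply: eq_bigr => j _.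
rewrite ip_fip// /fip mulr_sumr; apply: eq_bigr => i _.
by rewrite innerZl//; exact: hc.
Qed.

Lemma ipC u v : ip u v = ip v u.
Proof. by apply: eq_Rintegral => x _; apply: eq_bigr => i _; rewrite mulrC. Qed.

Lemma ipBl u v w : L2fam u -> L2fam v -> L2fam w ->
  ip (fun i x => u i x - v i x) w = ip u w - ip v w.
Proof. by move=> hu hv hw; rewrite !ip_fip//; [exact: fipBl|exact: L2famB]. Qed.

Lemma ipDl u v w : L2fam u -> L2fam v -> L2fam w ->
  ip (fun i x => u i x + v i x) w = ip u w + ip v w.
Proof. by move=> hu hv hw; rewrite !ip_fip//; [exact: fipDl|exact: L2famD]. Qed.

Lemma ipZl c u w : L2fam u -> L2fam w -> ip (fun i x => c * u i x) w = c * ip u w.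
Proof. by move=> hu hw; rewrite !ip_fip//; [exact: fipZl|exact: L2famZ]. Qed.

Lemma ipBr u v w : L2fam u -> L2fam v -> L2fam w ->
  ip w (fun i x => u i x - v i x) = ip w u - ip w v.
Proof. by move=> *; rewrite ipC ipBl// !(ipC w). Qed.

Lemma ipDr u v w : L2fam u -> L2fam v -> L2fam w ->
  ip w (fun i x => u i x + v i x) = ip w u + ip w v.
Proof. by move=> *; rewrite ipC ipDl// !(ipC w). Qed.

(** Only wt needs simple approximations: for a simple field the pairing is a finite sum of
    indicators times pairings of zt with fixed fields. Weak measurability of zt therefore
    suffices. *)
Lemma measurable_ip_strong tau wt zt : strongly_measurable `[0, tau] wt ->
  (forall t, t \in `[0, tau] -> inH (zt t)) ->
  (forall h, inH h -> measurable_fun (Itv tau) (fun t => ip (zt t) h)) ->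
  measurable_fun (Itv tau) (fun t => ip (wt t) (zt t)).
Proof.
move=> [hw [s [ss cs]]] hz mz.
apply: (@measurable_fun_cvg _ _ _ _ (fun n t => ip (s n t) (zt t))) => [n|t tD].
  have [m [E [c [hE sE]]]] := ss n.
  apply: (@eq_measurable_fun _ _ _ _ _ (fun t => \sum_j \1_(E j) t * ip (zt t) (c j))).
    move=> t /set_mem tD; rewrite sE ip_suml//.
    - by apply: eq_bigr => j _; rewrite ipC.
    - by move=> j; apply: inH_L2fam; exact: (hE j).2.
    - by apply: inH_L2fam; exact: hz.
  apply: measurable_sum => j; apply: measurable_funM; last exact: mz (hE j).2.
  by apply: measurable_funTS; apply: measurable_indic; exact: (hE j).1.
have hzt := inH_L2fam (hz t tD); have hwt := inH_L2fam (hw t tD).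
have hs n : L2fam (s n t).
  have [m [E [c [hE ->]]]] := ss n => i; apply: sqint_sum => // j _.
  by apply: sqintZ => //; apply: inH_L2fam; exact: (hE j).2.
apply/cvgrPdist_lt => e e0.
have k0 : 0 < normH (zt t) + 1 by rewrite ltr_wpDl ?normH_ge0.
have := cs t tD => /cvgrPdist_lt /(_ (e / (normH (zt t) + 1)) (divr_gt0 e0 k0)).
apply: filterS => n; rewrite sub0r normrN ger0_norm ?normH_ge0// ltr_pdivlMr// => hn.
rewrite distrC -ipBl//; apply: le_lt_trans hn.
apply: le_trans (ip_cauchy_schwarz (L2famB (hs n) hwt) hzt) _.
by apply: ler_wpM2l; [exact: normH_ge0|rewrite lerDl].
Qed.

Lemma measurable_ip_weak tau wt h : strongly_measurable `[0, tau] wt -> inH h ->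
  measurable_fun (Itv tau) (fun t => ip (wt t) h).
Proof.
by move=> mw hh; apply: (measurable_ip_strong (zt := fun=> h) mw) => // h' _; exact: measurable_cst.
Qed.

Lemma measurable_ip tau wt zt : strongly_measurable `[0, tau] wt ->
  strongly_measurable `[0, tau] zt ->
  measurable_fun (Itv tau) (fun t => ip (wt t) (zt t)).
Proof.
move=> mw mz; apply: measurable_ip_strong => //; first by case: mz.
by move=> h hh; exact: measurable_ip_weak.
Qed.

Lemma L2H_sqint tau wt : L2H tau wt -> sqint leb (Itv tau) (fun t => normH (wt t)).
Proof.
move=> [mw iw]; split => //.
rewrite /normH; apply: measurableT_comp.
  by apply: continuous_measurable_fun; exact: sqrt_continuous.
exact: measurable_ip.
Qed.

Lemma rint_ip tau wt zt : L2H tau wt -> (forall t, t \in `[0, tau] -> inH (zt t)) ->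
  measurable_fun (Itv tau) (fun t => ip (wt t) (zt t)) ->
  sqint leb (Itv tau) (fun t => normH (zt t)) ->
  rint leb (Itv tau) (fun t => ip (wt t) (zt t)).
Proof.
move=> hw hz mip sz; have sw := L2H_sqint hw.
apply: (le_rint _ mip _ (sqintM _ sw sz)) => // t tD.
by apply: ip_cauchy_schwarz; apply: inH_L2fam; [case: hw => -[+ _] _; apply|exact: hz].
Qed.

Lemma rint_ip_L2H tau wt zt : L2H tau wt -> L2H tau zt ->
  rint leb (Itv tau) (fun t => ip (wt t) (zt t)).
Proof.
move=> hw hz; have [mz _] := hz; apply: rint_ip => //.
- by case: mz.
- by apply: measurable_ip => //; case: hw.
- exact: L2H_sqint.
Qed.

Lemma Rintegral_ip_cauchy_schwarz tau wt zt : L2H tau wt -> L2H tau zt ->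
  `|\int[leb]_(t in `[0, tau]) ip (wt t) (zt t)| <=
  Num.sqrt (\int[leb]_(t in `[0, tau]) normH (wt t) ^+ 2) *
  Num.sqrt (\int[leb]_(t in `[0, tau]) normH (zt t) ^+ 2).
Proof.
move=> hw hz; have sw := L2H_sqint hw; have sz := L2H_sqint hz.
have ri := rint_ip_L2H hw hz.
apply: le_trans (le_trans (ler_norm _) (integral_cauchy_schwarz _ sw sz)) => //.
apply: le_trans (le_normr_Rintegral _ ri) _ => //.
apply: le_Rintegral => //; [exact: rint_norm|exact: sqintM|].
move=> t tD; apply: ip_cauchy_schwarz; apply: inH_L2fam.
  by case: hw => -[+ _] _; apply.
by case: hz => -[+ _] _; apply.
Qed.

Lemma eq_ae_ip u u' v : L2fam u -> L2fam u' -> L2fam v -> eq_ae u u' -> ip u v = ip u' v.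
Proof.
move=> hu hu' hv e; rewrite !ip_fip//; apply: eq_bigr => i _.
apply: ae_eq_Rintegral => //.
- by apply: (@rint_measurable _ _ _ (torus R)); apply: sqintM.
- by apply: (@rint_measurable _ _ _ (torus R)); apply: sqintM.
- by apply: filterS e => x -> _.
Qed.

(** A change on a null set leaves the predicate [is_wderiv] unchanged, and [xget] selects from the
    predicate alone; hence an equality of functions rather than one almost everywhere. *)
Lemma eq_ae_wderiv j (g g' : R * R -> R) : sqint (torus R) setT g ->
  sqint (torus R) setT g' -> {ae torus R, forall x, g x = g' x} ->
  wderiv j g = wderiv j g'.
Proof.
move=> hg hg' e; rewrite /wderiv; congr (xget _ _).
have E psi : test psi -> inner g ('D_(dir R j) psi) = inner g' ('D_(dir R j) psi).
  move=> tp; have hp := L2_derive_test j tp; apply: ae_eq_Rintegral => //.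
  - by apply: (@rint_measurable _ _ _ (torus R)); apply: sqintM.
  - by apply: (@rint_measurable _ _ _ (torus R)); apply: sqintM.
  - by apply: filterS e => x -> _.
apply/funext => D; apply/propext.
by split=> /is_wderivP[]// hD H; apply/is_wderivP => //; split => // psi tp;
  [rewrite -E|rewrite E]; rewrite ?H.
Qed.

Lemma eq_ae_A u u' : inDA u -> inDA u' -> eq_ae u u' -> A u = A u'.
Proof.
move=> hu hu' e; have wE i j : wderiv j (u i) = wderiv j (u' i).
  apply: eq_ae_wderiv; last by apply: filterS e => y /(_ i).
    by apply: inV_L2fam; case: hu.
  by apply: inV_L2fam; case: hu'.
apply: (eq_trans (A_laplacian hu)); apply: (eq_trans _ (esym (A_laplacian hu'))).
apply/funext => i; apply/funext => x.
apply: (congr1 (fun y => - y)); apply: eq_bigr => j _.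
exact: (congr1 (fun D => wderiv j D x) (wE i j)).
Qed.

Lemma L2DA_ae tau vt : L2DA tau vt ->
  {ae leb, forall t : R, t \in `[0, tau] -> inDA (vt t)}.
Proof. by case. Qed.

(** Well-definedness on classes: representatives may differ on null sets of time and, at a given
    time, on null sets of space. *)
Lemma W_eq_ae tau (v1 v2 v1' v2' : R -> vfield R) : L2DA tau v1 -> L2H tau v2 -> L2DA tau v1' -> L2H tau v2' ->
  {ae leb, forall t : R, t \in `[0, tau] -> eq_ae (v1' t) (v1 t) /\ eq_ae (v2' t) (v2 t)} ->
  W tau v1' v2' = W tau v1 v2.
Proof.
move=> /[dup] /L2DA_ae d1 [_ h1] h2 /[dup] /L2DA_ae d1' [_ h1'] h2' e.
apply: (congr1 (fun y => - y)).
apply: ae_eq_Rintegral => //.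
- exact: rint_measurable (rint_ip_L2H h1' h2').
- exact: rint_measurable (rint_ip_L2H h1 h2).
suff : {ae leb, forall t : R, t \in `[0, tau] ->
    ip (A (v1' t)) (v2' t) = ip (A (v1 t)) (v2 t)} by [].
apply: filterS3 d1 d1' e => t k1 k2 k3 tD.
have [e1 e2] := k3 tD; rewrite (eq_ae_A (k2 tD) (k1 tD) e1).
rewrite ipC [RHS]ipC; apply: eq_ae_ip => //; apply: inH_L2fam.
- by case: h2' => -[+ _] _; apply.
- by case: h2 => -[+ _] _; apply.
- by case: h1 => -[+ _] _; apply.
Qed.

End TimeDependence.

(** * The energy identity *)

Section Energy.
Variable R : realType.
Local Notation line := (measurableTypeR R).
Local Notation leb := (@lebesgue_measure R).
Implicit Types (u v w z h : vfield R) (vt wt zt : R -> vfield R) (tau t s : R).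
Local Notation Itv tau := ([set` `[0%R, tau]%R] : set line).

(** Every quantity tracked in time is Lipschitz with respect to [normV], so one lemma yields all the
    continuity statements. *)
Lemma C0V_continuous tau vt (n : R -> R) c : C0V tau vt ->
  (forall s t, s \in `[0, tau] -> t \in `[0, tau] ->
     `|n s - n t| <= c * normV (fun i x => vt s i x - vt t i x)) ->
  {within `[0, tau], continuous n}.
Proof.
move=> [_ cv] nc; apply/subspace_continuousP => t tD.
have c1 : 0 < `|c| + 1 by rewrite ltr_wpDl.
apply/cvgrPdist_lt => e e0.
have := cv t tD => /cvgrPdist_lt /(_ _ (divr_gt0 e0 c1)).
rewrite !near_withinE; apply: filterS => s H sD; have := H sD.
rewrite sub0r normrN ger0_norm ?normV_ge0// ltr_pdivlMr// => hs.
rewrite distrC; apply: le_lt_trans (nc _ _ sD tD) _; apply: le_lt_trans hs.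
rewrite mulrC; apply: ler_wpM2l; first exact: normV_ge0.
by rewrite (le_trans (ler_norm c))// lerDl.
Qed.

Lemma within_bounded tau (n : R -> R) : {within `[0, tau], continuous n} ->
  exists M : R, forall t, t \in `[0, tau] -> `|n t| <= M.
Proof.
move=> cn; have [M [_ HM]] : bounded_set (n @` `[0, tau]%classic).
  by apply: compact_bounded; apply: continuous_compact => //; exact: segment_compact.
exists (`|M| + 1) => t tD; apply: HM; last by exists t.
by rewrite (le_lt_trans (ler_norm M))// ltrDl.
Qed.

Lemma within_sqint tau (n : R -> R) : {within `[0, tau], continuous n} ->
  sqint leb (Itv tau) n.
Proof.
move=> cn; have [M HM] := within_bounded cn.
apply: (bounded_sqint _ (c := M)) => //.
- by apply: subspace_continuous_measurable_fun.
- by rewrite /= lebesgue_measure_itv /=; case: ifP => _; rewrite ?ltry.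
Qed.

Lemma C0V_H tau vt t : C0V tau vt -> t \in `[0, tau] -> inH (vt t).
Proof. by move=> [hV _] /hV /inV_H. Qed.

Lemma C0V_ip tau vt h : C0V tau vt -> inH h ->
  {within `[0, tau], continuous (fun t => ip (vt t) h)}.
Proof.
move=> hv hh; have hh2 := inH_L2fam hh.
apply: (C0V_continuous (c := normH h) hv) => s t sD tD.
have hs := inH_L2fam (C0V_H hv sD); have ht := inH_L2fam (C0V_H hv tD).
rewrite -ipBl//; apply: le_trans (ip_cauchy_schwarz (L2famB hs ht) hh2) _.
rewrite mulrC; apply: ler_wpM2l; first exact: normH_ge0.
by apply: normH_le_normV; apply: inVB; case: hv => + _; apply.
Qed.

Lemma C0V_normV tau vt : C0V tau vt -> {within `[0, tau], continuous (fun t => normV (vt t))}.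
Proof.
move=> hv; apply: (C0V_continuous (c := 1) hv) => s t sD tD; rewrite mul1r.
by apply: normVB_le; case: hv => + _; apply.
Qed.

Lemma C0V_normH tau vt : C0V tau vt -> {within `[0, tau], continuous (fun t => normH (vt t))}.
Proof.
move=> hv; apply: (C0V_continuous (c := 1) hv) => s t sD tD; rewrite mul1r.
have hs := inH_L2fam (C0V_H hv sD); have ht := inH_L2fam (C0V_H hv tD).
apply: le_trans (normHB_le hs ht) _.
by apply: normH_le_normV; apply: inVB; case: hv => + _; apply.
Qed.

Lemma C0V_normH_PN N tau vt : C0V tau vt ->
  {within `[0, tau], continuous (fun t => normH (PN N (vt t)))}.
Proof.
move=> hv; apply: (C0V_continuous (c := 1) hv) => s t sD tD; rewrite mul1r.
have hs := inH_L2fam (C0V_H hv sD); have ht := inH_L2fam (C0V_H hv tD).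
apply: le_trans (normHB_le (PN_L2fam N hs) (PN_L2fam N ht)) _.
rewrite -PN_B//; apply: le_trans (normH_PN_le N (L2famB hs ht)) _.
by apply: normH_le_normV; apply: inVB; case: hv => + _; apply.
Qed.

(** Continuity on the compact interval bounds the set; without a bound [sup] would be a default
    value. *)
Lemma C0V_normV_sup tau vt t : C0V tau vt -> t \in `[0, tau] ->
  normV (vt t) <= sup [set normV (vt t) | t in `[0, tau]].
Proof.
move=> hv tD; have [M HM] := within_bounded (C0V_normV hv).
apply: ub_le_sup; last by exists t.
by exists M => _ [s sD <-]; apply: le_trans (ler_norm _) (HM _ sD).
Qed.

Lemma rint_ip_C0V tau wt vt : L2H tau wt -> C0V tau vt ->
  rint leb (Itv tau) (fun t => ip (wt t) (vt t)).
Proof.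
move=> hw hv; have hvH t : t \in `[0, tau] -> inH (vt t) by exact: C0V_H.
apply: rint_ip => //; last exact/within_sqint/C0V_normH.
apply: measurable_ip_strong => //; first by case: hw.
by move=> h hh; have [] := within_sqint (C0V_ip hv hh).
Qed.

(** Over n + 1 equal steps the factor t - s is tau / (n + 1) and the increments of k telescope, so
    |F(tau) - F(0)| is at most c tau (k(tau) - k(0)) / (n + 1) for every n. *)
Lemma quadratic_increments_const (F k : R -> R) tau c : 0 <= tau ->
  (forall s t, 0 <= s -> s <= t -> t <= tau ->
     `|F t - F s| <= c * (t - s) * (k t - k s)) ->
  F tau = F 0.
Proof.
move=> tau0 H; apply/eqP; rewrite -subr_eq0 -normr_eq0; apply/eqP.
set a := `|_|; have a0 : 0 <= a by exact: normr_ge0.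
set b := c * tau * (k tau - k 0).
have step n : a <= n.+1%:R^-1 * b.
  pose p (i : nat) : R := tau * (i%:R / n.+1%:R).
  have pi0 i : 0 <= p i by rewrite mulr_ge0// divr_ge0.
  have pS i : p i.+1 - p i = tau * n.+1%:R^-1.
    by rewrite /p -[i.+1]addn1 natrD; field.
  have G m : (m <= n.+1)%N ->
      `|F (p m) - F 0| <= c * (tau * n.+1%:R^-1) * (k (p m) - k 0).
    elim: m => [_|m ih mn].
      by rewrite /p mul0r mulr0 !subrr normr0 mulr0.
    have -> : F (p m.+1) - F 0 = (F (p m.+1) - F (p m)) + (F (p m) - F 0) by ring.
    apply: le_trans (ler_normD _ _) _.
    have h1 := ih (ltnW mn).
    have := H (p m) (p m.+1) (pi0 m) _ _.
    rewrite pS => h2; apply: le_trans (lerD (h2 _ _) h1) _.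
    - by rewrite -subr_ge0 pS mulr_ge0// invr_ge0.
    - by rewrite /p ler_piMr// ler_pdivrMr// mul1r ler_nat.
    - by rewrite le_eqVlt; apply/orP; left; apply/eqP; ring.
  have := G n.+1 (leqnn _); rewrite /p mulfV// mulr1 => /le_trans; apply.
  by rewrite /b le_eqVlt; apply/orP; left; apply/eqP; ring.
apply: le_anti; rewrite a0 andbT.
have c1 : (fun n => n.+1%:R^-1 * b) @ \oo --> (0 : R).
  rewrite -[X in _ --> X](mul0r b); apply: cvgM; last exact: cvg_cst.
  exact: cvg_harmonic.
rewrite -(cvg_lim _ c1)//; apply: limr_ge; first by apply/cvg_ex; exists 0.
exact: nearW.
Qed.

End Energy.

Section EnergyIdentity.
Variable R : realType.
Local Notation line := (measurableTypeR R).
Local Notation leb := (@lebesgue_measure R).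
Implicit Types (u v w z h : vfield R) (vt wt zt : R -> vfield R) (tau t s : R).
Local Notation Itv tau := ([set` `[0%R, tau]%R] : set line).
Local Notation Inc s t := ([set` `]s, t]%R] : set line).

Lemma rint_sub tau s t (f : R -> R) : 0 <= s -> t <= tau ->
  rint leb (Itv tau) f -> rint leb (Inc s t) f.
Proof.
move=> s0 tt; apply: integrableS => // r /=; rewrite !in_itv/= => /andP[sr rt].
by rewrite (le_trans s0 (ltW sr)) (le_trans rt tt).
Qed.

Lemma rint_init tau t (f : R -> R) : t <= tau ->
  rint leb (Itv tau) f -> rint leb (Itv t) f.
Proof.
move=> tt; apply: integrableS => // r /=; rewrite !in_itv/= => /andP[-> rt].
by rewrite (le_trans rt tt).
Qed.

Lemma Rintegral_increment tau s t (f : R -> R) : 0 <= s -> s <= t -> t <= tau ->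
  rint leb (Itv tau) f ->
  \int[leb]_(r in `[0, t]) f r - \int[leb]_(r in `[0, s]) f r =
  \int[leb]_(r in `]s, t]) f r.
Proof.
move=> s0 st tt fi; apply: Rintegral_itvB; rewrite ?bnd_simp//.
exact: rint_init fi.
Qed.

Lemma Rintegral_increment_ge0 tau s t (f : R -> R) : 0 <= s -> s <= t -> t <= tau ->
  rint leb (Itv tau) f -> (forall r, 0 <= f r) ->
  \int[leb]_(r in `[0, s]) f r <= \int[leb]_(r in `[0, t]) f r.
Proof.
move=> s0 st tt fi f0; rewrite -subr_ge0 (Rintegral_increment s0 st tt fi).
exact: Rintegral_ge0.
Qed.

Lemma energy_identity tau zt wt : 0 <= tau -> C0V tau zt -> L2H tau wt ->
  is_time_derivative tau zt wt ->
  normH (zt tau) ^+ 2 - normH (zt 0) ^+ 2 =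
  2 * \int[leb]_(s in `[0, tau]) ip (wt s) (zt s).
Proof.
move=> tau0 hz hw der.
have zH t : 0 <= t -> t <= tau -> inH (zt t).
  by move=> t0 t1; apply: (C0V_H hz); rewrite in_itv/= t0 t1.
have z2 t : 0 <= t -> t <= tau -> L2fam (zt t) by move=> t0 t1; exact/inH_L2fam/zH.
have wH t : 0 <= t -> t <= tau -> L2fam (wt t).
  by move=> t0 t1; apply: inH_L2fam; case: hw => -[+ _] _; apply; rewrite /= in_itv/= t0 t1.
have riz := rint_ip_C0V hw hz.
have rih h : inH h -> rint leb (Itv tau) (fun s => ip (wt s) h).
  move=> hh; have m1 : measurable_fun (Itv tau) (fun t => ip (wt t) h).
    by apply: measurable_ip_weak => //; case: hw.
  apply: (@rint_ip _ tau wt (fun=> h)) => //.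
  apply: (@bounded_sqint _ _ _ leb (Itv tau) _ _ `|normH h|) => //.
  by rewrite /= lebesgue_measure_itv /=; case: ifP => _; rewrite ?ltry.
have sw := L2H_sqint hw; have [_ rw2] := sw.
have rw : rint leb (Itv tau) (fun s => normH (wt s)).
  have s1 : sqint leb (Itv tau) (cst 1).
    apply: (@bounded_sqint _ _ _ leb (Itv tau) _ _ 1) => //.
      by rewrite /= lebesgue_measure_itv /=; case: ifP => _; rewrite ?ltry.
    by move=> x _; rewrite /= normr1.
  have mI : measurable (Itv tau) by exact: measurable_itv.
  by have := sqintM mI sw s1; apply: eq_rint => // x _; rewrite mulr1.
have incr h s t : inH h -> 0 <= s -> s <= t -> t <= tau ->
    ip (fun i x => zt t i x - zt s i x) h = \int[leb]_(r in `]s, t]) ip (wt r) h.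
  move=> hh s0 st tt; have t0 := le_trans s0 st; have sT := le_trans st tt.
  rewrite ipBl//; [|exact: z2|exact: z2|exact: inH_L2fam].
  rewrite -(Rintegral_increment s0 st tt (rih _ hh)).
  by rewrite (der h hh t) ?(der h hh s) ?in_itv/= ?t0 ?s0//; ring.
pose g t := \int[leb]_(r in `[0, t]) normH (wt r).
pose k t := \int[leb]_(r in `[0, t]) normH (wt r) ^+ 2.
(* The increment of z is itself a fixed field of H; testing with it and dividing by its norm gives
   the bound by the integral of |z'|. *)
have lip s t : 0 <= s -> s <= t -> t <= tau ->
    normH (fun i x => zt t i x - zt s i x) <= g t - g s.
  move=> s0 st tt; have t0 := le_trans s0 st; have sT := le_trans st tt.
  set d := fun i x => zt t i x - zt s i x.
  have hd : inH d by apply: inHB; exact: zH.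
  have hd2 := inH_L2fam hd.
  have gts : 0 <= g t - g s.
    by rewrite subr_ge0; apply: (Rintegral_increment_ge0 s0 st tt rw) => r; exact: normH_ge0.
  have [d0|d0] := eqVneq (normH d) 0; first by rewrite d0.
  have dp : 0 < normH d by rewrite lt_neqAle eq_sym d0 normH_ge0.
  rewrite -(ler_pM2r dp) -expr2 normH_sqr// {1}/d incr//.
  rewrite /g (Rintegral_increment s0 st tt rw) -RintegralZr//; last exact: rint_sub rw.
  have ri := rint_sub s0 tt (rih _ hd).
  apply: le_Rintegral => //.
    have mI : measurable (Inc s t) by exact: measurable_itv.
    by have := rintZ mI (normH d) (rint_sub s0 tt rw); apply: eq_rint => // r _; rewrite mulrC.
  move=> r; rewrite /= in_itv/= => /andP[sr rt].
  apply: le_trans (ler_norm _) _; apply: ip_cauchy_schwarz => //.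
  by apply: wH; [exact: le_trans s0 (ltW sr)|exact: le_trans rt tt].
pose F t := normH (zt t) ^+ 2 - 2 * \int[leb]_(s in `[0, t]) ip (wt s) (zt s).
suff : F tau = F 0.
  by rewrite /F set_itv1 Rintegral_set1 mulr0 subr0 => <-; ring.
apply: (@quadratic_increments_const _ _ k _ 2) => // s t s0 st tt.
have t0 := le_trans s0 st; have sT := le_trans st tt.
have hzs := z2 s s0 sT; have hzt := z2 t t0 tt.
have hsum : inH (fun i x => zt t i x + zt s i x) by apply: inHD; exact: zH.
(* The difference of squares is the increment of z paired with the fixed field z(t) + z(s), to which
   [incr] applies. *)
have FE : F t - F s = \int[leb]_(r in `]s, t])
    (ip (wt r) (fun i x => zt t i x + zt s i x) - 2 * ip (wt r) (zt r)).
  rewrite RintegralB//; last 2 first.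
  - exact: rint_sub s0 tt (rih _ hsum).
  - by apply: rintZ => //; exact: rint_sub riz.
  rewrite RintegralZl//; last exact: rint_sub riz.
  rewrite -incr// -(Rintegral_increment s0 st tt riz) /F !normH_sqr//.
  rewrite ipBl// ?ipDr//; last exact: L2famD.
  rewrite (ipC (zt s) (zt t)); ring.
have gts : 0 <= g t - g s.
  by rewrite subr_ge0; apply: (Rintegral_increment_ge0 s0 st tt rw) => r; exact: normH_ge0.
have rF : rint leb (Inc s t) (fun r =>
    ip (wt r) (fun i x => zt t i x + zt s i x) - 2 * ip (wt r) (zt r)).
  apply: rintB => //; first exact: rint_sub s0 tt (rih _ hsum).
  by apply: rintZ => //; exact: rint_sub riz.
have b1 : `|F t - F s| <= 2 * (g t - g s) ^+ 2.
  rewrite FE; apply: le_trans (le_normr_Rintegral _ rF) _ => //.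
  have -> : 2 * (g t - g s) ^+ 2 = (2 * (g t - g s)) * (g t - g s) by ring.
  rewrite {2}/g [X in _ <= _ * X](Rintegral_increment s0 st tt rw).
  rewrite -RintegralZl//; last exact: rint_sub rw.
  apply: le_Rintegral => //; first exact: rint_norm.
    by apply: rintZ => //; exact: rint_sub rw.
  move=> r; rewrite /= in_itv/= => /andP[sr rt].
  have r0 := le_trans s0 (ltW sr); have rT := le_trans rt tt.
  have hw' := wH r r0 rT; have hzr := z2 r r0 rT.
  (* z(t) + z(s) - 2 z(r) is a difference of two increments, each small by [lip]; this is the second
     factor of g(t) - g(s). *)
  have -> : ip (wt r) (fun i x => zt t i x + zt s i x) - 2 * ip (wt r) (zt r) =
      ip (wt r) (fun i x => zt t i x - zt r i x) -
      ip (wt r) (fun i x => zt r i x - zt s i x).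
    by rewrite !ipBr// ipDr//; ring.
  apply: le_trans (ler_normB _ _) _.
  have c1 := ip_cauchy_schwarz hw' (L2famB hzt hzr).
  have c2 := ip_cauchy_schwarz hw' (L2famB hzr hzs).
  have l1 := lip r t r0 rt tt; have l2 := lip s r s0 (ltW sr) rT.
  have m1 := ler_wpM2l (normH_ge0 (wt r)) (lerD l1 l2).
  have g1 := Rintegral_increment_ge0 s0 (ltW sr) rT rw (fun r => normH_ge0 (wt r)).
  have g2 := Rintegral_increment_ge0 r0 rt tt rw (fun r => normH_ge0 (wt r)).
  have := normH_ge0 (wt r); move: c1 c2 m1 g1 g2; rewrite -/(g s) -/(g r) -/(g t).
  nra.
apply: le_trans b1 _; rewrite -mulrA; apply: ler_wpM2l => //.
have si : sqint leb (Inc s t) (fun r => normH (wt r)).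
  split; last exact: rint_sub rw2.
  by case: sw => mw _; apply: (rint_measurable (rint_sub s0 tt rw)).
have s1 : sqint leb (Inc s t) (cst 1).
  apply: (@bounded_sqint _ _ _ leb (Inc s t) _ _ 1) => //.
    by rewrite /= lebesgue_measure_itv /=; case: ifP => _; rewrite ?ltry.
  by move=> x _; rewrite /= normr1.
have mI : measurable (Inc s t) by exact: measurable_itv.
(* Cauchy-Schwarz against the constant 1 trades the square of the integral of |z'| for (t - s) times
   the integral of |z'|^2, the shape that [quadratic_increments_const] asks for. *)
have := integral_cauchy_schwarz mI si s1.
have -> : \int[leb]_(r in `]s, t]) (normH (wt r) * cst 1 r) = g t - g s.
  rewrite (Rintegral_increment s0 st tt rw).
  by apply: eq_Rintegral => r _; rewrite mulr1.
have -> : \int[leb]_(r in `]s, t]) cst 1 r ^+ 2 = t - s.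
  under eq_Rintegral do rewrite /= expr1n.
  rewrite Rintegral_cst// mul1r; apply: (congr1 fine (_ : _ = (t - s)%:E)).
  rewrite /= lebesgue_measure_itv /= lte_fin -EFinB; case: ltP => // ts.
  by have -> : s = t by [apply: le_anti; rewrite st ts]; rewrite subrr.
rewrite -(Rintegral_increment s0 st tt rw2) -/(k t) -/(k s) => H.
have kts : 0 <= k t - k s.
  by rewrite subr_ge0; apply: (Rintegral_increment_ge0 s0 st tt rw2) => r; exact: sqr_ge0.
move: H; rewrite ger0_norm// => H.
have ts : 0 <= t - s by rewrite subr_ge0.
have : (g t - g s) ^+ 2 <= (Num.sqrt (k t - k s) * Num.sqrt (t - s)) ^+ 2.
  by apply: lerXn2r => //; rewrite nnegrE ?mulr_ge0 ?sqrtr_ge0.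
by rewrite exprMn !sqr_sqrtr// mulrC.
Qed.

End EnergyIdentity.

(** * The energy estimates *)

Section Sensitivity.
Variable R : realType.
Local Notation line := (measurableTypeR R).
Local Notation leb := (@lebesgue_measure R).
Implicit Types (u v w z h b : vfield R) (vt wt zt : R -> vfield R) (tau t s : R).
Local Notation Itv tau := ([set` `[0%R, tau]%R] : set line).

(* Young's inequality absorbs the low modes into the damping and the high modes
   into the dissipation. *)
Lemma stretching_absorbed (hnu mu c n zH zV zP : R) :
  0 < hnu -> 0 < mu -> 0 < n -> 0 <= c -> 0 <= zH -> 0 <= zV -> 0 <= zP ->
  4 * c ^+ 2 / mu <= hnu -> 2 * c / n <= hnu ->
  n ^+ 2 * (zH ^+ 2 - zP ^+ 2) <= zV ^+ 2 ->
  c * zV * zH <= hnu / 2 * zV ^+ 2 + mu / 2 * zP ^+ 2.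
Proof.
move=> hnu0 mu0 n0 c0 zH0 zV0 zP0; rewrite !ler_pdivrMr// => h1 h2 h3.
(* Everything is multiplied by hnu to avoid divisions. *)
have young : hnu * (c * zV * zH) <= hnu ^+ 2 / 4 * zV ^+ 2 + c ^+ 2 * zH ^+ 2.
  rewrite -subr_ge0; have -> : hnu ^+ 2 / 4 * zV ^+ 2 + c ^+ 2 * zH ^+ 2 -
    hnu * (c * zV * zH) = (hnu / 2 * zV - c * zH) ^+ 2 by field.
  exact: sqr_ge0.
have low : c ^+ 2 * zP ^+ 2 <= hnu * mu / 4 * zP ^+ 2.
  by apply: ler_wpM2r; [exact: sqr_ge0|lra].
have cn : c ^+ 2 <= hnu ^+ 2 / 4 * n ^+ 2.
  have -> : hnu ^+ 2 / 4 * n ^+ 2 = (hnu * n / 2) ^+ 2 by field.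
  apply: lerXn2r; rewrite ?nnegrE//; last by lra.
  by rewrite divr_ge0// mulr_ge0// ltW.
have high : c ^+ 2 * (zH ^+ 2 - zP ^+ 2) <= hnu ^+ 2 / 4 * zV ^+ 2.
  (* For abstract reals the high-mode part may be negative; the claim is then trivial. *)
  have [d0|d0] := leP (zH ^+ 2 - zP ^+ 2) 0.
    apply: (@le_trans _ _ 0); first by rewrite mulr_ge0_le0 ?sqr_ge0.
    by apply: mulr_ge0; [rewrite divr_ge0 ?sqr_ge0|exact: sqr_ge0].
  apply: le_trans (ler_wpM2r (ltW d0) cn) _.
  rewrite -[leLHS]mulrA; apply: ler_wpM2l h3.
  by rewrite divr_ge0 ?sqr_ge0.
have muP : 0 <= hnu * (mu * zP ^+ 2).
  by apply: mulr_ge0; [exact: ltW|apply: mulr_ge0; [exact: ltW|exact: sqr_ge0]].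
rewrite -(ler_pM2l hnu0); lra.
Qed.

(** The hypothesis gives zH <= zP + zV / n, and Young's inequality is applied to each part. The
    weight hnu/4 on zV^2 is half of the dissipation kept in the lower bound, so that half of W can
    absorb it. *)
Lemma work_absorbed (hnu mu n a zH zV zP : R) :
  0 < hnu -> 0 < mu -> 0 < n -> 0 <= a -> 0 <= zH -> 0 <= zV -> 0 <= zP ->
  n ^+ 2 * (zH ^+ 2 - zP ^+ 2) <= zV ^+ 2 ->
  a * zH <= mu / 2 * zP ^+ 2 + hnu / 4 * zV ^+ 2 +
            (mu^-1 / 2 + (hnu * n ^+ 2)^-1) * a ^+ 2.
Proof.
move=> hnu0 mu0 n0 a0 zH0 zV0 zP0 h.
have zHle : zH <= zP + zV / n.
  rewrite -ler_sqr ?nnegrE//; last by rewrite addr_ge0// divr_ge0// ltW.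
  have : zH ^+ 2 <= zP ^+ 2 + (zV / n) ^+ 2.
    by rewrite addrC -lerBlDr expr_div_n ler_pdivlMr ?exprn_gt0// mulrC.
  by have := mulr_ge0 zP0 (divr_ge0 zV0 (ltW n0)); move: (zV / n) => q; nra.
apply: le_trans (ler_wpM2l a0 zHle) _; rewrite mulrDr.
have y1 : a * zP <= mu / 2 * zP ^+ 2 + mu^-1 / 2 * a ^+ 2.
  rewrite -subr_ge0; have -> : mu / 2 * zP ^+ 2 + mu^-1 / 2 * a ^+ 2 - a * zP =
    mu^-1 / 2 * (mu * zP - a) ^+ 2 by field; rewrite gt_eqF.
  by rewrite mulr_ge0 ?sqr_ge0// divr_ge0// invr_ge0 ltW.
have y2 : a * (zV / n) <= hnu / 4 * zV ^+ 2 + (hnu * n ^+ 2)^-1 * a ^+ 2.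
  rewrite -subr_ge0.
  have -> : hnu / 4 * zV ^+ 2 + (hnu * n ^+ 2)^-1 * a ^+ 2 - a * (zV / n) =
    hnu^-1 * (hnu / 2 * zV - a / n) ^+ 2 by field; rewrite !gt_eqF.
  by rewrite mulr_ge0 ?sqr_ge0// invr_ge0 ltW.
lra.
Qed.

(** Stated on abstract reals so that [lra] meets variables only. *)
Lemma energy_balance_le (hnu mu iw ia ib iP iq nV nP s k1 k2 : R) :
  iw + hnu * ia + ib = - (mu * iP) - iq -> ib = s -> ia = nV -> iP = nP ->
  `|s| <= k1 -> k1 <= k2 -> k2 <= hnu / 2 * nV + mu / 2 * nP ->
  iw + (hnu / 2 * nV + mu / 2 * nP) <= - iq.
Proof.
move=> + eb ea eP; rewrite eb ea eP => E.
by rewrite ler_norml => /andP[h _]; lra.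
Qed.

Lemma ip_balance (c m : R) w a b p q z :
  L2fam w -> L2fam a -> L2fam b -> L2fam p -> L2fam q -> L2fam z ->
  eq_ae (fun i x => w i x + c * a i x + b i x) (fun i x => - (m * p i x) - q i x) ->
  ip w z + c * ip a z + ip b z = - (m * ip p z) - ip q z.
Proof.
move=> hw ha hb hp hq hz e.
have hca := L2famZ c ha; have hwca := L2famD hw hca.
have rE : (fun i x => - (m * p i x) - q i x) = (fun i x => (- m) * p i x - q i x).
  by apply/funext => i; apply/funext => x; rewrite mulNr.
have hmp := L2famZ (- m) hp.
rewrite -ipZl// -ipDl// -ipDl// -mulNr -ipZl// -ipBl//.
by rewrite rE in e; apply: eq_ae_ip => //; [exact: L2famD|exact: L2famB].
Qed.

(** The energy inequality at one instant, before integration in time. *)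
Lemma sensitivity_dissipation (cL hnu mu V1 : R) N v z w b :
  0 < cL -> ladyzhenskaya cL -> 0 < hnu -> 0 < mu -> (0 < N)%N ->
  inV v -> normV v <= V1 -> inH (A v) -> inDA z -> inH (A z) -> inH w ->
  4 * (cL * V1) ^+ 2 / mu <= hnu -> 2 * (cL * V1) / N%:R <= hnu ->
  is_DB v z b ->
  eq_ae (fun i x => w i x + hnu * A z i x + b i x)
        (fun i x => - (mu * PN N z i x) - A v i x) ->
  ip w z + (hnu / 2 * normV z ^+ 2 + mu / 2 * normH (PN N z) ^+ 2) <= - ip (A v) z.
Proof.
move=> cL0 lad hnu0 mu0 N0 hv vV1 hAv hz hAz hw c1 c2 [b1 [b2 [hb1 hb2 bE]]] e.
have zV : inV z by case: hz.
have zH := inV_H zV; have z2 := inH_L2fam zH.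
have hAv2 := inH_L2fam hAv; have hAz2 := inH_L2fam hAz; have hw2 := inH_L2fam hw.
have hP := PN_L2fam N z2.
have [adv1 b1H leray1] := hb1; have [adv2 b2H leray2] := hb2.
have b12 := inH_L2fam b1H; have b22 := inH_L2fam b2H.
(* Since z lies in H, pairing with it does not see the Leray projection. *)
have b1z : ip b1 z = 0.
  have := leray1 z zH; rewrite ipBl//; last exact/inL2v_L2fam.
  by rewrite (advection_skew cL0 lad hv zV adv1) sub0r => /eqP; rewrite oppr_eq0 => /eqP.
have b2z : ip b2 z = ip (advection z v) z.
  have := leray2 z zH; rewrite ipBl//; last exact/inL2v_L2fam.
  by move/eqP; rewrite subr_eq0 => /eqP.
have hb : L2fam b by rewrite bE; exact: L2famD.
have bz : ip b z = ip (advection z v) z by rewrite bE ipDl// b1z b2z add0r.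
have E := ip_balance hw2 hAz2 hb hP hAv2 z2 e.
have eA := ip_A hz; have eP := ip_PN N z2.
have stretch := advection_bound cL0 lad zV hv adv2.
have V10 : 0 <= V1 := le_trans (normV_ge0 v) vV1.
have absorbed := stretching_absorbed hnu0 mu0 (_ : 0 < N%:R) (mulr_ge0 (ltW cL0) V10)
  (normH_ge0 z) (normV_ge0 z) (normH_ge0 (PN N z)) c1 c2 (normH_high N zV).
have {}absorbed := absorbed (_ : 0 < N%:R); rewrite ltr0n in absorbed.
have {}absorbed := absorbed N0.
have mono : cL * normV z * normH z * normV v <= cL * V1 * normV z * normH z.
  have -> : cL * V1 * normV z * normH z = cL * normV z * normH z * V1 by ring.
  by apply: ler_wpM2l; rewrite // !mulr_ge0 ?normV_ge0 ?normH_ge0 ?ltW.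
exact: (energy_balance_le E bz eA eP stretch mono absorbed).
Qed.

(** The instantaneous estimates integrated in time. The upper bound still contains the dissipation;
    the integrated Poincare inequality in the third conjunct serves the case mu <= hnu N^2 / 2. *)
Lemma sensitivity_bounds (tau mu hnu cL : R) (N : nat) (f u vt zt : R -> vfield R)
    (v0 : vfield R) :
  0 < tau -> 0 < mu -> 0 < hnu -> (0 < N)%N -> 0 < cL -> ladyzhenskaya cL ->
  nudged tau hnu mu N f u v0 vt -> sensitivity tau hnu mu N vt zt ->
  let V1 := sup [set normV (vt t) | t in `[0, tau]] in
  let G := \int[leb]_(t in `[0, tau]) normH (PN N (zt t)) ^+ 2 in
  let IA := \int[leb]_(t in `[0, tau]) normH (A (vt t)) ^+ 2 in
  let IH := \int[leb]_(t in `[0, tau]) normH (zt t) ^+ 2 in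
  let IV := \int[leb]_(t in `[0, tau]) normV (zt t) ^+ 2 in
  4 * cL ^+ 2 * V1 ^+ 2 / mu <= hnu -> 2 * cL * V1 / N%:R <= hnu ->
  [/\ 2^-1 * normH (zt tau) ^+ 2 + hnu / 2 * IV + mu / 2 * G <= W tau vt zt,
      W tau vt zt <= mu / 2 * G + hnu / 4 * IV +
                     (mu^-1 / 2 + (hnu * N%:R ^+ 2)^-1) * IA,
      N%:R ^+ 2 * (IH - G) <= IV &
      [/\ 0 <= G, 0 <= IA & 0 <= IV]].
Proof.
move=> tau0 mu0 hnu0 N0 cL0 lad [_ [wv [[cv /[dup] /L2DA_ae dav [_ hAv] _ _] _]]].
move=> [z0 [wz [[cz /[dup] /L2DA_ae daz [_ hAz] hwz der] eqz]]] V1 G IA IH IV c1 c2.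
have mI : measurable (Itv tau) by exact: measurable_itv.
have [_ rV] := within_sqint (C0V_normV cz).
have [_ rH] := within_sqint (C0V_normH cz).
have [_ rP] := within_sqint (C0V_normH_PN (N := N) cz).
have [_ rA] := L2H_sqint hAv.
have rw := rint_ip_C0V hwz cz; have rAz := rint_ip_C0V hAv cz.
have zV t : t \in `[0, tau] -> inV (zt t) by case: cz => + _; apply.
have nN : 0 < N%:R :> R by rewrite ltr0n.
(* The initial field vanishes only almost everywhere in space. *)
have z00 : normH (zt 0) = 0.
  have D0 : (0 : R) \in `[0, tau] by rewrite in_itv/= lexx ltW.
  have hz0 := inV_L2fam (zV 0 D0).
  have h0 : L2fam ((fun _ _ => 0) : vfield R)
    by move=> i; apply: L2_continuous; exact: cst_continuous.
  rewrite /normH (eq_ae_ip hz0 h0 hz0 z0) ip_fip// /fip big1 ?sqrtr0// => i _.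
  by rewrite /inner; under eq_Rintegral do rewrite mul0r; rewrite Rintegral0.
have energy := energy_identity (ltW tau0) cz hwz der.
have WE : W tau vt zt = \int[leb]_(t in `[0, tau]) (- ip (A (vt t)) (zt t)).
  by rewrite /W RintegralN.
split.
- have : \int[leb]_(t in `[0, tau]) (ip (wz t) (zt t) +
     (hnu / 2 * normV (zt t) ^+ 2 + mu / 2 * normH (PN N (zt t)) ^+ 2)) <= W tau vt zt.
    rewrite WE; apply: ae_le_Rintegral => //.
    + apply: rintD => //; apply: rintD => //; exact: rintZ.
    + exact: rintN.
    suff : {ae leb, forall t : R, t \in `[0, tau] -> ip (wz t) (zt t) +
      (hnu / 2 * normV (zt t) ^+ 2 + mu / 2 * normH (PN N (zt t)) ^+ 2) <=
      - ip (A (vt t)) (zt t)} by [].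
    apply: filterS2 daz eqz => t zDA H tD; have [b [hb e]] := H tD.
    apply: (@sensitivity_dissipation cL _ _ V1 _ _ _ _ b) => //.
    + by case: cv => + _; apply.
    + exact: C0V_normV_sup.
    + by case: hAv => -[+ _] _; apply.
    + exact: zDA.
    + by case: hAz => -[+ _] _; apply.
    + by case: hwz => -[+ _] _; apply.
    + by rewrite exprMn mulrA.
    + by rewrite mulrA.
  rewrite RintegralD//; last by apply: rintD => //; exact: rintZ.
  rewrite RintegralD//; [|exact: rintZ..].
  rewrite !RintegralZl// -/IV -/G; move: energy; rewrite z00 expr0n /= subr0; lra.
- have -> : mu / 2 * G + hnu / 4 * IV + (mu^-1 / 2 + (hnu * N%:R ^+ 2)^-1) * IA =
      \int[leb]_(t in `[0, tau]) (mu / 2 * normH (PN N (zt t)) ^+ 2 +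
        hnu / 4 * normV (zt t) ^+ 2 +
        (mu^-1 / 2 + (hnu * N%:R ^+ 2)^-1) * normH (A (vt t)) ^+ 2).
    rewrite RintegralD//; [|by apply: rintD => //; exact: rintZ|exact: rintZ].
    by rewrite RintegralD//; [|exact: rintZ..]; rewrite !RintegralZl.
  rewrite WE; apply: le_Rintegral => //.
  + exact: rintN.
  + by apply: rintD => //; [apply: rintD => //; exact: rintZ|exact: rintZ].
  move=> t tD; have hz := zV t tD.
  have hA : inH (A (vt t)) by case: hAv => -[+ _] _; apply.
  apply: le_trans (work_absorbed hnu0 mu0 nN (normH_ge0 _) (normH_ge0 _) (normV_ge0 _)
    (normH_ge0 _) (normH_high N hz)).
  apply: le_trans (ler_norm _) _; rewrite normrN.
  by apply: ip_cauchy_schwarz; [exact: inH_L2fam|exact: inV_L2fam].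
- rewrite -RintegralB// -RintegralZl//; last exact: rintB.
  apply: le_Rintegral => //; first by apply: rintZ => //; exact: rintB.
  by move=> t tD; apply: normH_high; exact: zV.
- by split; apply: Rintegral_ge0 => t _; exact: sqr_ge0.
Qed.

End Sensitivity.

Theorem proposition3p3 (R : realType) (tau : R) (htau : 0 < tau) :
  (forall v1 v2 : R -> vfield R, L2DA tau v1 -> L2H tau v2 ->
     [/\ (@lebesgue_measure R).-integrable `[0, tau]
           (fun t => (ip (A (v1 t)) (v2 t))%:E),
         (forall v1' v2' : R -> vfield R, L2DA tau v1' -> L2H tau v2' ->
            {ae (@lebesgue_measure R), forall t, t \in `[0, tau] ->
               eq_ae (v1' t) (v1 t) /\ eq_ae (v2' t) (v2 t)} ->
            W tau v1' v2' = W tau v1 v2) &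
         `|W tau v1 v2| <=
           Num.sqrt (\int[@lebesgue_measure R]_(t in `[0, tau])
                       normH (A (v1 t)) ^+ 2) *
           Num.sqrt (\int[@lebesgue_measure R]_(t in `[0, tau])
                       normH (v2 t) ^+ 2)]) /\
  (forall (nu mu hnu cL : R) (N : nat) (f u v hv : R -> vfield R)
          (u0 v0 : vfield R),
     0 < nu -> 0 < mu -> 0 < hnu -> (0 < N)%N ->
     0 < cL -> ladyzhenskaya cL ->
     LinftyH f -> inV u0 -> inV v0 ->
     (forall T : R, 0 < T -> navier_stokes T nu f u0 u) ->
     nudged tau hnu mu N f u v0 v ->
     sensitivity tau hnu mu N v hv ->
     let V1 := sup [set normV (v t) | t in `[0, tau]] in
     let Wv := W tau v hv in
     let G := \int[@lebesgue_measure R]_(t in `[0, tau])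
                normH (PN N (hv t)) ^+ 2 in
     let IA := \int[@lebesgue_measure R]_(t in `[0, tau])
                 normH (A (v t)) ^+ 2 in
     let IH := \int[@lebesgue_measure R]_(t in `[0, tau])
                 normH (hv t) ^+ 2 in
     let IV := \int[@lebesgue_measure R]_(t in `[0, tau])
                 normV (hv t) ^+ 2 in
     Num.max (4 * cL ^+ 2 * V1 ^+ 2 / mu) (2 * cL * V1 / N%:R) <= hnu ->
     (2^-1 * normH (hv tau) ^+ 2 + hnu / 2 * IV + mu / 2 * G <= Wv /\
      Wv <= mu * G + (mu^-1 + 2 / (hnu * N%:R ^+ 2)) * IA) /\
     (mu <= 2^-1 * hnu * N%:R ^+ 2 ->
      2^-1 * normH (hv tau) ^+ 2 + hnu / 4 * IV + mu / 2 * IH <= Wv /\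
      Wv <= mu * G + 2 / mu * IA)).
Proof.
split=> [v1 v2 h1 h2|nu mu hnu cL N f u v hv u0 v0 _ mu0 hnu0 N0 cL0 lad _ _ _ _ nud sens].
  split.
  - by apply: rint_ip_L2H => //; case: h1.
  - by move=> v1' v2' h1' h2' e; exact: W_eq_ae.
  - by rewrite /W normrN; apply: Rintegral_ip_cauchy_schwarz => //; case: h1.
move=> V1 Wv G IA IH IV; rewrite ge_max => /andP[c1 c2].
have [lower upper gap [G0 IA0 IV0]] :=
  sensitivity_bounds htau mu0 hnu0 N0 cL0 lad nud sens c1 c2.
rewrite -/Wv -/G -/IA -/IH -/IV in lower upper gap G0 IA0 IV0.
have nN : 0 < N%:R ^+ 2 :> R by rewrite exprn_gt0// ltr0n.
have z0 := sqr_ge0 (normH (hv tau)).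
have muG := mulr_ge0 (ltW mu0) G0.
(* Half of [lower] gives hnu/4 IV <= Wv/2 - mu/4 G; inserting it into [upper] and doubling yields
   the constants. *)
have bound : Wv <= mu * G + (mu^-1 + 2 / (hnu * N%:R ^+ 2)) * IA.
  move: upper lower; set q := (hnu * _)^-1; set r := mu^-1.
  have hIV := mulr_ge0 (ltW hnu0) IV0; lra.
split=> [//|muN]; split.
(* Hence half of the dissipation pays for replacing mu/2 G by mu/2 IH, which leaves hnu/4 IV. *)
- have step : mu * (IH - G) <= hnu / 2 * IV.
    rewrite -(ler_pM2l nN).
    have -> : N%:R ^+ 2 * (mu * (IH - G)) = mu * (N%:R ^+ 2 * (IH - G)) by ring.
    apply: le_trans (ler_wpM2l (ltW mu0) gap) _.
    by apply: le_trans (ler_wpM2r IV0 muN) _; rewrite le_eqVlt; apply/orP; left; apply/eqP; field.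
  lra.
(* The extra hypothesis says exactly that 2 / (hnu N^2) <= 1 / mu. *)
- apply: le_trans bound _; rewrite lerD2l; apply: ler_wpM2r => //.
  have : 2 / (hnu * N%:R ^+ 2) <= mu^-1.
    have hN : 0 < hnu * N%:R ^+ 2 by exact: mulr_gt0.
    rewrite (ler_pdivrMr _ _ hN) -(ler_pM2l mu0) mulrA mulfV ?gt_eqF// mul1r.
    by lra.
  have -> : 2 / mu = mu^-1 + mu^-1 by field; rewrite gt_eqF.
  by rewrite lerD2l.
Qed.
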